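(* Let $\mathcal S^1\subset \mathcal P(B(H_1))\times\mathcal P(B(H_2))$ and $\mathcal S^2\subset \mathcal P(B(K_1))\times\mathcal P(B(K_2))$ be isomorphic, strongly closed commutative bilattices, and let $\mathcal U_1=\mathfrak M(\mathcal S^1)\subset B(H_1,H_2)$ and $\mathcal U_2=\mathfrak M(\mathcal S^2)\subset B(K_1,K_2)$, where $\mathcal U_1$ and $\mathcal U_2$ are nondegenerate. Then $\mathcal U_1$ and $\mathcal U_2$ are spatially Morita equivalent.
   Context: $H_i,K_i$ ($i=1,2$) are Hilbert spaces; $B(H_1,H_2)$ is the space of bounded operators from $H_1$ into $H_2$ and $B(H)=B(H,H)$; $\mathcal P(B(H))$ is the set of orthogonal projections of $H$. For a set $\mathcal X$ of operators, $[\mathcal X]$ is the weak* closure of the linear span of $\mathcal X$; products of sets of operators are the sets of products. A masa is a maximal abelian selfadjoint algebra. If $\mathcal D_i$ is a masa acting on $H_i$, $i=1,2$, a subspace $\mathcal U\subset B(H_1,H_2)$ with $\mathcal D_2\mathcal U\mathcal D_1\subset\mathcal U$ is called a masa bimodule (a bimodule over these masas). A space $\mathcal U\subset B(H_1,H_2)$ is nondegenerate if $\mathcal U(H_1)$ is dense in $H_2$ and $\mathcal U^*(H_2)$ is dense in $H_1$. A set $\mathcal S\subset\mathcal P(B(H_1))\times\mathcal P(B(H_2))$ is a bilattice if $(0,0),(I,0),(0,I)\in\mathcal S$ and whenever $(P_1,Q_1),(P_2,Q_2)\in\mathcal S$, then $(P_1\wedge P_2,Q_1\vee Q_2),(P_1\vee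 P_2,Q_1\wedge Q_2)\in\mathcal S$. Put $\mathcal S_l=\{P:(P,Q)\in\mathcal S\}$, $\mathcal S_r=\{Q:(P,Q)\in\mathcal S\}$ and $\mathfrak M(\mathcal S)=\{T\in B(H_1,H_2): QTP=0\ \forall (P,Q)\in\mathcal S\}$. The bilattice $\mathcal S$ is commutative if the elements of $\mathcal S_l$ commute with one another and so do the elements of $\mathcal S_r$; it is strongly closed if it is closed in the strong operator topology. A CSL is a commuting set of orthogonal projections containing $0$ and $I$ and closed under arbitrary suprema and infima. A CSL homomorphism is a map between CSLs preserving arbitrary suprema and infima. For strongly closed commutative bilattices $\mathcal S^1,\mathcal S^2$, if $\phi:\mathcal S^1_l\to\mathcal S^2_l$ and $\psi:\mathcal S^1_r\to\mathcal S^2_r$ are CSL homomorphisms such that $(\phi(P),\psi(Q))\in\mathcal S^2$ for all $(P,Q)\in\mathcal S^1$, then $\phi\oplus\psi$ is called a bilattice homomorphism from $\mathcal S^1$ to $\mathcal S^2$. If $\phi$ and $\psi$ are 1-1 and onto, $\phi\oplus\psi$ is called a bilattice isomorphism, and $\mathcal S^1,\mathcal S^2$ are isomorphic when such a bilattice isomorphism exists. Spatial Morita equivalence of spaces: fix masas acting on $H_i,K_i$, $i=1,2$, and let $\mathcal U_1\subset B(H_1,H_2)$, $\mathcal U_2\subset B(K_1,K_2)$ be nondegenerate bimodules over these masas. They are called spatially Morita equivalent if there exist bimodules over the same masas $\mathcal V_1\subset B(H_1,K_1)$, $\mathcal V_2\subset B(H_2,K_2)$, $\mathcal W_1\subset B(K_1,H_1)$,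 $\mathcal W_2\subset B(K_2,H_2)$ such that (i) $\mathcal U_1=[\mathcal W_2\mathcal U_2\mathcal V_1]$ and $\mathcal U_2=[\mathcal V_2\mathcal U_1\mathcal W_1]$; and (ii) the spaces $[\mathcal V_1\mathcal W_1],[\mathcal W_1\mathcal V_1],[\mathcal V_2\mathcal W_2],[\mathcal W_2\mathcal V_2]$ are unital algebras.
   Formalization: A bilattice isomorphism is required, besides φ and ψ being 1-1 and onto, to map S^1 onto S^2 via (P,Q) ↦ (φ(P),ψ(Q)); with only φ and ψ bijective the claim fails already for bilattices on C^2. *)

(* Defs.v *)
From HB Require Import structures.
From mathcomp Require Import all_boot all_order all_algebra.
From mathcomp Require Import sesquilinear complex.
From mathcomp Require Import all_classical all_reals.
From mathcomp Require Import topology normedtype sequences.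

Set Implicit Arguments.
Unset Strict Implicit.
Unset Printing Implicit Defensive.

Import Order.TTheory GRing.Theory Num.Theory Num.Def.
Import numFieldNormedType.Exports.

Local Open Scope classical_set_scope.
Local Open Scope complex_scope.
Local Open Scope ring_scope.

(* Complex Hilbert spaces of arbitrary dimension. The inner product is linear
   in its first argument and conjugate-linear in the second. *)
HB.mixin Record CompleteNormedModule_isHilbert (R : realType) V
    & CompleteNormedModule R[i] V := {
  inner : {dot V for (@conjC R[i])} ;
  inner_normE : forall x : V, inner x x = `|x| ^+ 2
}.

#[short(type="hilbertType")]
HB.structure Definition Hilbert (R : realType) :=
  {V of CompleteNormedModule R[i] V & CompleteNormedModule_isHilbert R V}.

Notation "''[' x , y ]" := (inner x y) : ring_scope.

Section BoundedOperators.
Context {R : realType}.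
Implicit Types H K L : hilbertType R.

Definition bounded_linear H K : {pred H -> K} :=
  [pred f | `[< linear f /\
    exists M : R, forall x, `|f x| <= M%:C * `|x| >]].

Arguments bounded_linear : clear implicits.

Record bop H K := Bop {
  bop_fun :> H -> K ;
  bop_funP : bounded_linear H K bop_fun }.

HB.instance Definition _ H K := [isSub for @bop_fun H K].
HB.instance Definition _ H K := [Choice of bop H K by <:].

Lemma bounded_linear_submod H K : submod_closed (bounded_linear H K).
Proof.
split.
  apply/asboolP; split; first by move=> a x y; rewrite scaler0 addr0.
  by exists 0 => x; rewrite normr0 mul0r.
move=> a f g /asboolP[lf [M fM]] /asboolP[lg [N gN]]; apply/asboolP; split.
  move=> b x y; rewrite !fctE lf lg !scalerDr !scalerA (mulrC a b).
  by rewrite -!addrA; congr (_ + _); rewrite addrCA.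
exists (complex.Re `|a| * M + N) => x; rewrite !fctE.
apply: (le_trans (ler_normD _ _)).
rewrite rmorphD rmorphM mulrDl lerD//= normrZ -mulrA.
by rewrite (_ : (Normc.normc a)%:C = `|a|) ?ler_wpM2l// normc_def.
Qed.

HB.instance Definition _ H K :=
  GRing.isSubmodClosed.Build R[i] (H -> K) (bounded_linear H K)
    (bounded_linear_submod H K).
HB.instance Definition _ H K :=
  [SubChoice_isSubLmodule of bop H K by <:].


Lemma bop_linear H K (T : bop H K) : linear T.
Proof. by case: T => f /= /asboolP[]. Qed.

HB.instance Definition _ H K (T : bop H K) :=
  GRing.isLinear.Build R[i] H K _ T (bop_linear T).

Lemma bopP H K (S T : bop H K) : S =1 T <-> S = T.
Proof. by split=> [/funext/val_inj|->]. Qed.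

Lemma idop_bounded_linear H : bounded_linear H H id.
Proof. by apply/asboolP; split=> //; exists 1 => x; rewrite mul1r. Qed.

Definition idop H : bop H H := Bop (idop_bounded_linear H).

Lemma comp_bounded_linear H K L (S : bop K L) (T : bop H K) :
  bounded_linear H L (S \o T).
Proof.
apply/asboolP; split=> [a x y|]; first by rewrite /= !linearP.
case: S T => s /= /asboolP[ls [M sM]] [t /= /asboolP[lt [N tN]]].
exists (`|M| * N) => x; apply: (le_trans (sM _)).
rewrite rmorphM/= -mulrA (le_trans (ler_wpM2r _ _) (ler_wpM2l _ (tN x)))//.
- by rewrite lecR ler_norm.
- by rewrite lecR.
Qed.

Definition compop H K L (S : bop K L) (T : bop H K) : bop H L :=
  Bop (comp_bounded_linear S T).

Definition is_adjoint H K (T : bop H K) (S : bop K H) :=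
  forall x y, '[T x, y] = '[x, S y].

Definition adjoints H K (U : set (bop H K)) : set (bop K H) :=
  [set S | exists2 T, U T & is_adjoint T S].

Definition mulset H K L (A : set (bop K L)) (B : set (bop H K)) :
    set (bop H L) :=
  [set compop S T | S in A & T in B].

Definition op_subspace H K (U : set (bop H K)) :=
  U 0 /\ forall (a : R[i]) S T, U S -> U T -> U (a *: S + T).

Definition unital_algebra H (A : set (bop H H)) :=
  [/\ op_subspace A, mulset A A `<=` A & A (idop H)].

(* The predual of B(H,K) consists of the trace class operators K -> H; each of
   them has the form sum_n <., y_n> x_n with (x_n) and (y_n) square summable,
   and pairs with T to give sum_n <T x_n, y_n>. The weak* topology is the
   initial topology for these functionals. *)
Definition square_summable H (x : H^nat) :=
  cvgn (series (fun n => `|x n| ^+ 2 : R[i]^o)).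

Definition l2_pair H K :=
  {xy : H^nat * K^nat | square_summable xy.1 /\ square_summable xy.2}.

Definition trace_pairing H K (T : bop H K) (w : l2_pair H K) : R[i]^o :=
  limn (series (fun n => '[T ((sval w).1 n), (sval w).2 n] : R[i]^o)).

Definition weak_star H K :=
  initial_topology (@trace_pairing H K : bop H K -> {ptws _ -> R[i]^o}).

Definition wspan H K (X : set (bop H K)) : set (bop H K) :=
  closure (smallest (@op_subspace H K) X : set (weak_star H K)).

(* strong operator topology *)
Definition sot H K :=
  initial_topology (@bop_fun H K : bop H K -> {ptws H -> K}).

Definition selfadjoint_abelian H (D : set (bop H H)) :=
  [/\ op_subspace D, mulset D D `<=` D, adjoints D `<=` D &
      forall S T, D S -> D T -> compop S T = compop T S].

Definition masa H (D : set (bop H H)) :=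
  selfadjoint_abelian D /\
  forall D', selfadjoint_abelian D' -> D `<=` D' -> D' `<=` D.

Definition bimodule H K (E : set (bop K K)) (D : set (bop H H))
    (U : set (bop H K)) :=
  op_subspace U /\ mulset (mulset E U) D `<=` U.

Definition nondegenerate_op H K (U : set (bop H K)) :=
  dense [set y : K | exists2 T, U T & range T y] /\
  dense [set x : H | exists2 S, adjoints U S & range S x].

Definition is_proj H : {pred bop H H} :=
  [pred P | `[< compop P P = P /\ is_adjoint P P >]].
Arguments is_proj : clear implicits.

Record projection H := Projection {
  proj_op :> bop H H ;
  proj_opP : is_proj H proj_op }.

HB.instance Definition _ H := [isSub for @proj_op H].
HB.instance Definition _ H := [Choice of projection H by <:].

Lemma proj_idem H (P : projection H) x : P (P x) = P x.
Proof. by case: P => P /= /asboolP[/bopP PP _]; exact: PP. Qed.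

Lemma proj_adj H (P : projection H) : is_adjoint P P.
Proof. by case: P => P /= /asboolP[]. Qed.

Lemma proj0_subproof H : is_proj H 0.
Proof.
apply/asboolP; split; first exact/bopP.
by move=> x y; rewrite /= linear0l linear0r.
Qed.

Definition proj0 H : projection H := Projection (proj0_subproof H).

Lemma proj1_subproof H : is_proj H (idop H).
Proof. by apply/asboolP; split=> //; exact/bopP. Qed.

Definition proj1 H : projection H := Projection (proj1_subproof H).

Definition le_proj H (P Q : projection H) := `[< range P `<=` range Q >].
Definition lt_proj H (P Q : projection H) := (Q != P) && le_proj P Q.

Lemma le_projP H (P Q : projection H) :
  le_proj P Q <-> forall x, Q (P x) = P x.
Proof.
split=> [/asboolP PQ x|QP]; last by apply/asboolP => _ [x _ <-]; exists (P x).
by have [|y _ <-] := PQ (P x); [exists x|rewrite proj_idem].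
Qed.

Lemma lt_proj_def H (P Q : projection H) :
  lt_proj P Q = (Q != P) && le_proj P Q.
Proof. by []. Qed.

Lemma le_proj_refl H : reflexive (@le_proj H).
Proof. by move=> P; apply/asboolP. Qed.

Lemma le_proj_trans H : transitive (@le_proj H).
Proof.
by move=> Q P S /asboolP PQ /asboolP QS; apply/asboolP; exact: subset_trans QS.
Qed.

Lemma le_proj_anti H : antisymmetric (@le_proj H).
Proof.
move=> P Q /andP[/le_projP QP /le_projP PQ].
have adj x y : '[P x, y] = '[Q x, y] by rewrite -QP 2!proj_adj PQ -proj_adj.
apply/val_inj/bopP => x; apply/eqP; rewrite -subr_eq0 -normr_eq0 -sqrf_eq0.
by rewrite -inner_normE linearBl/= adj subrr.
Qed.

End BoundedOperators.

Fact proj_display : Order.disp_t. Proof. exact: Order.Disp tt tt. Qed.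

HB.instance Definition _ (R : realType) (H : hilbertType R) :=
  Order.isPOrder.Build proj_display (projection H) (@lt_proj_def R H)
    (@le_proj_refl R H) (@le_proj_anti R H) (@le_proj_trans R H).

Section Bilattices.
Context {R : realType}.
Implicit Types H K : hilbertType R.

Definition commuting H (L : set (projection H)) :=
  forall P Q, L P -> L Q -> compop P Q = compop Q P.

Definition is_csl H (L : set (projection H)) :=
  [/\ commuting L, L (proj0 H), L (proj1 H) &
      forall (F : set (projection H)) P, F `<=` L ->
        supremums F P \/ infimums F P -> L P].

(* Since a CSL is closed under suprema and infima, those of its subsets are
   computed in the ambient projection lattice. Only the values of [phi] on [L]
   matter. *)
Definition csl_hom H K (L : set (projection H)) (M : set (projection K))
    (phi : projection H -> projection K) :=
  [/\ is_csl L, is_csl M, set_fun L M phi &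
      forall (F : set (projection H)) P, F `<=` L ->
        (supremums F P -> supremums (phi @` F) (phi P)) /\
        (infimums F P -> infimums (phi @` F) (phi P))].

Section OneBilattice.
Context {H K : hilbertType R}.
Implicit Type S : set (projection H * projection K).

Definition is_bilattice S :=
  [/\ S (proj0 H, proj0 K), S (proj1 H, proj0 K), S (proj0 H, proj1 K) &
      forall P1 P2 Q1 Q2, S (P1, Q1) -> S (P2, Q2) ->
      forall P Q,
        (infimums [set P1; P2] P -> supremums [set Q1; Q2] Q -> S (P, Q)) /\
        (supremums [set P1; P2] P -> infimums [set Q1; Q2] Q -> S (P, Q))].

Definition bl_left S : set (projection H) := [set pq.1 | pq in S].
Definition bl_right S : set (projection K) := [set pq.2 | pq in S].

Definition bl_commutative S := commuting (bl_left S) /\ commuting (bl_right S).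

Definition strongly_closed S :=
  closed [set ((pq.1 : bop H H) : sot H H, (pq.2 : bop K K) : sot K K)
         | pq in S].

Definition bl_space S : set (bop H K) :=
  [set T | forall P Q, S (P, Q) -> compop (compop Q T) P = 0].

End OneBilattice.

Section TwoBilattices.
Context {H1 H2 K1 K2 : hilbertType R}.

Definition bl_hom (S1 : set (projection H1 * projection H2))
    (S2 : set (projection K1 * projection K2))
    (phi : projection H1 -> projection K1) (psi : projection H2 -> projection K2) :=
  [/\ csl_hom (bl_left S1) (bl_left S2) phi,
      csl_hom (bl_right S1) (bl_right S2) psi &
      forall P Q, S1 (P, Q) -> S2 (phi P, psi Q)].

(* "1-1 and onto" includes that (P, Q) |-> (phi P, psi Q) maps [S1] onto [S2]:
   bijectivity of [phi] and [psi] alone does not make the inverse pair a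
   homomorphism, and would not give a symmetric relation. *)
Definition bl_isom (S1 : set (projection H1 * projection H2))
    (S2 : set (projection K1 * projection K2))
    (phi : projection H1 -> projection K1) (psi : projection H2 -> projection K2) :=
  [/\ bl_hom S1 S2 phi psi,
      set_bij (bl_left S1) (bl_left S2) phi,
      set_bij (bl_right S1) (bl_right S2) psi &
      set_bij S1 S2 (fun pq => (phi pq.1, psi pq.2))].

Definition bl_isomorphic (S1 : set (projection H1 * projection H2))
    (S2 : set (projection K1 * projection K2)) :=
  exists phi psi, bl_isom S1 S2 phi psi.

(* [D1], [D2], [E1], [E2] are the fixed masas, acting on [H1], [H2], [K1],
   [K2]. *)
Definition nondegenerate_bimodules
    (D1 : set (bop H1 H1)) (D2 : set (bop H2 H2))
    (E1 : set (bop K1 K1)) (E2 : set (bop K2 K2))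
    (U1 : set (bop H1 H2)) (U2 : set (bop K1 K2)) :=
  [/\ masa D1, masa D2, masa E1 & masa E2] /\
  [/\ bimodule D2 D1 U1, nondegenerate_op U1, bimodule E2 E1 U2 &
      nondegenerate_op U2].

Definition spatially_Morita_equivalent
    (D1 : set (bop H1 H1)) (D2 : set (bop H2 H2))
    (E1 : set (bop K1 K1)) (E2 : set (bop K2 K2))
    (U1 : set (bop H1 H2)) (U2 : set (bop K1 K2)) :=
  nondegenerate_bimodules D1 D2 E1 E2 U1 U2 /\
  exists (V1 : set (bop H1 K1)) (V2 : set (bop H2 K2))
         (W1 : set (bop K1 H1)) (W2 : set (bop K2 H2)),
  [/\ [/\ bimodule E1 D1 V1, bimodule E2 D2 V2,
          bimodule D1 E1 W1 & bimodule D2 E2 W2],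
      U1 = wspan (mulset (mulset W2 U2) V1),
      U2 = wspan (mulset (mulset V2 U1) W1) &
      [/\ unital_algebra (wspan (mulset V1 W1)),
          unital_algebra (wspan (mulset W1 V1)),
          unital_algebra (wspan (mulset V2 W2)) &
          unital_algebra (wspan (mulset W2 V2))]].

End TwoBilattices.
End Bilattices.

(* Main.v *)
(* An isomorphism [phi] of CSLs gives the spaces V = {T : T P = phi(P) T P} and
   W = {T : T phi(P) = P T phi(P)}.  The key fact is that the identity lies in the
   weak* closed span of VW; taking such spaces on both sides of a bilattice
   isomorphism, U2 contains V2 U1 W1, U1 contains W2 U2 V1, and the identities are
   absorbed to give equalities.

   Reflexivity: if <T x, y> = 0 for all T in M(S), then some (P, Q) in S has P x = x
   and Q y = y.  Otherwise min |x - P x|^2 + |y - Q y|^2 over S is positive, and a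
   finite transport problem on atoms, followed by a weak operator limit, produces T in
   M(S) with <T x, y> <> 0.  Hence <V W x, y> = 0 implies <x, y> = 0.

   Synthesis: a weak* continuous functional T |-> sum <T x_n, y_n> vanishing on VW
   vanishes on the identity.  Otherwise it does not vanish on a cyclic projection
   [BB g] of the Boolean algebra BB generated by the lattice.  Approximating x_n, y_n by
   simple multiples of g and cutting down to a suitable E in BB, the functional becomes a
   small perturbation of T |-> c <T E g, E g>; then the norm of the compression of each T
   in VW is at most half of itself, so <T E g, E g> = 0, against reflexivity.

   To make the spaces bimodules over the given masas, each (P, Q) in S1 is enlarged to
   the pair (A, B) that is maximal with B U1 A = 0.  Such a pair commutes with the masas,
   and since A is a lattice expression in S1, the isomorphism maps it to the pair
   enlarging (phi P, psi Q) in S2. *)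

Require Import Defs.
From mathcomp Require Import all_boot all_order all_algebra.
From mathcomp Require Import sesquilinear complex ring lra.
From mathcomp Require Import all_classical all_reals.
From mathcomp Require Import topology normedtype sequences.

Set Implicit Arguments.
Unset Strict Implicit.
Unset Printing Implicit Defensive.

Import Order.TTheory GRing.Theory Num.Theory Num.Def.
Import numFieldNormedType.Exports.

Local Open Scope classical_set_scope.
Local Open Scope complex_scope.
Local Open Scope ring_scope.

(** * Hilbert spaces and bounded operators *)

(** Reflexivity only controls the functionals T |-> <T x, y>, and a weak* closed masa bimodule can
    be strictly smaller than the space cut out by those of them that annihilate it. Synthesis is
    therefore a separate argument, and it is made for the identity alone, whose compressions by E
    are seen through <E g, E g>. It works because VW absorbs, on both sides, every projection
    commuting with the lattice: this allows cutting the functional by elements of BB and by cyclic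
    projections, independently on the left and on the right.

    The spaces have arbitrary dimension and no measure represents the lattices. Projections of BB
    stand for measurable sets, squared norms for measures, and simple vectors for simple functions.
    A single modular minimisation then gives both the distance from a pair of vectors to a bilattice
    and the Hahn decomposition.

    The given masas are only known to act on U1 and U2 and need not commute with the bilattices: a
    pair (P, 0) puts no condition on U1, so its P is unrelated to the masa. Hence the passage to
    enlarged pairs, which are determined by U1 and U2. *)

Section RealNorm.
Context {R : realType}.

(** The norm of an [R[i]]-module is [R[i]]-valued; its real part moves estimates to the ordered
    field [R], where [lra] applies. *)
Definition nrm (V : normedZmodType R[i]) (x : V) : R := complex.Re `|x|.

Lemma nrmE (V : normedZmodType R[i]) (x : V) : `|x| = (nrm x)%:C.
Proof. by rewrite /nrm RRe_real// ger0_real. Qed.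

Context {V : normedZmodType R[i]}.
Implicit Types x y : V.

Lemma nrm_ge0 x : 0 <= nrm x.
Proof. by rewrite -ler0c -nrmE. Qed.

Lemma nrm0 : nrm (0 : V) = 0.
Proof. by rewrite /nrm normr0. Qed.

Lemma nrm0_eq0 x : nrm x = 0 -> x = 0.
Proof. by move=> x0; apply/eqP; rewrite -normr_eq0 nrmE x0. Qed.

Lemma nrmN x : nrm (- x) = nrm x.
Proof. by rewrite /nrm normrN. Qed.

Lemma nrmD x y : nrm (x + y) <= nrm x + nrm y.
Proof. by rewrite -lecR rmorphD/= -!nrmE ler_normD. Qed.

Lemma nrmB x y : nrm (x - y) <= nrm x + nrm y.
Proof. by rewrite -(nrmN y) nrmD. Qed.

Lemma nrm_sub x y : nrm (x - y) = nrm (y - x).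
Proof. by rewrite -nrmN opprB. Qed.

Lemma nrm_sum (I : Type) (r : seq I) (P : pred I) (f : I -> V) :
  nrm (\sum_(i <- r | P i) f i) <= \sum_(i <- r | P i) nrm (f i).
Proof.
by elim/big_rec2: _ => [|i a b _ h]; rewrite ?nrm0// (le_trans (nrmD _ _)) ?lerD2l.
Qed.

Lemma nrm_dist x y : `|nrm x - nrm y| <= nrm (x - y).
Proof.
have := nrmD (x - y) y; have := nrmD (y - x) x.
by rewrite !subrK nrm_sub; case: ler0P => _ h1 h2; lra.
Qed.

End RealNorm.

Section ComplexNorm.
Context {R : realType}.
Implicit Types z w : R[i].

Lemma nrmM z w : nrm (z * w) = nrm z * nrm w.
Proof. by rewrite /nrm normrM !nrmE -rmorphM. Qed.

Lemma nrmZ (V : normedModType R[i]) z (x : V) : nrm (z *: x) = nrm z * nrm x.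
Proof. by rewrite /nrm normrZ !nrmE -rmorphM. Qed.

Lemma nrmC (a : R) : nrm (a%:C : R[i]) = `|a|.
Proof. by rewrite /nrm normc_def/= expr0n/= addr0 sqrtr_sqr. Qed.

Lemma nrmJ z : nrm (z^*)%C = nrm z.
Proof. by rewrite /nrm normcJ. Qed.

Lemma nrm_sqr z : nrm z ^+ 2 = complex.Re z ^+ 2 + complex.Im z ^+ 2.
Proof. by apply: complexI; rewrite rmorphXn/= -nrmE add_Re2_Im2. Qed.

Lemma Re_le_nrm z : `|complex.Re z| <= nrm z.
Proof. by rewrite -lecR -nrmE normc_ge_Re. Qed.

Lemma Im_le_nrm z : `|complex.Im z| <= nrm z.
Proof.
rewrite -(ler_pXn2r (ltn0Sn 1)) ?nnegrE ?nrm_ge0//.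
by rewrite nrm_sqr real_normK ?num_real// lerDr sqr_ge0.
Qed.

Lemma nrm_le_ReIm z : nrm z <= `|complex.Re z| + `|complex.Im z|.
Proof.
rewrite -(ler_pXn2r (ltn0Sn 1)) ?nnegrE ?nrm_ge0 ?addr_ge0//.
rewrite nrm_sqr sqrrD !real_normK ?num_real// lerD2r lerDl.
by rewrite mulrn_wge0// mulr_ge0.
Qed.

End ComplexNorm.

Section InnerProduct.
Context {R : realType} {H : hilbertType R}.
Implicit Types x y z : H.

Lemma innerC x y : '[x, y] = ('[y, x]^*)%C.
Proof. by rewrite hermC expr0 mul1r. Qed.

Lemma innerDl x y z : '[x + y, z] = '[x, z] + '[y, z].
Proof. by rewrite linearDl. Qed.
Lemma innerDr x y z : '[x, y + z] = '[x, y] + '[x, z].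
Proof. by rewrite linearDr. Qed.
Lemma innerNr x y : '[x, - y] = - '[x, y].
Proof. by rewrite linearNr. Qed.
Lemma innerBl x y z : '[x - y, z] = '[x, z] - '[y, z].
Proof. by rewrite linearBl. Qed.
Lemma innerBr x y z : '[x, y - z] = '[x, y] - '[x, z].
Proof. by rewrite linearBr. Qed.
Lemma innerZl a x y : '[a *: x, y] = a * '[x, y].
Proof. by rewrite linearZl_LR. Qed.
Lemma innerZr a x y : '[x, a *: y] = (a^*)%C * '[x, y].
Proof. by rewrite linearZr_LR. Qed.
Lemma inner0l x : '[0, x] = 0.
Proof. by rewrite linear0l. Qed.
Lemma inner0r x : '[x, 0] = 0.
Proof. by rewrite linear0r. Qed.
Lemma inner_suml (I : Type) (r : seq I) (P : pred I) (f : I -> H) y :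
  '[\sum_(i <- r | P i) f i, y] = \sum_(i <- r | P i) '[f i, y].
Proof. by rewrite linear_sumlz. Qed.
Lemma inner_sumr (I : Type) (r : seq I) (P : pred I) (f : I -> H) y :
  '[y, \sum_(i <- r | P i) f i] = \sum_(i <- r | P i) '[y, f i].
Proof. by rewrite linear_sumr. Qed.

Lemma inner_nrm x : '[x, x] = (nrm x ^+ 2)%:C.
Proof. by rewrite inner_normE nrmE -rmorphXn. Qed.

Lemma Re_innerC x y : complex.Re '[x, y] = complex.Re '[y, x].
Proof. by rewrite innerC; case: '[y, x]. Qed.

Lemma ReD (a b : R[i]) : complex.Re (a + b) = complex.Re a + complex.Re b.
Proof. by case: a b => [? ?] [? ?]. Qed.
Lemma ImD (a b : R[i]) : complex.Im (a + b) = complex.Im a + complex.Im b.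
Proof. by case: a b => [? ?] [? ?]. Qed.
Lemma ReN (a : R[i]) : complex.Re (- a) = - complex.Re a.
Proof. by case: a. Qed.
Lemma ImN (a : R[i]) : complex.Im (- a) = - complex.Im a.
Proof. by case: a. Qed.
Lemma ReMr (r : R) (a : R[i]) : complex.Re (r%:C * a) = r * complex.Re a.
Proof. by case: a => a b /=; rewrite mul0r subr0. Qed.

Lemma nrm_sqrE x : nrm x ^+ 2 = complex.Re '[x, x].
Proof. by rewrite inner_nrm. Qed.

Lemma nrmD_sqr x y :
  nrm (x + y) ^+ 2 = nrm x ^+ 2 + nrm y ^+ 2 + complex.Re '[x, y] *+ 2.
Proof.
rewrite !nrm_sqrE innerDl !innerDr !ReD (Re_innerC y x) mulr2n; ring.
Qed.

Lemma nrmB_sqr x y :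
  nrm (x - y) ^+ 2 = nrm x ^+ 2 + nrm y ^+ 2 - complex.Re '[x, y] *+ 2.
Proof. by rewrite nrmD_sqr nrmN innerNr ReN mulNrn. Qed.

Lemma nrm_pyth x y : '[x, y] = 0 -> nrm (x + y) ^+ 2 = nrm x ^+ 2 + nrm y ^+ 2.
Proof. by move=> xy; rewrite nrmD_sqr xy/= mul0rn addr0. Qed.

Lemma Re_inner_le x y : complex.Re '[x, y] <= nrm x * nrm y.
Proof.
have [/nrm0_eq0 ->|x0] := eqVneq (nrm x) 0; first by rewrite inner0l nrm0 mul0r.
have [/nrm0_eq0 ->|y0] := eqVneq (nrm y) 0; first by rewrite inner0r nrm0 mulr0.
have xp : 0 < nrm x by rewrite lt_def x0 nrm_ge0.
have yp : 0 < nrm y by rewrite lt_def y0 nrm_ge0.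
(* The two rescaled vectors have equal length, so their squared distance has the factor
   [nrm x * nrm y]. *)
have := sqr_ge0 (nrm ((nrm y)%:C *: x - (nrm x)%:C *: y)).
rewrite nrmB_sqr !nrmZ !nrmC !ger0_norm ?nrm_ge0// innerZl innerZr conjc_real.
rewrite !ReMr => h.
have : (nrm x * nrm y) * complex.Re '[x, y] <= (nrm x * nrm y) * (nrm x * nrm y).
  by move: h; rewrite !mulr2n; lra.
by rewrite ler_pM2l// mulr_gt0.
Qed.

(** Multiplying [x] by the conjugate of ['[x, y]] makes the scalar product real, so [Re_inner_le]
    applies. *)
Lemma inner_le x y : nrm '[x, y] <= nrm x * nrm y.
Proof.
have [/nrm0_eq0 ->|z0] := eqVneq (nrm '[x, y]) 0.
  by rewrite nrm0 mulr_ge0 ?nrm_ge0.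
have zp : 0 < nrm '[x, y] by rewrite lt_def z0 nrm_ge0.
have := Re_inner_le (('[x, y]^*)%C *: x) y.
rewrite innerZl nrmZ nrmJ mulrC -sqr_normc nrmE -rmorphXn/= expr2 -mulrA.
by rewrite ler_pM2l.
Qed.

Lemma inner_eq0P x : (forall y, '[x, y] = 0) -> x = 0.
Proof.
move=> /(_ x); rewrite inner_nrm => /complexI/eqP.
by rewrite sqrf_eq0 => /eqP/nrm0_eq0.
Qed.

Lemma inner_inj x y : (forall z, '[x, z] = '[y, z]) -> x = y.
Proof.
move=> xy; apply/eqP; rewrite -subr_eq0; apply/eqP/inner_eq0P => z.
by rewrite innerBl xy subrr.
Qed.

Lemma inner_injr x y : (forall z, '[z, x] = '[z, y]) -> x = y.
Proof. by move=> xy; apply: inner_inj => z; rewrite innerC xy -innerC. Qed.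

Lemma parallelogram x y :
  nrm (x + y) ^+ 2 + nrm (x - y) ^+ 2 = (nrm x ^+ 2 + nrm y ^+ 2) *+ 2.
Proof. rewrite nrmD_sqr nrmB_sqr !mulr2n; ring. Qed.

End InnerProduct.

Section NormConvergence.
Context {R : realType}.

(** One notion, through real norms, serves vectors and scalars alike; [cvg_ncvg] ties it to the
    topology of normed modules. *)
Definition ncvg {T : Type} (V : normedZmodType R[i]) (F : set_system T)
  (u : T -> V) (l : V) := nrm (u i - l) @[i --> F] --> (0 : R).

Section Filter.
Context {T : Type} {F : set_system T} {FF : ProperFilter F}.

Lemma ncvg_cst (V : normedZmodType R[i]) (l : V) : ncvg F (fun=> l) l.
Proof.
rewrite /ncvg (_ : (fun=> _) = fun=> 0); first exact: cvg_cst.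
by apply/funext => i; rewrite subrr nrm0.
Qed.

Lemma ncvg_le (V W : normedZmodType R[i]) (u : T -> V) l (v : T -> W) m (c : R) :
  (forall i, nrm (v i - m) <= c * nrm (u i - l)) -> ncvg F u l -> ncvg F v m.
Proof.
move=> vu ul; apply: (@squeeze_cvgr _ _ _ _ (fun=> 0) (fun i => c * nrm (u i - l))).
- by near=> i; rewrite nrm_ge0 vu.
- exact: cvg_cst.
- by rewrite -(mulr0 c); apply: cvgMr.
Unshelve. all: by end_near. Qed.

Lemma ncvgD (V : normedZmodType R[i]) (u v : T -> V) l m :
  ncvg F u l -> ncvg F v m -> ncvg F (fun i => u i + v i) (l + m).
Proof.
move=> ul vm; apply: (@squeeze_cvgr _ _ _ _ (fun=> 0)
    (fun i => nrm (u i - l) + nrm (v i - m))).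
- by near=> i; rewrite nrm_ge0/= opprD addrACA nrmD.
- exact: cvg_cst.
- by rewrite -(addr0 0); apply: cvgD.
Unshelve. all: by end_near. Qed.

Lemma ncvgN (V : normedZmodType R[i]) (u : T -> V) l :
  ncvg F u l -> ncvg F (fun i => - u i) (- l).
Proof.
by apply: (@ncvg_le _ _ _ _ _ _ 1) => i; rewrite -opprD nrmN mul1r.
Qed.

Lemma ncvgB (V : normedZmodType R[i]) (u v : T -> V) l m :
  ncvg F u l -> ncvg F v m -> ncvg F (fun i => u i - v i) (l - m).
Proof. by move=> ul /ncvgN; apply: ncvgD. Qed.

Lemma ncvgM (u : T -> R[i]) l a :
  ncvg F u l -> ncvg F (fun i => a * u i) (a * l).
Proof. by apply: (@ncvg_le _ _ _ _ _ _ (nrm a)) => i; rewrite -mulrBr nrmM. Qed.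

Lemma ncvg_nrm (V : normedZmodType R[i]) (u : T -> V) l :
  ncvg F u l -> nrm (u i) @[i --> F] --> nrm l.
Proof.
move=> ul; apply/cvgrPdist_le => e e0.
move/cvgrPdist_le : ul => /(_ _ e0); apply: filterS => i.
rewrite sub0r normrN ger0_norm ?nrm_ge0// => h.
by rewrite distrC (le_trans (nrm_dist _ _)).
Qed.

Lemma ncvg_sqr (V : normedZmodType R[i]) (u : T -> V) l :
  ncvg F u l -> nrm (u i) ^+ 2 @[i --> F] --> nrm l ^+ 2.
Proof. by move=> /ncvg_nrm ul; rewrite expr2; apply: cvgM. Qed.

Lemma ncvg_Re (u : T -> R[i]) l :
  ncvg F u l -> complex.Re (u i) @[i --> F] --> complex.Re l.
Proof.
move=> ul; apply/cvgrPdist_le => e e0.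
move/cvgrPdist_le : ul => /(_ _ e0); apply: filterS => i.
rewrite sub0r normrN ger0_norm ?nrm_ge0// => h.
by rewrite distrC -ReN -ReD (le_trans (Re_le_nrm _)).
Qed.

Lemma ncvg_unique (V : normedZmodType R[i]) (u : T -> V) l m :
  ncvg F u l -> ncvg F u m -> l = m.
Proof.
move=> ul um; apply/eqP; rewrite -subr_eq0; apply/eqP/nrm0_eq0.
have /ncvg_nrm h := ncvgB ul um.
have : nrm (u i - u i) @[i --> F] --> (0 : R).
  rewrite (_ : (fun=> _) = fun=> 0); first exact: cvg_cst.
  by apply/funext => i; rewrite subrr nrm0.
by move=> /(cvg_unique _ h) ->.
Qed.

Lemma ncvg_le_nrm (V : normedZmodType R[i]) (u : T -> V) l (c : R) :
  ncvg F u l -> (\forall i \near F, nrm (u i) <= c) -> nrm l <= c.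
Proof. by move=> /ncvg_nrm ul; apply: cvgr_to_le. Qed.

Lemma ncvg_inner (H : hilbertType R) (u : T -> H) l y :
  ncvg F u l -> ncvg F (fun i => '[u i, y]) '[l, y].
Proof.
apply: (@ncvg_le _ _ _ _ _ _ (nrm y)) => i.
by rewrite -innerBl mulrC inner_le.
Qed.

Lemma ncvg_innerr (H : hilbertType R) (u : T -> H) l y :
  ncvg F u l -> ncvg F (fun i => '[y, u i]) '[y, l].
Proof.
by apply: (@ncvg_le _ _ _ _ _ _ (nrm y)) => i; rewrite -innerBr inner_le.
Qed.

Lemma bop_bounded (H K : hilbertType R) (S : bop H K) :
  exists2 M : R, 0 <= M & forall x, nrm (S x) <= M * nrm x.
Proof.
case: S => f /= /asboolP[_ [M fM]]; exists `|M| => // x.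
rewrite (@le_trans _ _ (M * nrm x)) ?ler_wpM2r ?nrm_ge0 ?ler_norm//.
by rewrite -lecR rmorphM/= -!nrmE.
Qed.

Lemma ncvg_bop (H K : hilbertType R) (S : bop H K) (u : T -> H) l :
  ncvg F u l -> ncvg F (fun i => S (u i)) (S l).
Proof.
have [M _ SM] := bop_bounded S.
by apply: (@ncvg_le _ _ _ _ _ _ M) => i; rewrite -linearB SM.
Qed.

Lemma ncvg_ext (V : normedZmodType R[i]) (u v : T -> V) l :
  u =1 v -> ncvg F u l -> ncvg F v l.
Proof. by move=> /funext ->. Qed.

Lemma ncvg_near0 (V : normedZmodType R[i]) (u : T -> V) l :
  (\forall i \near F, u i = 0) -> ncvg F u l -> l = 0.
Proof.
move=> u0 ul; apply: nrm0_eq0; apply/eqP; rewrite eq_le nrm_ge0 andbT.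
by apply: ncvg_le_nrm ul _; apply: filterS u0 => i ->; rewrite nrm0.
Qed.

Lemma ncvgP (V : normedZmodType R[i]) (u : T -> V) l :
  ncvg F u l <-> forall e : R, 0 < e -> \forall i \near F, nrm (u i - l) <= e.
Proof.
split=> [ul e e0|h].
  move/cvgrPdist_le : ul => /(_ _ e0); apply: filterS => i.
  by rewrite sub0r normrN ger0_norm ?nrm_ge0.
apply/cvgrPdist_le => e /h; apply: filterS => i.
by rewrite sub0r normrN ger0_norm ?nrm_ge0.
Qed.

End Filter.

Lemma cvg_ncvg (V : normedModType R[i]) {T : Type} (F : set_system T)
    {FF : ProperFilter F} (u : T -> V) (l : V) :
  (u @ F --> l) <-> ncvg F u l.
Proof.
split=> [/cvgrPdist_le ul|ul].
  apply/cvgrPdist_le => e e0; have e0' : 0 < e%:C by rewrite ltcR.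
  apply: filterS (ul _ e0') => i.
  by rewrite nrmE lecR sub0r normrN ger0_norm ?nrm_ge0// nrm_sub.
apply/cvgrPdist_le => e e0.
have eE : e = (complex.Re e)%:C by rewrite RRe_real// gtr0_real.
have e0' : 0 < complex.Re e by rewrite -ltcR -eE.
move/cvgrPdist_le : ul => /(_ _ e0'); apply: filterS => i.
by rewrite nrmE eE lecR sub0r normrN ger0_norm ?nrm_ge0// nrm_sub.
Qed.

Lemma ncauchy_cvg (V : completeNormedModType R[i]) (u : nat -> V) :
  (forall e : R, 0 < e -> exists N : nat, forall n m, (N <= n)%N -> (N <= m)%N ->
     nrm (u n - u m) <= e) ->
  exists l, ncvg \oo u l.
Proof.
move=> uc; exists (lim (u @ \oo)); apply/cvg_ncvg; apply: cauchy_cvg.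
apply/cauchy_exP => e e0.
have eE : e = (complex.Re e)%:C by rewrite RRe_real// gtr0_real.
have e0' : 0 < complex.Re e / 2 by rewrite divr_gt0// -ltcR -eE.
have [N uN] := uc _ e0'; exists (u N).
exists N => // n /= Nn; rewrite -ball_normE/= nrmE eE ltcR.
rewrite (le_lt_trans (uN _ _ _ _))// ltr_pdivrMr//.
by rewrite ltr_pMr ?ltr1n// -ltcR -eE.
Qed.

End NormConvergence.

(** * Projection theorem, Riesz representation and adjoints *)

Section Bop.
Context {R : realType}.
Implicit Types H K L : hilbertType R.

Lemma bop_build H K (f : H -> K) (M : R) : linear f ->
  (forall x, nrm (f x) <= M * nrm x) -> exists T : bop H K, forall x, T x = f x.
Proof.
move=> lf fM; suff fP : f \in @bounded_linear R H K by exists (Bop fP).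
apply/asboolP; split=> //; exists M => x.
by rewrite !nrmE -rmorphM lecR.
Qed.

Lemma eq_bop H K (S T : bop H K) : (forall x, S x = T x) -> S = T.
Proof. by move=> /bopP. Qed.

Lemma bopDE H K (S T : bop H K) x : (S + T) x = S x + T x. Proof. by []. Qed.
Lemma bopBE H K (S T : bop H K) x : (S - T) x = S x - T x. Proof. by []. Qed.
Lemma bopZE H K a (S : bop H K) x : (a *: S) x = a *: S x. Proof. by []. Qed.
Lemma bop0E H K x : (0 : bop H K) x = 0. Proof. by []. Qed.
Lemma compopE H K L (S : bop K L) (T : bop H K) x : compop S T x = S (T x).
Proof. by []. Qed.
Lemma idopE H (x : H) : idop H x = x. Proof. by []. Qed.

Definition subsp H (M : set H) :=
  M 0 /\ forall a x y, M x -> M y -> M (a *: x + y).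

Definition seq_closed H (M : set H) :=
  forall (u : nat -> H) l, (forall n, M (u n)) -> ncvg \oo u l -> M l.

Section Subspace.
Context {H : hilbertType R} (M : set H) (sM : subsp M).

Lemma subspD x y : M x -> M y -> M (x + y).
Proof. by move=> Mx My; rewrite -(scale1r x); apply: sM.2. Qed.

Lemma subspZ a x : M x -> M (a *: x).
Proof. by move=> Mx; rewrite -(addr0 (_ *: _)); apply: sM.2 => //; exact: sM.1. Qed.

Lemma subspB x y : M x -> M y -> M (x - y).
Proof. by move=> Mx My; rewrite -scaleN1r addrC; apply: sM.2. Qed.

Lemma Re_orth x : (forall z, M z -> complex.Re '[x, z] = 0) ->
  forall z, M z -> '[x, z] = 0.
Proof.
move=> xM z Mz; have h1 := xM _ Mz; have h2 := xM _ (subspZ 'i%C Mz).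
by apply/eqP; rewrite eq_complex h1/=; move: h2; rewrite innerZr;
  case: '[x, z] => a b /=; rewrite mul0r sub0r mulN1r opprK => ->; rewrite !eqxx.
Qed.

Lemma closest_orth x m : M m ->
  (forall z, M z -> nrm (x - m) ^+ 2 <= nrm (x - z) ^+ 2) ->
  forall z, M z -> '[x - m, z] = 0.
Proof.
move=> Mm mmin; apply: Re_orth => z Mz.
have h t : t * complex.Re '[x - m, z] *+ 2 <= t ^+ 2 * nrm z ^+ 2.
  have := mmin _ (subspD Mm (subspZ t%:C Mz)).
  rewrite opprD addrA (nrmB_sqr (x - m)) nrmZ nrmC innerZr conjc_real ReMr exprMn.
  by rewrite real_normK ?num_real//; lra.
set r := complex.Re _ in h *.
have [/nrm0_eq0 z0|z0] := eqVneq (nrm z) 0; first by rewrite /r z0 inner0r.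
have zp : 0 < nrm z ^+ 2 by rewrite exprn_gt0// lt_def z0 nrm_ge0.
(* This [t] is the best step of the quadratic; up to a positive factor, [h] becomes 2 r^2 <= r^2. *)
have := h (r / nrm z ^+ 2); rewrite expr_div_n -mulrA expr2.
have -> : r * r / (nrm z ^+ 2) ^+ 2 * nrm z ^+ 2 = r * r / nrm z ^+ 2.
  by field; rewrite z0.
rewrite [X in X *+ 2](_ : _ = r * r / nrm z ^+ 2) => [hh|]; last by field; rewrite z0.
have : r * r / nrm z ^+ 2 <= 0 by move: hh; rewrite mulr2n; lra.
by rewrite ler_pdivrMr// mul0r -expr2 => hr; apply/eqP; rewrite -sqrf_eq0 eq_le hr sqr_ge0.
Qed.

Hypothesis cM : seq_closed M.

Lemma closest_exists x : exists2 m, M m &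
  forall z, M z -> nrm (x - m) ^+ 2 <= nrm (x - z) ^+ 2.
Proof.
pose E := [set nrm (x - z) ^+ 2 | z in M].
have E0 : E !=set0 by exists (nrm (x - 0) ^+ 2), 0 => //; exact: sM.1.
have lE : has_lbound E by exists 0 => _ [z _ <-]; rewrite sqr_ge0.
set d := inf E.
have dle z : M z -> d <= nrm (x - z) ^+ 2 by move=> Mz; apply: ge_inf => //; exists z.
have /choice[m mP] : forall n : nat, exists m, M m /\ nrm (x - m) ^+ 2 <= d + n.+1%:R^-1.
  move=> n; have [] := @inf_adherent _ E n.+1%:R^-1 _ (conj E0 lE).
    by rewrite invr_gt0.
  by move=> _ [z Mz <-] /ltW h; exists z.
(* The midpoint of [m i] and [m j] lies in [M], so the parallelogram law bounds their distance by
   the two excesses over [d]. *)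
have dist i j : nrm (m i - m j) ^+ 2 <= (i.+1%:R^-1 + j.+1%:R^-1) *+ 2.
  have := parallelogram (x - m i) (x - m j).
  have -> : x - m i - (x - m j) = m j - m i by rewrite opprB addrC subrKA.
  have -> : x - m i + (x - m j) = 2%:R%:C *: (x - (2^-1)%:C *: (m i + m j)).
    rewrite scalerBr scalerA -rmorphM/= mulfV ?pnatr_eq0// scale1r.
    by rewrite -[2%:R]/(1 + 1) rmorphD/= scalerDl scale1r opprD addrACA.
  rewrite nrmZ exprMn nrmC ger0_norm// (nrm_sub (m j)) -natrX.
  have := dle _ (subspZ (2^-1)%:C (subspD (mP i).1 (mP j).1)).
  have := (mP i).2; have := (mP j).2.
  move: (nrm (x - _ *: _) ^+ 2) (nrm (m i - m j) ^+ 2) => w v.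
  move: (i.+1%:R^-1) (j.+1%:R^-1) => p q.
  rewrite (_ : (2 ^ 2)%N = 4%N)// !mulr2n; lra.
have [l ml] : exists l, ncvg \oo m l.
  apply: ncauchy_cvg => e e0.
  have [N NP] : exists N : nat, N.+1%:R^-1 <= e ^+ 2 / 4.
    have ee : 0 < e ^+ 2 / 4 by rewrite divr_gt0// exprn_gt0.
    exists (Num.truncn (e ^+ 2 / 4)^-1).
    rewrite -[leRHS]invrK lef_pV2 ?posrE ?invr_gt0//.
    by rewrite ltW// truncnS_gt.
  exists N => i j Ni Nj.
  rewrite -(ler_pXn2r (ltn0Sn 1)) ?nnegrE ?nrm_ge0 ?(ltW e0)//.
  apply: le_trans (dist _ _) _.
  have h k : (N <= k)%N -> k.+1%:R^-1 <= e ^+ 2 / 4.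
    by move=> Nk; rewrite (le_trans _ NP)// lef_pV2 ?posrE// ler_nat.
  have := h _ Ni; have := h _ Nj; move: (i.+1%:R^-1) (j.+1%:R^-1) => p q hp hq.
  by rewrite mulr2n; lra.
exists l; first exact: (cM (fun n => (mP n).1) ml).
move=> z Mz; apply: le_trans (dle _ Mz).
have h : nrm (x - m n) ^+ 2 @[n --> \oo] --> nrm (x - l) ^+ 2.
  by apply: ncvg_sqr; apply: ncvgB => //; exact: ncvg_cst.
have h2 : d + n.+1%:R^-1 @[n --> \oo] --> d.
  by rewrite -[X in _ --> X]addr0; apply: cvgD; [exact: cvg_cst|exact: cvg_harmonic].
by apply: (ler_cvg_to h h2); near=> n; have [] := mP n.
Unshelve. all: by end_near. Qed.

Lemma orth_decomp x : exists2 m, M m & forall z, M z -> '[x - m, z] = 0.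
Proof.
by have [m Mm mmin] := closest_exists x; exists m => //; exact: closest_orth.
Qed.

(** Infima, cyclic projections and the covers [bl_rel_left], [bl_rel_right] all come from here: each
    is specified only by the vectors it fixes. *)
Lemma proj_exists : exists P : projection H, forall x, M x <-> P x = x.
Proof.
have /choice[p pP] : forall x, exists m, M m /\ forall z, M z -> '[x - m, z] = 0.
  by move=> x; have [m] := orth_decomp x; exists m.
have uniq x m : M m -> (forall z, M z -> '[x - m, z] = 0) -> p x = m.
  move=> Mm mo; have [Mp po] := pP x; apply/eqP; rewrite -subr_eq0.
  have Mpm := subspB Mp Mm.
  apply/eqP/nrm0_eq0/eqP; rewrite -sqrf_eq0 nrm_sqrE.
  rewrite [X in '[X, _]](_ : _ = (x - m) - (x - p x)).
    by rewrite innerBl mo// po// subr0.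
  by rewrite opprB [RHS]addrC subrKA.
have lp : linear p.
  move=> a x y; apply: uniq.
    by apply: sM.2; have [] := pP x; have [] := pP y.
  move=> z Mz; rewrite opprD addrACA -scalerBr innerDl innerZl.
  by rewrite (pP x).2// (pP y).2// mulr0 addr0.
have np x : nrm (p x) <= 1 * nrm x.
  rewrite mul1r -(ler_pXn2r (ltn0Sn 1)) ?nnegrE ?nrm_ge0//.
  rewrite -[x in leRHS](subrK (p x)) nrm_pyth ?lerDr ?sqr_ge0//.
  by rewrite (pP x).2//; have [] := pP x.
have [P PE] := bop_build lp np.
have Mid x : M x -> p x = x.
  by move=> Mx; apply: uniq => // z _; rewrite subrr inner0l.
have PP : P \in @is_proj R H.
  apply/asboolP; split; first by apply: eq_bop => x /=; rewrite !PE Mid//; have [] := pP x.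
  move=> x y; rewrite !PE; have [Mx ox] := pP x; have [My oy] := pP y.
  have h1 := oy _ Mx; have h2 := ox _ My.
  have -> : '[p x, y] = '[p x, p y].
    by rewrite -[y in LHS](subrK (p y)) innerDr (innerC _ (y - _)) h1 conjc0 add0r.
  by rewrite -[x in RHS](subrK (p x)) innerDl h2 add0r.
exists (Projection PP) => x /=; rewrite PE; split=> [/Mid//|<-].
by have [] := pP x.
Qed.

End Subspace.

Lemma riesz H (f : H -> R[i]) (c : R) :
  (forall a x y, f (a *: x + y) = a * f x + f y) ->
  (forall x, nrm (f x) <= c * nrm x) -> exists y, forall x, f x = '[x, y].
Proof.
move=> lf fc; pose M := [set x | f x = 0].
have f0 : f 0 = 0.
  have := lf 1 0 0; rewrite scale1r addr0 mul1r => h.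
  by apply/eqP; rewrite -[X in X == _](addrK (f 0)) -h subrr.
have fB x y : f (x - y) = f x - f y.
  by rewrite addrC -scaleN1r lf mulN1r addrC.
have sM : subsp M.
  by split=> // a x y; rewrite /M/= => fx fy; rewrite lf fx fy mulr0 addr0.
have cM : seq_closed M.
  move=> u l fu ul; rewrite /M/=.
  apply: (ncvg_unique (F := \oo) (u := fun=> 0)); last exact: ncvg_cst.
  by apply: ncvg_le ul => n; rewrite -(fu n) -fB; exact: fc.
have [[x fx]|nf] := pselect (exists x, f x <> 0); last first.
  exists 0 => x; rewrite inner0r; apply: contrapT => fx.
  by apply: nf; exists x.
have [m Mm mo] := orth_decomp sM cM x.
set z := x - m in mo; have fz : f z = f x by rewrite fB Mm subr0.
have z0 : '[z, z] != 0.
  apply/eqP => z0; apply: fx; rewrite -fz.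
  suff -> : z = 0 by rewrite f0.
  by apply: nrm0_eq0; apply/eqP; rewrite -sqrf_eq0 nrm_sqrE z0.
exists ((f z / '[z, z])^*%C *: z) => y.
have My : M (y - (f y / f z) *: z).
  rewrite /M/= fB -[_ *: z]addr0 lf f0 addr0 mulfVK ?subrr//.
  by rewrite fz; exact/eqP.
rewrite -[y in RHS](subrK ((f y / f z) *: z)) innerDl !innerZr conjcK.
rewrite (innerC (y - _)) (mo _ My) conjc0 mulr0 add0r innerZl.
by field; rewrite fz z0; apply/andP; split=> //; exact/eqP.
Qed.

(** Adjoints, transport plans and weak operator limits are all obtained from their sesquilinear
    forms. *)
Lemma sesq_bop H K (B : H -> K -> R[i]) (c : R) :
  (forall a x x' y, B (a *: x + x') y = a * B x y + B x' y) ->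
  (forall a x y y', B x (a *: y + y') = a^*%C * B x y + B x y') ->
  (forall x y, nrm (B x y) <= c * nrm x * nrm y) ->
  exists T : bop H K, forall x y, '[T x, y] = B x y.
Proof.
move=> Bl Br Bc.
have /choice[T TP] : forall x, exists v, forall y, '[v, y] = B x y.
  move=> x; have [||v vP] := @riesz K (fun y => (B x y)^*%C) (c * nrm x).
  - by move=> a y y'; rewrite Br rmorphD rmorphM/= conjcK.
  - by move=> y; rewrite nrmJ.
  by exists v => y; rewrite innerC -vP conjcK.
have lT : linear T.
  move=> a x x'; apply: inner_inj => y.
  by rewrite innerDl innerZl !TP Bl.
have nT x : nrm (T x) <= `|c| * nrm x.
  have := Bc x (T x); rewrite -TP inner_nrm nrmC ger0_norm ?sqr_ge0// expr2.
  have [-> _|t0] := eqVneq (nrm (T x)) 0; first by rewrite mulr_ge0 ?nrm_ge0.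
  rewrite ler_pM2r ?lt_def ?t0 ?nrm_ge0// => /le_trans; apply.
  by rewrite ler_wpM2r ?nrm_ge0 ?ler_norm.
have [S ST] := bop_build lT nT.
by exists S => x y; rewrite ST.
Qed.

Lemma adjoint_exists H K (T : bop H K) : exists S, is_adjoint T S.
Proof.
have [M M0 TM] := bop_bounded T.
have [||y x|S SP] := @sesq_bop K H (fun y x => ('[T x, y])^*%C) M.
- by move=> a y y' x; rewrite innerDr innerZr rmorphD rmorphM/= conjcK.
- by move=> a y x x'; rewrite linearP innerDl innerZl rmorphD rmorphM.
- by rewrite nrmJ (le_trans (inner_le _ _))// mulrAC ler_wpM2r ?nrm_ge0 ?TM.
by exists S => x y; rewrite innerC (innerC x) SP conjcK -innerC.
Qed.

End Bop.

(** * The lattice of projections *)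

Section Projections.
Context {R : realType}.

Section OneSpace.
Context {H : hilbertType R}.
Implicit Types (P Q : projection H) (F G : set (projection H)) (x y : H).

Lemma eq_proj P Q : (forall x, P x = Q x) -> P = Q.
Proof. by move=> PQ; apply/val_inj/eq_bop. Qed.

Lemma proj_build (f : bop H H) : (forall x, f (f x) = f x) ->
  is_adjoint f f -> exists P : projection H, forall x, P x = f x.
Proof.
move=> ff af; suff fP : f \in @is_proj R H by exists (Projection fP).
by apply/asboolP; split=> //; apply: eq_bop.
Qed.

Lemma proj_orth P x : '[P x, x - P x] = 0.
Proof. by rewrite proj_adj linearB/= proj_idem subrr inner0r. Qed.

Lemma proj_pyth P x : nrm x ^+ 2 = nrm (P x) ^+ 2 + nrm (x - P x) ^+ 2.
Proof. by rewrite -nrm_pyth ?proj_orth// addrC subrK. Qed.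

Lemma proj_nrm_sqr P x : nrm (P x) ^+ 2 <= nrm x ^+ 2.
Proof. by rewrite (proj_pyth P x) lerDl sqr_ge0. Qed.

Lemma proj_nrm P x : nrm (P x) <= nrm x.
Proof. by rewrite -(@ler_pXn2r _ 2) ?nnegrE ?nrm_ge0// proj_nrm_sqr. Qed.

Lemma pcompl_exists P : exists Q, forall x, Q x = x - P x.
Proof.
have [||Q QE] := @proj_build (idop H - (P : bop H H)); last by exists Q => x; rewrite QE.
  by move=> x; rewrite !bopBE !idopE linearB/= proj_idem subrr subr0.
by move=> x y; rewrite !bopBE !idopE innerBl innerBr proj_adj.
Qed.

Definition pcompl P := sval (cid (pcompl_exists P)).

Lemma pcomplE P x : pcompl P x = x - P x.
Proof. exact: (svalP (cid (pcompl_exists P))). Qed.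

Lemma pcomplK P : pcompl (pcompl P) = P.
Proof. by apply: eq_proj => x; rewrite !pcomplE opprB addrC subrK. Qed.

Lemma pcompl_eq0 P x : pcompl P x = 0 <-> P x = x.
Proof.
rewrite pcomplE; split=> [/eqP|->]; last by rewrite subrr.
by rewrite subr_eq0 => /eqP.
Qed.

Lemma pcompl_id P x : pcompl P x = x <-> P x = 0.
Proof. by rewrite -{2}(pcomplK P) pcompl_eq0. Qed.

Lemma pinf_exists F :
  exists P, forall x, (forall Q, F Q -> Q x = x) <-> P x = x.
Proof.
apply: (@proj_exists _ _ [set x | forall Q, F Q -> Q x = x]).
  split=> [Q _|a x y Fx Fy Q FQ]; first by rewrite linear0.
  by rewrite linearP/= (Fx _ FQ) (Fy _ FQ).
move=> u l Fu ul Q FQ; apply: (ncvg_unique (F := \oo) (u := u)) => //.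
by apply: ncvg_ext (ncvg_bop Q ul) => n; rewrite Fu.
Qed.

Definition pinf F := sval (cid (pinf_exists F)).

Lemma pinfP F x : pinf F x = x <-> forall Q, F Q -> Q x = x.
Proof. by rewrite (svalP (cid (pinf_exists F))). Qed.

Definition psup F := pcompl (pinf [set pcompl P | P in F]).

(** The range of a supremum is the closure of a sum, with no pointwise description; its kernel has
    one, so suprema are handled through kernels. *)
Lemma psupP F x : psup F x = 0 <-> forall Q, F Q -> Q x = 0.
Proof.
rewrite pcompl_eq0 pinfP; split=> h Q.
  by move=> FQ; apply/pcompl_id/h; exists Q.
by case=> P FP <-; apply/pcompl_id/h.
Qed.

Lemma proj_leP P Q : (P <= Q)%O <-> forall x, P x = x -> Q x = x.
Proof.
split=> [/le_projP PQ x Px|PQ]; first by rewrite -Px PQ Px.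
by apply/le_projP => x; apply: PQ; exact: proj_idem.
Qed.

Lemma le_pcompl P Q : (P <= Q)%O -> (pcompl Q <= pcompl P)%O.
Proof.
move=> /proj_leP PQ; apply/proj_leP => x /pcompl_id Qx; apply/pcompl_id.
apply: inner_eq0P => y; rewrite proj_adj -(PQ _ (proj_idem P y)).
by rewrite -proj_adj Qx inner0l.
Qed.

Lemma le_pcomplE P Q : (pcompl Q <= pcompl P)%O = (P <= Q)%O.
Proof.
by apply/idP/idP => /le_pcompl//; rewrite !pcomplK.
Qed.

Lemma proj_le0P P Q : (P <= Q)%O <-> forall x, Q x = 0 -> P x = 0.
Proof.
rewrite -le_pcomplE proj_leP; split=> h x.
  by move=> /pcompl_id/h/pcompl_id.
by move=> /pcompl_id/h/pcompl_id.
Qed.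

Lemma proj_le_absl P Q x : (P <= Q)%O -> Q (P x) = P x.
Proof. by move=> /le_projP. Qed.

Lemma proj_le_absr P Q x : (P <= Q)%O -> P (Q x) = P x.
Proof.
move=> PQ; apply: inner_inj => y.
by rewrite proj_adj [in LHS]proj_adj proj_le_absl// -proj_adj.
Qed.

Lemma infimumsP F P : infimums F P <-> P = pinf F.
Proof.
have lb Q : lbound F Q <-> (Q <= pinf F)%O.
  split=> [FQ|Qi Q' FQ'].
    apply/proj_leP => x Qx; apply/pinfP => Q' /FQ /proj_leP; exact.
  apply/proj_leP => x Qx; move/proj_leP : Qi => /(_ _ Qx) /pinfP; exact.
split=> [[/lb Pi Pu]|->].
  by apply/eqP; rewrite eq_le Pi; apply: Pu; apply/lb.
by split; [apply/lb|move=> Q /lb].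
Qed.

Lemma supremumsP F P : supremums F P <-> P = psup F.
Proof.
have ub Q : ubound F Q <-> (psup F <= Q)%O.
  split=> [FQ|Qi Q' FQ'].
    apply/proj_le0P => x Qx; apply/psupP => Q' /FQ /proj_le0P; exact.
  apply/proj_le0P => x Qx; move/proj_le0P : Qi => /(_ _ Qx) /psupP; exact.
split=> [[/ub Pi Pu]|->].
  by apply/eqP; rewrite eq_le Pi andbT; apply: Pu; apply/ub.
by split; [apply/ub|move=> Q /ub].
Qed.

Lemma pinf_le F P : F P -> (pinf F <= P)%O.
Proof. by move=> FP; apply/proj_leP => x /pinfP; exact. Qed.

Lemma le_psup F P : F P -> (P <= psup F)%O.
Proof. by move=> FP; apply/proj_le0P => x /psupP; exact. Qed.

Lemma le_pinf F P : (forall Q, F Q -> (P <= Q)%O) -> (P <= pinf F)%O.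
Proof. by move=> FP; apply/proj_leP => x Px; apply/pinfP => Q /FP/proj_leP; exact. Qed.

Lemma psup_le F P : (forall Q, F Q -> (Q <= P)%O) -> (psup F <= P)%O.
Proof. by move=> FP; apply/proj_le0P => x Px; apply/psupP => Q /FP/proj_le0P; exact. Qed.

Lemma pcompl_pinf F : pcompl (pinf F) = psup [set pcompl P | P in F].
Proof.
rewrite /psup; congr (pcompl (pinf _)); apply/seteqP; split=> [P FP|_ [_ [P FP <-] <-]].
  by exists (pcompl P); [exists P|rewrite pcomplK].
by rewrite pcomplK.
Qed.

Lemma pcompl_psup F : pcompl (psup F) = pinf [set pcompl P | P in F].
Proof. by rewrite /psup pcomplK. Qed.

Lemma proj0E x : proj0 H x = 0. Proof. by []. Qed.
Lemma proj1E x : proj1 H x = x. Proof. by []. Qed.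

Lemma pcompl0 : pcompl (proj0 H) = proj1 H.
Proof. by apply: eq_proj => x; rewrite pcomplE proj0E subr0. Qed.

Lemma pcompl1 : pcompl (proj1 H) = proj0 H.
Proof. by apply: eq_proj => x; rewrite pcomplE proj1E subrr. Qed.

Lemma pinf_set0 : pinf set0 = proj1 H.
Proof. by apply: eq_proj => x; apply/pinfP. Qed.

Lemma psup_set0 : psup set0 = proj0 H.
Proof. by apply: eq_proj => x; rewrite proj0E; apply/psupP. Qed.

Definition pmeet P Q := pinf [set P; Q].
Definition pjoin P Q := psup [set P; Q].

Lemma pmeetP P Q x : pmeet P Q x = x <-> P x = x /\ Q x = x.
Proof.
rewrite pinfP; split=> [h|[Px Qx] T]; first by split; apply: h; [left|right].
by case=> ->.
Qed.

Lemma pmeetl P Q : (pmeet P Q <= P)%O. Proof. by apply: pinf_le; left. Qed.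
Lemma pmeetr P Q : (pmeet P Q <= Q)%O. Proof. by apply: pinf_le; right. Qed.
Lemma pjoinl P Q : (P <= pjoin P Q)%O. Proof. by apply: le_psup; left. Qed.
Lemma pjoinr P Q : (Q <= pjoin P Q)%O. Proof. by apply: le_psup; right. Qed.

Lemma pcompl_meet P Q : pcompl (pmeet P Q) = pjoin (pcompl P) (pcompl Q).
Proof.
rewrite /pmeet pcompl_pinf; congr psup; rewrite image_setU; congr (_ `|` _);
  exact: image_set1.
Qed.

Lemma pcompl_join P Q : pcompl (pjoin P Q) = pmeet (pcompl P) (pcompl Q).
Proof. by rewrite -[RHS]pcomplK pcompl_meet !pcomplK. Qed.

Definition pcomm P Q := forall x, P (Q x) = Q (P x).

Lemma pcommC P Q : pcomm P Q -> pcomm Q P.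
Proof. by move=> h x; rewrite h. Qed.

Lemma pcomm_compl P Q : pcomm P Q -> pcomm P (pcompl Q).
Proof. by move=> h x; rewrite !pcomplE linearB/= h. Qed.

Lemma pmeetE P Q x : pcomm P Q -> pmeet P Q x = P (Q x).
Proof.
move=> PQ; apply: inner_injr => z.
have h : pmeet P Q (P (Q x)) = P (Q x).
  by apply/pmeetP; split; rewrite ?proj_idem// -PQ proj_idem.
rewrite -[in RHS]h -[RHS]proj_adj -[RHS]proj_adj -[RHS]proj_adj.
have [Pz Qz] : P (pmeet P Q z) = pmeet P Q z /\ Q (pmeet P Q z) = pmeet P Q z.
  by apply/pmeetP; exact: proj_idem.
by rewrite Pz Qz proj_adj.
Qed.

Lemma pjoinE P Q x : pcomm P Q -> pjoin P Q x = P x + Q x - P (Q x).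
Proof.
move=> PQ; rewrite -[pjoin P Q]pcomplK pcompl_join pcomplE pmeetE; last first.
  exact/pcommC/pcomm_compl/pcommC/pcomm_compl.
rewrite !pcomplE [P (_ - _)]linearB/= opprB opprB addrCA [x + _]addrC subrK.
by rewrite addrAC.
Qed.

Lemma proj_le_anti P Q : (P <= Q)%O -> (Q <= P)%O -> P = Q.
Proof. by move=> PQ QP; apply/eqP; rewrite eq_le PQ. Qed.

(** The numbers [nrm (p n x) ^+ 2] decrease and their differences are squared distances, so the
    sequence is Cauchy. Its limit is fixed by every [p k], and has the scalar products of the
    infimum. *)
Lemma pinf_cvg (p : nat -> projection H) x :
  (forall n, (p n.+1 <= p n)%O) -> ncvg \oo (fun n => p n x) (pinf (range p) x).
Proof.
move=> pS.
have pm n m : (n <= m)%N -> (p m <= p n)%O.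
  by move=> /subnK <-; elim: (_ - _)%N => // k; apply: le_trans; exact: pS.
have [l pl] : exists l, ncvg \oo (fun n => p n x) l.
  apply: ncauchy_cvg => e e0.
  pose a n := nrm (p n x) ^+ 2.
  have da n m : (n <= m)%N -> nrm (p n x - p m x) ^+ 2 = a n - a m.
    move=> nm; rewrite /a -(proj_le_absr x (pm _ _ nm)).
    by rewrite [in RHS](proj_pyth (p m) (p n x)) [RHS]addrAC subrr add0r.
  have E0 : range a !=set0 by exists (a 0%N), 0%N.
  have lE : has_lbound (range a) by exists 0 => _ [n _ <-]; rewrite sqr_ge0.
  have [_ [N _ <-] aN] := inf_adherent (exprn_gt0 2 e0) (conj E0 lE).
  have ale n : inf (range a) <= a n by apply: ge_inf => //; exists n.
  have am n m : (n <= m)%N -> a m <= a n.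
    by move=> nm; rewrite -subr_ge0 -da// sqr_ge0.
  have h n m : (N <= n)%N -> (n <= m)%N -> nrm (p n x - p m x) <= e.
    move=> Nn nm; rewrite -(@ler_pXn2r _ 2) ?nnegrE ?nrm_ge0 ?(ltW e0)// da//.
    by have := am _ _ Nn; have := ale m; move: aN; lra.
  exists N => n m Nn Nm; have [nm|/ltnW mn] := leqP n m; first exact: h.
  by rewrite nrm_sub h.
have pl' k : p k l = l.
  apply: (ncvg_unique (F := \oo) (u := fun n => p k (p (n + k)%N x))).
    by apply: ncvg_bop; rewrite /ncvg (cvg_shiftn k (fun n => nrm (p n x - l))).
  apply: (@ncvg_ext _ _ _ _ (fun n => p (n + k)%N x)).
    by move=> n; rewrite proj_le_absl// pm// leq_addl.
  by rewrite /ncvg (cvg_shiftn k (fun n => nrm (p n x - l))).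
suff -> : pinf (range p) x = l by [].
have il : pinf (range p) l = l by apply/pinfP => _ [k _ <-].
have xl y : '[pinf (range p) x, y] = '[l, y].
  rewrite -il proj_adj [RHS]proj_adj; set z := pinf _ y.
  apply: (ncvg_unique (F := \oo) (u := fun n => '[p n x, z])); last exact: ncvg_inner.
  apply: ncvg_ext (ncvg_cst '[x, z]) => n; rewrite proj_adj.
  suff -> : p n z = z by [].
  by have /pinfP := proj_idem (pinf (range p)) y; apply; exists n.
exact: inner_inj.
Qed.

Lemma psup_cvg (p : nat -> projection H) x :
  (forall n, (p n <= p n.+1)%O) -> ncvg \oo (fun n => p n x) (psup (range p) x).
Proof.
move=> pS; have pc n : (pcompl (p n.+1) <= pcompl (p n))%O by rewrite le_pcomplE.
have : ncvg \oo (fun n => x - pcompl (p n) x)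
    (x - pinf (range (fun n => pcompl (p n))) x).
  by apply: ncvgB; [exact: ncvg_cst|exact: pinf_cvg].
have -> : range (fun n => pcompl (p n)) = [set pcompl P | P in range p].
  apply/seteqP; split=> [_ [n _ <-]|_ [_ [n _ <-] <-]]; last by exists n.
  by exists (p n) => //; exists n.
rewrite -pcompl_psup pcomplE opprB addrC subrK => h.
by apply: ncvg_ext h => n; rewrite pcomplE opprB addrC subrK.
Qed.

(** A range invariant under an operator and its adjoint reduces the operator. *)
Lemma proj_commute (T S : bop H H) P : is_adjoint T S ->
  (forall x, P x = x -> P (T x) = T x) -> (forall x, P x = x -> P (S x) = S x) ->
  forall x, T (P x) = P (T x).
Proof.
move=> TS PT PS x; apply: inner_inj => y.
rewrite -(PT _ (proj_idem P x)) proj_adj TS proj_adj.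
by rewrite (PS _ (proj_idem P y)) [RHS]proj_adj TS.
Qed.

Lemma pinf_commute (T S : bop H H) F : is_adjoint T S ->
  (forall P, F P -> forall x, T (P x) = P (T x)) ->
  forall x, T (pinf F x) = pinf F (T x).
Proof.
move=> TS TF; have SF P : F P -> forall x, S (P x) = P (S x).
  move=> FP x; apply: inner_injr => y.
  by rewrite -TS -proj_adj -TF// TS proj_adj.
by apply: (proj_commute TS) => x /pinfP xF; apply/pinfP => P FP;
  rewrite -?TF// -?SF// xF.
Qed.

Lemma psup_commute (T S : bop H H) F : is_adjoint T S ->
  (forall P, F P -> forall x, T (P x) = P (T x)) ->
  forall x, T (psup F x) = psup F (T x).
Proof.
move=> TS TF x; rewrite /psup !pcomplE linearB/=; congr (_ - _).
apply: (pinf_commute TS) => _ [P FP <-] z.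
by rewrite !pcomplE linearB/= TF.
Qed.

Lemma pcomm_inf P F : (forall Q, F Q -> pcomm P Q) -> pcomm P (pinf F).
Proof. exact: (pinf_commute (proj_adj P)). Qed.

Lemma pcomm_sup P F : (forall Q, F Q -> pcomm P Q) -> pcomm P (psup F).
Proof. exact: (psup_commute (proj_adj P)). Qed.

End OneSpace.
End Projections.

(** * Two extremal problems *)

Section Minimization.
Context {R : realType}.

Lemma geometric_small (c e : R) : 0 < e -> exists n : nat, c * 2^-1 ^+ n <= e.
Proof.
move=> e0; have h : (c * 2^-1 ^+ n : R) @[n --> \oo] --> c * 0.
  apply: cvgMr; apply: cvg_expr.
  by rewrite ger0_norm ?invr_ge0// invf_lt1 ?ltr1n.
move/cvgrPdist_le : h => /(_ _ e0)[N _ /(_ N (leqnn N))].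
by rewrite mulr0 sub0r normrN => h; exists N; rewrite (le_trans (ler_norm _)).
Qed.

(* Replacing a minimizing sequence [e] by its tail infima and then taking the
   supremum of these loses nothing in the limit, because modularity bounds the
   excess of a meet by the sum of the excesses. *)
Lemma modular_min (X : Type) (L : set X) (le : X -> X -> Prop) (f : X -> R)
    (meet : X -> X -> X) (B : R) :
  L !=set0 -> (forall x, L x -> B <= f x) ->
  (forall x y z, le x y -> le y z -> le x z) ->
  (forall x y, L x -> L y -> [/\ L (meet x y), le (meet x y) x, le (meet x y) y &
     forall z, L z -> le z x -> le z y -> le z (meet x y)]) ->
  (forall x y, L x -> L y -> exists2 j, L j & f (meet x y) + f j <= f x + f y) ->
  (forall u, (forall n, L (u n)) -> (forall n, le (u n.+1) (u n)) ->
     exists a, [/\ L a, forall n, le a (u n),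
       forall b, L b -> (forall n, le b (u n)) -> le b a &
       forall M, (forall n, f (u n) <= M) -> f a <= M]) ->
  (forall u, (forall n, L (u n)) -> (forall n, le (u n) (u n.+1)) ->
     exists2 a, L a & forall k M, (forall n, (k <= n)%N -> f (u n) <= M) -> f a <= M) ->
  exists2 a, L a & forall b, L b -> f a <= f b.
Proof.
move=> [x0 Lx0] fB letr meetP modP decP incP.
pose E := [set f x | x in L].
have E0 : E !=set0 by exists (f x0), x0.
have lE : has_lbound E by exists B => _ [x Lx <-]; exact: fB.
set s := inf E.
have sle x : L x -> s <= f x by move=> Lx; apply: ge_inf => //; exists x.
have hp n : 0 < (2^-1 : R) ^+ n by rewrite exprn_gt0// invr_gt0.
have /choice[e eP] : forall n, exists e, L e /\ f e <= s + 2^-1 ^+ n.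
  move=> n; have [_ [e Le <-] /ltW h] := inf_adherent (hp n) (conj E0 lE).
  by exists e.
have eL n := (eP n).1.
(* [g n m] is the meet of [e n], ..., [e (n + m)]. *)
pose g := fix g n m : X := if m is m'.+1 then meet (g n m') (e (n + m)%N) else e n.
have g0E n : g n 0%N = e n by [].
have gSE n m : g n m.+1 = meet (g n m) (e (n + m.+1)%N) by [].
clearbody g.
have gL n m : L (g n m).
  by elim: m => [|m IH]; rewrite ?g0E ?gSE; [exact: eL|have [] := meetP _ _ IH (eL (n + m.+1)%N)].
have gS n m : le (g n m.+1) (g n m) by rewrite gSE; have [] := meetP _ _ (gL n m) (eL (n + m.+1)%N).
have ge n m : g n m = e n /\ m = 0%N \/ le (g n m) (e (n + m)%N).
  case: m => [|m]; first by left.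
  by right; rewrite gSE; have [] := meetP _ _ (gL n m) (eL (n + m.+1)%N).
(* The join costs at least [s], so meeting with [e (n + m.+1)] adds at most its excess 2^-(n+m+1);
   the bound is the geometric sum of these excesses. *)
have gf n m : f (g n m) <= s + 2 * 2^-1 ^+ n - 2^-1 ^+ (n + m).
  elim: m => [|m IH]; first by rewrite addn0 g0E; have := (eP n).2; move: (2^-1 ^+ n) => p; lra.
  have [j Lj] := modP _ _ (gL n m) (eL (n + m.+1)%N).
  rewrite -gSE.
  have := sle _ Lj; have := (eP (n + m.+1)%N).2; rewrite addnS exprS.
  move: IH; move: (2^-1 ^+ (n + m)) (2^-1 ^+ n) => p q; lra.
have /choice[G GP] := fun n => decP _ (gL n) (gS n).
have GL n : L (G n) by have [] := GP n.
have Gg n m : le (G n) (g n m) by have [_ + _ _] := GP n; exact.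
have Gf n : f (G n) <= s + 2 * 2^-1 ^+ n.
  have [_ _ _] := GP n; apply => m; have := gf n m; have := hp (n + m)%N.
  by move: (2^-1 ^+ (n + m)) (2^-1 ^+ n) => p q; lra.
have Ge n m : le (G n) (e (n + m)%N).
  by have [[ge0 m0]|h] := ge n m; [have := Gg n m; rewrite ge0 m0 addn0
    |apply: letr h; exact: Gg].
have GS n : le (G n) (G n.+1).
  have [_ _ + _] := GP n.+1; apply => // m.
  elim: m => [|m IH]; first by have := Ge n 1%N; rewrite addn1 g0E.
  rewrite gSE; have [_ _ _] := meetP _ _ (gL n.+1 m) (eL (n.+1 + m.+1)%N); apply => //.
  by rewrite addSnnS; exact: Ge.
have [a La aP] := incP _ GL GS; exists a => // b /sle; apply: le_trans.
suff h k : f a <= s + 2 * 2^-1 ^+ k.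
  apply/ler_addgt0Pr => d d0; have [k kd] := geometric_small 2 d0.
  by apply: le_trans (h k) _; rewrite lerD2l.
apply: (aP k) => n kn; apply: le_trans (Gf n) _.
by rewrite lerD2l ler_pM2l// ler_wiXn2l ?invr_ge0// invf_le1 ?ler1n.
Qed.

Lemma cvg_sumr {T : Type} {F : set_system T} {FF : ProperFilter F} (I : finType)
    (f : I -> T -> R) (l : I -> R) :
  (forall i, f i x @[x --> F] --> l i) -> \sum_i f i x @[x --> F] --> \sum_i l i.
Proof.
move=> fl; rewrite -[X in X @ _](_ : \sum_i f i = _); last first.
  by apply/funext => x; rewrite fct_sumE.
by elim/big_rec2: _ => [|i a b _ h]; [exact: cvg_cst|exact: cvgD].
Qed.

Section Ultra.
Context {T : Type} {U : set_system T} {UU : UltraFilter U}.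

(** The limit is the supremum of the [r] below [g] on a set of [U]; any larger threshold fails on a
    set of [U], by the ultrafilter dichotomy. *)
Lemma ultra_bounded_cvg (g : T -> R) (c : R) :
  (forall i, `|g i| <= c) -> exists l : R, g @ U --> l.
Proof.
move=> gc; pose E := [set r | U [set i | r <= g i]].
have gE i : - c <= g i <= c by rewrite -ler_norml.
have E0 : E !=set0.
  by exists (- c); rewrite /E/=; apply: filterE => i /=; have /andP[] := gE i.
have uE : has_ubound E.
  exists c => r Er; have [i /= ri] := filter_ex Er.
  by apply: le_trans ri _; have /andP[] := gE i.
exists (sup E); apply/cvgrPdist_le => e e0.
have [r Er re] := sup_adherent e0 (conj E0 uE).
have [Ug|Ug] := in_ultra_setVsetC [set i | sup E + e <= g i] UU.
  by have := ub_le_sup uE Ug; rewrite gerDl leNgt e0.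
near=> i; rewrite ler_norml; apply/andP; split.
  have : ~ (sup E + e <= g i) by near: i; exact: Ug.
  by move=> /negP; rewrite -ltNge; lra.
have : r <= g i by near: i; exact: Er.
lra.
Unshelve. all: by end_near. Qed.

Lemma ultra_ncvg (g : T -> R[i]) (c : R) :
  (forall i, nrm (g i) <= c) -> exists l, ncvg U g l.
Proof.
move=> gc.
have [|a ga] := @ultra_bounded_cvg (fun i => complex.Re (g i)) c.
  by move=> i; rewrite (le_trans (Re_le_nrm _)).
have [|b gb] := @ultra_bounded_cvg (fun i => complex.Im (g i)) c.
  by move=> i; rewrite (le_trans (Im_le_nrm _)).
exists (a +i* b); apply/ncvgP => e e0.
have e2 : 0 < e / 2 by rewrite divr_gt0.
move/cvgrPdist_le : ga => /(_ _ e2) ga; move/cvgrPdist_le : gb => /(_ _ e2) gb.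
near=> i; apply: le_trans (nrm_le_ReIm _) _.
rewrite ReD ImD ReN ImN/= [leRHS](splitr e) lerD// distrC; near: i; assumption.
Unshelve. all: by end_near. Qed.

End Ultra.
End Minimization.

(** * A finite transport problem *)

Section Transport.
Context {R : realType} {I J : finType}.
Variables (a : I -> R) (b : J -> R) (bad : I -> J -> bool).
Hypotheses (a0 : forall i, 0 <= a i) (b0 : forall j, 0 <= b j).

Let rho (t : I -> J -> R) i := \sum_j t i j * b j.
Let kap (t : I -> J -> R) j := \sum_i t i j * a i.
Let F t := \sum_i a i * (1 - rho t i) ^+ 2 + \sum_j b j * (1 - kap t j) ^+ 2.
(** Cells with a massless side are excluded along with the bad ones: [F] does not see their weights
    and could not bound them. *)
Let good i j := [&& 0 < a i, 0 < b j & ~~ bad i j].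
Let adm (t : I -> J -> R) :=
  (forall i j, 0 <= t i j) /\ forall i j, ~~ good i j -> t i j = 0.

Let F_ge0 t : 0 <= F t.
Proof. by rewrite addr_ge0// sumr_ge0// => i _; rewrite mulr_ge0 ?sqr_ge0. Qed.

Let rho_ge0 t i : adm t -> 0 <= rho t i.
Proof. by move=> [t0 _]; rewrite sumr_ge0// => j _; rewrite mulr_ge0. Qed.

Let kap_ge0 t j : adm t -> 0 <= kap t j.
Proof. by move=> [t0 _]; rewrite sumr_ge0// => i _; rewrite mulr_ge0. Qed.

Let adm_bound t B i j : adm t -> F t <= B -> good i j ->
  t i j <= (2 + B / a i) / b j.
Proof.
move=> At FB /and3P[ai bj _]; have [t0 _] := At.
rewrite ler_pdivlMr//.
have h1 : t i j * b j <= rho t i.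
  by rewrite /rho (bigD1 j)//= lerDl sumr_ge0// => k _; rewrite mulr_ge0.
apply: le_trans h1 _.
have h2 : a i * (1 - rho t i) ^+ 2 <= B.
  apply: le_trans FB; rewrite /F (bigD1 i)//= -addrA lerDl addr_ge0// sumr_ge0//.
    by move=> k _; rewrite mulr_ge0 ?sqr_ge0.
  by move=> k _; rewrite mulr_ge0 ?sqr_ge0.
have h3 : (1 - rho t i) ^+ 2 <= B / a i by rewrite ler_pdivlMr// mulrC.
(* Completing the square at 3/2, (1 - r)^2 <= c gives r <= c + 5/4. *)
move: (B / a i) (rho t i) h3 => c r; have := sqr_ge0 (r - 3 / 2); rewrite !expr2; lra.
Qed.

(** Along a minimising sequence [adm_bound] keeps every weight bounded, so an ultrafilter limit
    exists cell by cell, and [F] is continuous in finitely many weights. *)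
Lemma transport_min : exists2 t, adm t & forall t', adm t' -> F t <= F t'.
Proof.
pose E := [set F t | t in adm].
have A0 : adm (fun _ _ => 0) by split.
have E0 : E !=set0 by exists (F (fun _ _ => 0)), (fun _ _ => 0).
have lE : has_lbound E by exists 0 => _ [t _ <-]; exact: F_ge0.
have /choice[t tP] : forall n : nat, exists t, adm t /\ F t <= inf E + n.+1%:R^-1.
  move=> n; have n0 : (0 : R) < n.+1%:R^-1 by rewrite invr_gt0.
  by have [_ [t At <-] /ltW h] := inf_adherent n0 (conj E0 lE); exists t.
have FB n : F (t n) <= inf E + 1.
  by apply: le_trans (tP n).2 _; rewrite lerD2l invf_le1// ler1n.
have [U [UU oU]] := @ultraFilterLemma nat \oo _.
have /choice[t' t'P] : forall ij : I * J, exists l : R, t n ij.1 ij.2 @[n --> U] --> l.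
  move=> [i j] /=; have [g|g] := boolP (good i j).
    apply: (@ultra_bounded_cvg _ _ _ _ _ ((2 + (inf E + 1) / a i) / b j)) => n.
    rewrite ger0_norm; last by have [[]] := tP n.
    by apply: adm_bound => //; have [] := tP n.
  exists 0; rewrite (_ : (fun n => t n i j) = fun=> 0); first exact: cvg_cst.
  by apply/funext => n; have [[_ ->]] := tP n.
pose u i j := t' (i, j).
have tu i j : t n i j @[n --> U] --> u i j by exact: (t'P (i, j)).
have Au : adm u.
  split=> i j; last first.
    move=> g; have := tu i j; rewrite (_ : (fun n => t n i j) = fun=> 0).
      by move=> h; exact: (cvg_unique _ h (cvg_cst _)).
    by apply/funext => n; have [[_ ->]] := tP n.
  have t0 : \forall n \near U, 0 <= t n i j by apply: filterE => n; have [[]] := tP n.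
  exact: cvgr_to_ge (tu i j) t0.
exists u => // v Av.
have FvE : inf E <= F v by apply: ge_inf => //; exists v.
apply: le_trans FvE.
have Fc : F (t n) @[n --> U] --> F u.
  apply: cvgD.
    apply: cvg_sumr => i; apply: cvgMr; rewrite expr2.
    by apply: cvgM; apply: cvgB; (try exact: cvg_cst); apply: cvg_sumr => j;
      apply: cvgMl.
  apply: cvg_sumr => i; apply: cvgMr; rewrite expr2.
  by apply: cvgM; apply: cvgB; (try exact: cvg_cst); apply: cvg_sumr => j;
    apply: cvgMl.
have h2 : inf E + n.+1%:R^-1 @[n --> U] --> inf E.
  rewrite -[X in _ --> X]addr0; apply: cvgD; first exact: cvg_cst.
  by apply: cvg_trans (@cvg_harmonic R) => A /= hA; exact: oU.
by apply: (ler_cvg_to Fc h2); apply: filterE => n; have [] := tP n.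
Qed.

Let bump (t : I -> J -> R) i j h i' j' := t i' j' + h * ((i' == i) && (j' == j))%:R.

Let F_bump t i j h : F (bump t i j h) =
  F t - 2 * h * (a i * b j) * (2 - rho t i - kap t j) + h ^+ 2 * (a i * b j) * (a i + b j).
Proof.
have rE i' : rho (bump t i j h) i' = rho t i' + h * b j * (i' == i)%:R.
  rewrite /rho (eq_bigr (fun j' => t i' j' * b j' + (h * (i' == i)%:R * b j') * (j' == j)%:R)).
    rewrite big_split/=; congr (_ + _); rewrite (bigD1 j)//= eqxx mulr1.
    by rewrite big1 ?addr0 => [|k /negPf ->]; [ring|rewrite mulr0].
  by move=> j' _; rewrite /bump -mulnb natrM; ring.
have kE j' : kap (bump t i j h) j' = kap t j' + h * a i * (j' == j)%:R.
  rewrite /kap (eq_bigr (fun i' => t i' j' * a i' + (h * (j' == j)%:R * a i') * (i' == i)%:R)).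
    rewrite big_split/=; congr (_ + _); rewrite (bigD1 i)//= eqxx mulr1.
    by rewrite big1 ?addr0 => [|k /negPf ->]; [ring|rewrite mulr0].
  by move=> i' _; rewrite /bump -mulnb natrM; ring.
rewrite /F (bigD1 i)//= (bigD1 j)//= (bigD1 i (P := predT))//= (bigD1 j (P := predT))//=.
rewrite !rE !kE !eqxx !mulr1.
rewrite (eq_bigr (fun i' => a i' * (1 - rho t i') ^+ 2)); last first.
  by move=> k /negPf ki; rewrite rE ki mulr0 addr0.
rewrite (eq_bigr (fun j' => b j' * (1 - kap t j') ^+ 2)); last first.
  by move=> k /negPf ki; rewrite kE ki mulr0 addr0.
move: (\sum_(i' | _) a i' * _) (\sum_(j' | _) b j' * _) (rho t i) (kap t j) => u v r k.
ring.
Qed.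

(* The weights [t] minimise [F], a relaxation of the transport problem.  At a
   minimum the first-order conditions force [rho t i + kap t j] to be [2] where
   [t] charges [(i, j)], which keeps both marginal densities below [2]. *)
Lemma transport : exists t : I -> J -> R,
  [/\ forall i j, 0 <= t i j, forall i j, bad i j -> t i j = 0,
      forall i, \sum_j t i j * b j <= 2, forall j, \sum_i t i j * a i <= 2 &
      forall i j, 0 < a i -> 0 < b j -> ~~ bad i j ->
        2 <= \sum_j t i j * b j + \sum_i t i j * a i].
Proof.
have [t At tmin] := transport_min.
have [t0 tg] := At.
have perturb i j h : good i j -> 0 <= t i j + h ->
    2 * h * (2 - rho t i - kap t j) <= h ^+ 2 * (a i + b j).
  move=> g th; have /and3P[ai bj _] := g.
  have : F t <= F (bump t i j h).
    apply: tmin; split=> i' j'.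
      rewrite /bump; case: (boolP (_ && _)) => [/andP[/eqP-> /eqP->]|_].
        by rewrite mulr1.
      by rewrite mulr0 addr0.
    move=> g'; rewrite /bump tg// add0r; case: (boolP (_ && _)) => [|_]; last by rewrite mulr0.
    by move=> /andP[/eqP i'i /eqP j'j]; rewrite i'i j'j g in g'.
  rewrite F_bump => hF.
  have ab : 0 < a i * b j by rewrite mulr_gt0.
  rewrite -(ler_pM2l ab); move: hF; move: (F t) => f; lra.
have lower i j : good i j -> 2 <= rho t i + kap t j.
  move=> g; have /and3P[ai bj _] := g.
  rewrite leNgt; apply/negP => lt2; set d := 2 - rho t i - kap t j.
  have d0 : 0 < d by rewrite /d; lra.
  have s0 : 0 < a i + b j by rewrite addr_gt0.
  (* The step minimising the quadratic of [F_bump]: [perturb] then reads 2 h d <= h d. *)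
  have h0 : 0 < d / (a i + b j) by rewrite divr_gt0.
  have := perturb i j (d / (a i + b j)) g (addr_ge0 (t0 i j) (ltW h0)).
  rewrite -/d.
  have -> : (d / (a i + b j)) ^+ 2 * (a i + b j) = d / (a i + b j) * d.
    by field; rewrite gt_eqF.
  have : 0 < d / (a i + b j) * d by rewrite mulr_gt0.
  lra.
have upper i j : 0 < t i j -> rho t i + kap t j <= 2.
  move=> tij.
  have g : good i j by apply: contraT => /tg tij0; rewrite tij0 ltxx in tij.
  have /and3P[ai bj _] := g.
  rewrite leNgt; apply/negP => lt2; set d := rho t i + kap t j - 2.
  have d0 : 0 < d by rewrite /d; lra.
  have s0 : 0 < a i + b j by rewrite addr_gt0.
  (* Here weight is removed, so the step is also capped by [t i j]. *)
  pose h := Num.min (t i j) (d / (a i + b j)).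
  have h0 : 0 < h by rewrite lt_min tij divr_gt0.
  have ht : h <= t i j by rewrite ge_min lexx.
  have hd : h * (a i + b j) <= d by rewrite -ler_pdivlMr// ge_min lexx orbT.
  have := perturb i j (- h) g; rewrite subr_ge0 => /(_ ht).
  rewrite sqrrN.
  have : h ^+ 2 * (a i + b j) <= h * d by rewrite expr2 -mulrA ler_pM2l.
  have : 0 < h * d by rewrite mulr_gt0.
  rewrite /d; lra.
exists t; split=> //.
- by move=> i j ij; apply: tg; rewrite /good ij !andbF.
- move=> i; rewrite -/(rho t i); have [j tij|h] := pickP (fun j => 0 < t i j).
    by apply: le_trans (upper _ _ tij); rewrite lerDl kap_ge0.
  rewrite /rho big1// => j _; move: (h j); rewrite lt_def t0 andbT => /negbFE/eqP->.
  by rewrite mul0r.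
- move=> j; rewrite -/(kap t j); have [i tij|h] := pickP (fun i => 0 < t i j).
    by apply: le_trans (upper _ _ tij); rewrite lerDr rho_ge0.
  rewrite /kap big1// => i _; move: (h i); rewrite lt_def t0 andbT => /negbFE/eqP->.
  by rewrite mul0r.
- by move=> i j ai bj ij; apply: lower; rewrite /good ai bj.
Qed.

End Transport.

(** * Reflexivity of commutative bilattices *)

Section BooleanAlgebra.
Context {R : realType} {H : hilbertType R}.
Implicit Types (P Q : projection H) (L : set (projection H)).

Definition pairwise_comm L := forall P Q, L P -> L Q -> pcomm P Q.

(** The projections of the von Neumann algebra generated by [L], tested against commuting
    projections only. For commuting [L] this is the complete Boolean algebra called BB. *)
Definition bicomm L : set (projection H) :=
  [set P | forall Q, (forall P', L P' -> pcomm Q P') -> pcomm Q P].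

Lemma sub_bicomm L : L `<=` bicomm L.
Proof. by move=> P LP Q; apply. Qed.

Lemma bicomm1 L : bicomm L (proj1 H).
Proof. by move=> Q _ x. Qed.

Lemma bicomm_compl L P : bicomm L P -> bicomm L (pcompl P).
Proof. by move=> BP Q QL; apply: pcomm_compl; exact: BP. Qed.

Lemma bicomm_inf L (F : set (projection H)) : F `<=` bicomm L -> bicomm L (pinf F).
Proof. by move=> FB Q QL; apply: pcomm_inf => P /FB; exact. Qed.

Lemma bicomm_sup L (F : set (projection H)) : F `<=` bicomm L -> bicomm L (psup F).
Proof. by move=> FB Q QL; apply: pcomm_sup => P /FB; exact. Qed.

Lemma bicomm_meet L P Q : bicomm L P -> bicomm L Q -> bicomm L (pmeet P Q).
Proof. by move=> BP BQ; apply: bicomm_inf => _ [->|->]. Qed.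

Lemma bicomm_join L P Q : bicomm L P -> bicomm L Q -> bicomm L (pjoin P Q).
Proof. by move=> BP BQ; apply: bicomm_sup => _ [->|->]. Qed.

Lemma bicomm_comm L : pairwise_comm L -> pairwise_comm (bicomm L).
Proof.
move=> Lc P Q BP BQ; apply: BQ => P' LP'; apply: pcommC.
by apply: BP => P'' LP''; exact: Lc.
Qed.

(** Each new projection cuts every piece in two. Empty cuts are kept, so some [F i] may be zero. *)
Lemma atoms L (s : seq (projection H)) : pairwise_comm L ->
  (forall P, P \in s -> bicomm L P) ->
  exists (I : finType) (F : I -> projection H),
  [/\ forall i, bicomm L (F i), forall x, \sum_i F i x = x,
      forall i j x, i != j -> F i (F j x) = 0 &
      forall P, P \in s -> forall i,
        (forall x, P (F i x) = F i x) \/ (forall x, P (F i x) = 0)].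
Proof.
move=> /bicomm_comm Lc; elim: s => [_|P s IH sL].
  exists unit, (fun=> proj1 H); split=> //.
  by move=> x; rewrite (bigD1 tt)//= big1 ?addr0// => -[].
have [|I [F [FL Fs Fo sF]]] := IH.
  by move=> Q Qs; apply: sL; rewrite inE Qs orbT.
have LP : bicomm L P by apply: sL; rewrite inE eqxx.
have [P' [P't P'f]] : exists P' : bool -> projection H, P' true = P /\ P' false = pcompl P.
  by exists (fun b => if b then P else pcompl P).
have LP' b : bicomm L (P' b).
  by case: b; rewrite ?P't ?P'f//; exact: bicomm_compl.
have Fc i b : pcomm (P' b) (F i) by apply: Lc.
have Fc2 i j : pcomm (F i) (F j) by apply: Lc.
have FE i b x : pmeet (P' b) (F i) x = P' b (F i x) by apply: pmeetE.
exists (I * bool)%type, (fun ib => pmeet (P' ib.2) (F ib.1)); split.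
- by move=> [i b]; apply: bicomm_meet.
- move=> x; rewrite -[RHS]Fs.
  rewrite -(pair_bigA _ (fun i b => pmeet (P' b) (F i) x))/=.
  apply: eq_bigr => i _; rewrite (bigD1 true)//= (bigD1 false)//= big1; last by case.
  by rewrite addr0 !FE P't P'f pcomplE addrC subrK.
- move=> [i b] [j c] x /=; rewrite xpair_eqE negb_and !FE.
  have -> : P' b (F i (P' c (F j x))) = P' b (P' c (F i (F j x))) by rewrite -(Fc i c).
  have [<-/= bc|ij _] := eqVneq i j; last by rewrite Fo// !linear0.
  case: b bc => /=; case: c => //= _; rewrite P't P'f pcomplE.
    by rewrite linearB/= !proj_idem subrr.
  by rewrite !proj_idem subrr.
- move=> Q; rewrite inE => /orP[/eqP->|Qs] [i b] /=.
    case: b; [left|right] => x; first by rewrite FE P't proj_idem.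
    by rewrite FE P'f pcomplE linearB/= proj_idem subrr.
  have QP' : pcomm Q (P' b) by apply: Lc => //; apply: sL; rewrite inE Qs orbT.
  by have [h|h] := sF _ Qs i; [left|right] => x; rewrite FE QP' h ?linear0.
Qed.

Lemma parseval (I : finType) (F : I -> projection H) :
  (forall x, \sum_i F i x = x) ->
  forall x, \sum_i nrm (F i x) ^+ 2 = nrm x ^+ 2.
Proof.
move=> Fs x; rewrite [RHS]nrm_sqrE -[X in '[X, _]](Fs x) inner_suml.
have -> : complex.Re (\sum_i '[F i x, x]) = \sum_i complex.Re '[F i x, x].
  by apply: (big_morph _ _ _) => // a b; rewrite ReD.
by apply: eq_bigr => i _; rewrite nrm_sqrE -[in RHS](proj_idem (F i) x) [in RHS]proj_adj.
Qed.

Lemma nrm_modular P Q x : pcomm P Q ->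
  nrm (pmeet P Q x) ^+ 2 + nrm (pjoin P Q x) ^+ 2 = nrm (P x) ^+ 2 + nrm (Q x) ^+ 2.
Proof.
have sq (T : projection H) : nrm (T x) ^+ 2 = complex.Re '[T x, x].
  by rewrite nrm_sqrE -[in RHS](proj_idem T x) [in RHS]proj_adj.
move=> PQ; rewrite !sq pmeetE// pjoinE// innerBl innerDl !ReD ReN; ring.
Qed.

Lemma compl_nrm P x : nrm (pcompl P x) ^+ 2 = nrm x ^+ 2 - nrm (P x) ^+ 2.
Proof. by rewrite pcomplE (proj_pyth P x) [RHS]addrAC subrr add0r. Qed.

End BooleanAlgebra.

Section Reflexivity.
Context {R : realType} {H K : hilbertType R}.
Implicit Types (P : projection H) (Q : projection K).

(** Strong closedness enters as closure under monotone sequences. In this form the axioms hold both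
    for the given bilattices and for those made from CSL graphs in [graph_bilat]. *)
Definition bilat (S : set (projection H * projection K)) :=
  [/\ forall P P' Q Q', S (P, Q) -> S (P', Q') -> pcomm P P' /\ pcomm Q Q',
      S (proj0 H, proj1 K) /\ S (proj1 H, proj0 K),
      forall P P' Q Q', S (P, Q) -> S (P', Q') ->
        S (pmeet P P', pjoin Q Q') /\ S (pjoin P P', pmeet Q Q'),
      forall p q, (forall n : nat, S (p n, q n)) -> (forall n, p n.+1 <= p n)%O ->
        (forall n, q n <= q n.+1)%O -> S (pinf (range p), psup (range q)) &
      forall p q, (forall n : nat, S (p n, q n)) -> (forall n, p n <= p n.+1)%O ->
        (forall n, q n.+1 <= q n)%O -> S (psup (range p), pinf (range q))].

Context (S : set (projection H * projection K)) (bS : bilat S).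
Context (x : H) (y : K).

Let cost (pq : projection H * projection K) :=
  nrm (pcompl pq.1 x) ^+ 2 + nrm (pcompl pq.2 y) ^+ 2.

Let cost_min : exists2 pq, S pq & forall pq', S pq' -> cost pq <= cost pq'.
Proof.
have [Sc [S01 S10] Sm Sd Si] := bS.
(* With the order reversed on the second entry, [S] is a lattice, and [cost] is modular because both
   of its terms are. *)
apply: (@modular_min _ _ S (fun a b => (a.1 <= b.1)%O /\ (b.2 <= a.2)%O) cost
  (fun a b => (pmeet a.1 b.1, pjoin a.2 b.2)) 0).
- by exists (proj0 H, proj1 K).
- by move=> pq _; rewrite addr_ge0 ?sqr_ge0.
- by move=> a b c [ab1 ab2] [bc1 bc2]; split; apply: le_trans; eassumption.
- move=> [P Q] [P' Q'] SPQ SPQ'; split=> /=.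
  + by have [] := Sm _ _ _ _ SPQ SPQ'.
  + by split; [exact: pmeetl|exact: pjoinl].
  + by split; [exact: pmeetr|exact: pjoinr].
  + by move=> z _ [z1 z2] [z1' z2']; split; [apply: le_pinf|apply: psup_le] => _ [->|->].
- move=> [P Q] [P' Q'] SPQ SPQ'; exists (pjoin P P', pmeet Q Q').
    by have [] := Sm _ _ _ _ SPQ SPQ'.
  have [cP cQ] := Sc _ _ _ _ SPQ SPQ'.
  rewrite /cost/= (compl_nrm (pmeet P P')) (compl_nrm (pjoin P P')).
  rewrite (compl_nrm (pmeet Q Q')) (compl_nrm (pjoin Q Q')).
  rewrite (compl_nrm P) (compl_nrm P') (compl_nrm Q) (compl_nrm Q').
  move: (nrm_modular x cP) (nrm_modular y cQ).
  move: (nrm (pmeet P P' x) ^+ 2) (nrm (pjoin P P' x) ^+ 2) => p1 p2.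
  move: (nrm (P x) ^+ 2) (nrm (P' x) ^+ 2) (nrm (Q y) ^+ 2) (nrm (Q' y) ^+ 2).
  move: (nrm (pmeet Q Q' y) ^+ 2) (nrm (pjoin Q Q' y) ^+ 2) => q1 q2 p3 p4 q3 q4.
  move: (nrm x ^+ 2) (nrm y ^+ 2) => p q; lra.
- move=> u Su ud; exists (pinf (range (fst \o u)), psup (range (snd \o u))); split.
  + apply: Sd => n; last by have [] := ud n.
      by rewrite /= -surjective_pairing.
    by have [] := ud n.
  + by move=> n; split=> /=; [apply: pinf_le|apply: le_psup]; exists n.
  + move=> b _ bu; split=> /=; [apply: le_pinf|apply: psup_le] => _ [n _ <-] /=;
    by have [] := bu n.
  + move=> M uM; have cP : ncvg \oo (fun n => (u n).1 x) (pinf (range (fst \o u)) x).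
      by apply: pinf_cvg => n; have [] := ud n.
    have cQ : ncvg \oo (fun n => (u n).2 y) (psup (range (snd \o u)) y).
      by apply: psup_cvg => n; have [] := ud n.
    rewrite /cost/= (pcomplE (pinf _)) (pcomplE (psup _)).
    have h : nrm (x - (u n).1 x) ^+ 2 + nrm (y - (u n).2 y) ^+ 2 @[n --> \oo] -->
        nrm (x - pinf (range (fst \o u)) x) ^+ 2 + nrm (y - psup (range (snd \o u)) y) ^+ 2.
      by apply: cvgD; apply: ncvg_sqr; apply: ncvgB => //; exact: ncvg_cst.
    apply: (cvgr_to_le h); apply: filterE => n.
    by have := uM n; rewrite /cost !pcomplE.
- move=> u Su ud; exists (psup (range (fst \o u)), pinf (range (snd \o u))).
    apply: Si => n; last by have [] := ud n.
      by rewrite /= -surjective_pairing.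
    by have [] := ud n.
  move=> k M uM; have cP : ncvg \oo (fun n => (u n).1 x) (psup (range (fst \o u)) x).
    by apply: psup_cvg => n; have [] := ud n.
  have cQ : ncvg \oo (fun n => (u n).2 y) (pinf (range (snd \o u)) y).
    by apply: pinf_cvg => n; have [] := ud n.
  rewrite /cost/= (pcomplE (psup _)) (pcomplE (pinf _)).
  have h : nrm (x - (u n).1 x) ^+ 2 + nrm (y - (u n).2 y) ^+ 2 @[n --> \oo] -->
      nrm (x - psup (range (fst \o u)) x) ^+ 2 + nrm (y - pinf (range (snd \o u)) y) ^+ 2.
    by apply: cvgD; apply: ncvg_sqr; apply: ncvgB => //; exact: ncvg_cst.
  apply: (cvgr_to_le h); near=> n.
  have kn : (k <= n)%N by near: n; exact: nbhs_infty_ge.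
  by have := uM _ kn; rewrite /cost !pcomplE.
Unshelve. all: by end_near. Qed.

(** Meets on the left keep [u] fixed while joins on the right collect the vectors [v j]. *)
Let rect_row (J : finType) (u : H) (v : J -> K) (r : seq J) :
  (forall j, j \in r -> exists P Q, [/\ S (P, Q), P u = u & Q (v j) = v j]) ->
  exists P Q, [/\ S (P, Q), P u = u & forall j, j \in r -> Q (v j) = v j].
Proof.
have [_ [_ S10] Sm _ _] := bS.
elim: r => [_|j r IH h]; first by exists (proj1 H), (proj0 K).
have [|P [Q [SPQ Pu Qr]]] := IH.
  by move=> k kr; apply: h; rewrite inE kr orbT.
have [|P' [Q' [SPQ' Pu' Qj]]] := h j; first by rewrite inE eqxx.
exists (pmeet P P'), (pjoin Q Q'); split.
- by have [] := Sm _ _ _ _ SPQ SPQ'.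
- exact/pmeetP.
- move=> k; rewrite inE => /orP[/eqP->|/Qr].
    by move/proj_leP: (pjoinr Q Q'); apply.
  by move/proj_leP: (pjoinl Q Q'); apply.
Qed.

(** Rows are combined the other way round: joins on the left, meets on the right. *)
Let rect (I J : finType) (u : I -> H) (v : J -> K) (r : seq I) (s : seq J) :
  (forall i j, i \in r -> j \in s ->
     exists P Q, [/\ S (P, Q), P (u i) = u i & Q (v j) = v j]) ->
  exists P Q, [/\ S (P, Q), forall i, i \in r -> P (u i) = u i &
    forall j, j \in s -> Q (v j) = v j].
Proof.
have [_ [S01 _] Sm _ _] := bS.
elim: r => [_|i r IH h]; first by exists (proj0 H), (proj1 K).
have [|P [Q [SPQ Pr Qs]]] := IH.
  by move=> k j kr; apply: h; rewrite inE kr orbT.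
have [|P' [Q' [SPQ' Pi Qs']]] := @rect_row J (u i) v s.
  by move=> j js; apply: h; rewrite ?inE ?eqxx.
exists (pjoin P P'), (pmeet Q Q'); split.
- by have [] := Sm _ _ _ _ SPQ SPQ'.
- move=> k; rewrite inE => /orP[/eqP->|/Pr].
    by move/proj_leP: (pjoinr P P'); apply.
  by move/proj_leP: (pjoinl P P'); apply.
- by move=> j js; apply/pmeetP; split; [exact: Qs|exact: Qs'].
Qed.

Let sub_S (s : seq (projection H * projection K)) := forall pq, pq \in s -> S pq.

(* [T] is a transport plan between the atoms of the two finite Boolean algebras
   generated by [s].  The atoms with [rho < 1] and those with [kap <= 1] span a
   rectangle all of whose cells are covered by [S], hence covered by a single pair of
   [S]; the cost of that pair is at most twice the total flow. *)
Let finite_flow s (c : R) : sub_S s -> (forall pq, S pq -> c <= cost pq) ->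
  exists T : bop H K, [/\ forall u v, nrm '[T u, v] <= 2 * nrm u * nrm v,
    forall P Q, (P, Q) \in s -> forall u v, '[T (P u), Q v] = 0 &
    c / 2 <= complex.Re '[T x, y]].
Proof.
move=> sS cS; have [Sc _ _ _ _] := bS.
pose L1 := [set pq.1 | pq in S]; pose L2 := [set pq.2 | pq in S].
have L1c : pairwise_comm L1.
  by move=> _ _ [[P Q] SP <-] [[P' Q'] SP' <-]; have [] := Sc _ _ _ _ SP SP'.
have L2c : pairwise_comm L2.
  by move=> _ _ [[P Q] SP <-] [[P' Q'] SP' <-]; have [] := Sc _ _ _ _ SP SP'.
have [|I [F [FL Fs Fo sF]]] := @atoms _ _ L1 [seq pq.1 | pq <- s] L1c.
  by move=> _ /mapP[pq pqs ->]; apply: sub_bicomm; exists pq => //; exact: sS.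
have [|J [G [GL Gs Go sG]]] := @atoms _ _ L2 [seq pq.2 | pq <- s] L2c.
  by move=> _ /mapP[pq pqs ->]; apply: sub_bicomm; exists pq => //; exact: sS.
pose a i := nrm (F i x) ^+ 2; pose b j := nrm (G j y) ^+ 2.
have a0 i : 0 <= a i by exact: sqr_ge0.
have b0 j : 0 <= b j by exact: sqr_ge0.
pose bad i j := has (fun pq : projection H * projection K => `[< forall u, pq.1 (F i u) = F i u >] &&
  `[< forall v, pq.2 (G j v) = G j v >]) s.
have [t [t0 tbad rho2 kap2 low]] := @transport R I J a b bad a0 b0.
set rho := fun i => \sum_j t i j * b j in rho2 low.
set kap := fun j => \sum_i t i j * a i in kap2 low.
(* The block from atom [i] to atom [j] is [t i j] times the rank one operator sending [u] to
   ['[u, F i x] *: G j y]. *)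
pose B (u : H) (v : K) := \sum_i \sum_j (t i j)%:C * '[u, F i x] * '[G j y, v].
have Bbound u v : nrm (B u v) <= 2 * nrm u * nrm v.
  have h : nrm (B u v) <= \sum_i \sum_j t i j * (nrm (F i u) * nrm (F i x)) *
      (nrm (G j y) * nrm (G j v)).
    apply: le_trans (nrm_sum _ _ _) _; apply: ler_sum => i _.
    apply: le_trans (nrm_sum _ _ _) _; apply: ler_sum => j _.
    rewrite !nrmM nrmC ger0_norm//.
    have -> : '[u, F i x] = '[F i u, F i x] by rewrite [RHS]proj_adj proj_idem.
    have -> : '[G j y, v] = '[G j y, G j v] by rewrite -[RHS]proj_adj proj_idem.
    apply: ler_pM; [by rewrite mulr_ge0 ?nrm_ge0|exact: nrm_ge0| |exact: inner_le].
    by rewrite ler_wpM2l ?inner_le.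
  apply: le_trans h _; set X := \sum_i _.
  (* A Schur test: AM-GM splits each product into two squares, and the marginal bounds [rho2] and
     [kap2] control the two sums. *)
  have h2 : 2 * (nrm u * nrm v) * X <= (2 * (nrm u * nrm v)) * (2 * (nrm u * nrm v)).
    have E1 : \sum_i \sum_j t i j * (nrm (F i u) * nrm (G j y)) ^+ 2 <= 2 * nrm u ^+ 2.
      rewrite -(parseval Fs u) mulr_sumr; apply: ler_sum => i _.
      rewrite (eq_bigr (fun j => nrm (F i u) ^+ 2 * (t i j * b j))); last first.
        by move=> j _; rewrite /b; ring.
      by rewrite -mulr_sumr mulrC ler_wpM2r ?sqr_ge0// rho2.
    have E2 : \sum_i \sum_j t i j * (nrm (F i x) * nrm (G j v)) ^+ 2 <= 2 * nrm v ^+ 2.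
      rewrite exchange_big -(parseval Gs v) mulr_sumr; apply: ler_sum => j _.
      rewrite (eq_bigr (fun i => nrm (G j v) ^+ 2 * (t i j * a i))); last first.
        by move=> i _; rewrite /a; ring.
      by rewrite -mulr_sumr mulrC ler_wpM2r ?sqr_ge0// kap2.
    have h3 : 2 * (nrm u * nrm v) * X <=
      nrm v ^+ 2 * (\sum_i \sum_j t i j * (nrm (F i u) * nrm (G j y)) ^+ 2) +
      nrm u ^+ 2 * (\sum_i \sum_j t i j * (nrm (F i x) * nrm (G j v)) ^+ 2).
      rewrite /X !mulr_sumr -big_split/=; apply: ler_sum => i _.
      rewrite !mulr_sumr -big_split/=; apply: ler_sum => j _.
      rewrite -subr_ge0.
      have := mulr_ge0 (t0 i j) (sqr_ge0 (nrm v * (nrm (F i u) * nrm (G j y)) -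
        nrm u * (nrm (F i x) * nrm (G j v)))).
      by congr (_ <= _); ring.
    apply: le_trans h3 _.
    have -> : 2 * (nrm u * nrm v) * (2 * (nrm u * nrm v)) =
        nrm v ^+ 2 * (2 * nrm u ^+ 2) + nrm u ^+ 2 * (2 * nrm v ^+ 2) by ring.
    by rewrite lerD// ler_wpM2l ?sqr_ge0.
  have [uv0|uv0] := eqVneq (nrm u * nrm v) 0; last first.
    rewrite -[leRHS]mulrA -(ler_pM2l (_ : 0 < 2 * (nrm u * nrm v)))//.
    by rewrite mulr_gt0// lt_def uv0 mulr_ge0 ?nrm_ge0.
  rewrite -mulrA uv0 mulr0 /X big1// => i _; rewrite big1// => j _.
  move/eqP: uv0; rewrite mulf_eq0 => /orP[] /eqP /nrm0_eq0 ->.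
    by rewrite linear0 nrm0 mul0r mulr0 mul0r.
  by rewrite linear0 nrm0 !mulr0.
have [||//|T TE] := @sesq_bop _ H K B 2.
- move=> z u u' v; rewrite /B mulr_sumr -big_split/=; apply: eq_bigr => i _.
  rewrite mulr_sumr -big_split/=; apply: eq_bigr => j _.
  rewrite innerDl innerZl; ring.
- move=> z u v v'; rewrite /B mulr_sumr -big_split/=; apply: eq_bigr => i _.
  rewrite mulr_sumr -big_split/=; apply: eq_bigr => j _.
  rewrite innerDr innerZr; ring.
exists T; split.
- by move=> u v; rewrite TE Bbound.
- move=> P Q PQs u v; rewrite TE /B big1// => i _; rewrite big1// => j _.
  rewrite proj_adj -(proj_adj Q).
  have [Pi|Pi] := sF P (map_f fst PQs) i; last by rewrite Pi inner0r mulr0 mul0r.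
  have [Qj|Qj] := sG Q (map_f snd PQs) j; last by rewrite Qj inner0l mulr0.
  rewrite tbad ?mul0r//; apply/hasP; exists (P, Q) => //=.
  by apply/andP; split; apply/asboolP.
have flow1 : complex.Re '[T x, y] = \sum_i a i * rho i.
  rewrite TE /B (_ : \sum_i _ = (\sum_i a i * rho i)%:C)// rmorph_sum/=.
  apply: eq_bigr => i _; rewrite /rho mulr_sumr rmorph_sum/=; apply: eq_bigr => j _.
  have -> : '[x, F i x] = (a i)%:C by rewrite -inner_nrm [RHS]proj_adj proj_idem.
  have -> : '[G j y, y] = (b j)%:C by rewrite -inner_nrm -[RHS]proj_adj proj_idem.
  rewrite -!rmorphM/=.
  by rewrite /a /b; congr (_%:C); ring.
have flow2 : \sum_i a i * rho i = \sum_j b j * kap j.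
  rewrite /rho /kap; under eq_bigr do rewrite mulr_sumr.
  rewrite exchange_big/=; apply: eq_bigr => j _; rewrite mulr_sumr.
  by apply: eq_bigr => i _; ring.
(* One inequality is strict, so a cell of the rectangle has [rho i + kap j < 2] and must be bad by
   [low]. Outside, [rho i >= 1] or [kap j > 1], so the mass of an atom is at most its flow. *)
pose rA := [seq i <- enum I | (0 < a i) && (rho i < 1)].
pose rB := [seq j <- enum J | (0 < b j) && (kap j <= 1)].
have [|P [Q [SPQ PA QB]]] := @rect I J (fun i => F i x) (fun j => G j y) rA rB.
  move=> i j; rewrite !mem_filter => /andP[/andP[ai ri] _] /andP[/andP[bj kj] _].
  have : bad i j by apply: contraT => /(low _ _ ai bj); rewrite -/(rho i) -/(kap j); lra.
  move=> /hasP[[P Q] /sS SPQ /andP[/asboolP PF /asboolP QG]].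
  by exists P, Q; split.
have rho0 i : 0 <= rho i by rewrite sumr_ge0// => j _; rewrite mulr_ge0.
have kap0 j : 0 <= kap j by rewrite sumr_ge0// => i _; rewrite mulr_ge0.
have := cS _ SPQ; rewrite /cost/=.
have PcF i : pcomm P (F i).
  apply: (FL i) => _ [[P' Q'] SP' <-]; exact: (Sc _ _ _ _ SPQ SP').1.
have QcG j : pcomm Q (G j).
  apply: (GL j) => _ [[P' Q'] SP' <-]; exact: (Sc _ _ _ _ SPQ SP').2.
have c1 : nrm (pcompl P x) ^+ 2 <= \sum_i a i * rho i.
  rewrite -(parseval Fs); apply: ler_sum => i _.
  rewrite pcomplE linearB/= -PcF -pcomplE.
  have [ai|ai] := ltP 0 (a i); last first.
    have : a i = 0 by apply/eqP; rewrite eq_le ai a0.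
    move=> /eqP; rewrite /a sqrf_eq0 => /eqP/nrm0_eq0 ->.
    by rewrite linear0 nrm0 expr0n mul0r.
  have [ri|ri] := ltP (rho i) 1.
    have PAi : P (F i x) = F i x by apply: PA; rewrite mem_filter ai ri mem_enum.
    by rewrite pcomplE PAi subrr nrm0 expr0n mulr_ge0.
  by apply: le_trans (proj_nrm_sqr _ _) _; rewrite -/(a i) ler_peMr.
have c2 : nrm (pcompl Q y) ^+ 2 <= \sum_j b j * kap j.
  rewrite -(parseval Gs); apply: ler_sum => j _.
  rewrite pcomplE linearB/= -QcG -pcomplE.
  have [bj|bj] := ltP 0 (b j); last first.
    have : b j = 0 by apply/eqP; rewrite eq_le bj b0.
    move=> /eqP; rewrite /b sqrf_eq0 => /eqP/nrm0_eq0 ->.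
    by rewrite linear0 nrm0 expr0n mul0r.
  have [kj|/ltW kj] := leP (kap j) 1.
    have QBj : Q (G j y) = G j y by apply: QB; rewrite mem_filter bj kj mem_enum.
    by rewrite pcomplE QBj subrr nrm0 expr0n mulr_ge0.
  by apply: le_trans (proj_nrm_sqr _ _) _; rewrite -/(b j) ler_peMr.
rewrite flow1; rewrite -flow2 in c2; lra.
Qed.

(* If the minimal cost were positive, a weak operator limit of the plans of
   [finite_flow] along the finite subsets of [S] would lie in [bl_space S] without
   annihilating [(x, y)]. *)
Lemma bl_space_reflexive :
  (forall T, bl_space S T -> '[T x, y] = 0) ->
  exists P Q, [/\ S (P, Q), P x = x & Q y = y].
Proof.
move=> Txy; have [[P Q] SPQ cmin] := cost_min.
have [c0|c0] := eqVneq (cost (P, Q)) 0.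
  move/eqP: c0; rewrite /cost/= paddr_eq0 ?sqr_ge0// !sqrf_eq0.
  move=> /andP[/eqP/nrm0_eq0/pcompl_eq0 Px /eqP/nrm0_eq0/pcompl_eq0 Qy].
  by exists P, Q.
have cp : 0 < cost (P, Q) by rewrite lt_def c0 addr_ge0 ?sqr_ge0.
set c := cost (P, Q) in c0 cp cmin.
have /choice[T TP] : forall s, exists T : bop H K, sub_S s ->
    [/\ forall u v, nrm '[T u, v] <= 2 * nrm u * nrm v,
    forall P Q, (P, Q) \in s -> forall u v, '[T (P u), Q v] = 0 &
    c / 2 <= complex.Re '[T x, y]].
  move=> s; have [sS|nS] := pselect (sub_S s); last by exists 0.
  by have [T TP] := finite_flow sS cmin; exists T.
pose Fil : set_system (seq (projection H * projection K)) :=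
  [set A | exists2 s0, sub_S s0 & forall s, sub_S s -> {subset s0 <= s} -> A s].
have FF : ProperFilter Fil.
  split; first by move=> [s0 s0S /(_ s0 s0S)]; apply.
  split.
  - by exists [::].
  - move=> A A' [s0 s0S h0] [s1 s1S h1]; exists (s0 ++ s1).
      by move=> pq; rewrite mem_cat => /orP[/s0S|/s1S].
    by move=> s sS s01; split; [apply: h0|apply: h1] => // pq pqs; apply: s01;
      rewrite mem_cat pqs ?orbT.
  - by move=> A A' AA' [s0 s0S h0]; exists s0 => // s sS ss; apply/AA'/h0.
have [U [UU FU]] := ultraFilterLemma FF.
have nS : \forall s \near U, sub_S s by apply: FU; exists [::].
(* The default 0 makes the norm bound hold at every index, as [ultra_ncvg] requires. *)
pose T' s := if pselect (sub_S s) then T s else 0.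
have T'b s u v : nrm '[T' s u, v] <= 2 * nrm u * nrm v.
  rewrite /T'; case: (pselect (sub_S s)) => [sS|nsS]; first by have [h _ _] := TP s sS; exact: h.
  by rewrite bop0E inner0l nrm0 !mulr_ge0 ?nrm_ge0.
have /choice[B BP] : forall uv : H * K, exists l, ncvg U (fun s => '[T' s uv.1, uv.2]) l.
  move=> [u v]; apply: (@ultra_ncvg _ _ _ _ _ (2 * nrm u * nrm v)) => s; exact: T'b.
have BE u v : ncvg U (fun s => '[T' s u, v]) (B (u, v)) by exact: (BP (u, v)).
have [|||T0 T0E] := @sesq_bop _ H K (fun u v => B (u, v)) 2.
- move=> a u u' v; apply: (ncvg_unique (BE _ _)).
  apply: ncvg_ext (ncvgD (ncvgM a (BE u v)) (BE u' v)) => s.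
  by rewrite linearP innerDl innerZl.
- move=> a u v v'; apply: (ncvg_unique (BE _ _)).
  apply: ncvg_ext (ncvgD (ncvgM (a^*)%C (BE u v)) (BE u v')) => s.
  by rewrite innerDr innerZr.
- by move=> u v; apply: ncvg_le_nrm (BE u v) _; apply: filterE => s; exact: T'b.
have T0S : bl_space S T0.
  move=> P1 Q1 S1; apply: eq_bop => u; rewrite !compopE bop0E; apply: inner_eq0P => v.
  rewrite proj_adj T0E; apply: ncvg_near0 (BE _ _).
  have h : \forall s \near U, sub_S s /\ (P1, Q1) \in s.
    apply: FU; exists [:: (P1, Q1)].
      by move=> pq; rewrite inE => /eqP->.
    by move=> s sS ss; split=> //; apply: ss; rewrite inE.
  apply: filterS h => s [sS PQs]; rewrite /T'; case: pselect => // sS'.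
  by have [_ h _] := TP s sS; exact: h.
have := Txy _ T0S; rewrite T0E => B0.
have h : complex.Re '[T' s x, y] @[s --> U] --> complex.Re (B (x, y)).
  by apply: ncvg_Re; exact: BE.
rewrite B0/= in h.
have : c / 2 <= 0.
  apply: (cvgr_to_ge h); apply: filterS nS => s sS; rewrite /T'.
  by case: pselect => // sS'; have [] := TP s sS.
lra.
Qed.

End Reflexivity.

(** * Pairings and weak* closed spans *)

Section SquareSummable.
Context {R : realType}.

Definition l2bounded (H : hilbertType R) (x : nat -> H) :=
  exists c : R, forall N : nat, \sum_(0 <= k < N) nrm (x k) ^+ 2 <= c.

Lemma psum_le (f : nat -> R) (N M : nat) : (forall k, 0 <= f k) -> (N <= M)%N ->
  \sum_(0 <= k < N) f k <= \sum_(0 <= k < M) f k.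
Proof.
move=> f0 NM; rewrite (@big_cat_nat _ _ _ N 0 M)//= lerDl sumr_ge0//.
Qed.

Lemma real_sum_complex (f : nat -> R) N :
  \sum_(0 <= k < N) (f k)%:C = (\sum_(0 <= k < N) f k)%:C :> R[i].
Proof. by rewrite rmorph_sum. Qed.

Lemma square_summableP (H : hilbertType R) (x : nat -> H) :
  square_summable x <-> l2bounded x.
Proof.
have E : series (fun n => `|x n| ^+ 2 : R[i]^o) =
    fun N => (\sum_(0 <= k < N) nrm (x k) ^+ 2)%:C.
  by apply/funext => N; rewrite /series/= -real_sum_complex; apply: eq_bigr => k _;
    rewrite nrmE -rmorphXn.
have f0 k : 0 <= nrm (x k) ^+ 2 by rewrite sqr_ge0.
split.
  rewrite /square_summable E => /cvg_ex[/= l /cvg_ncvg h].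
  exists (nrm l + 1) => N.
  have [M _ hM] := (ncvgP _ _).1 h 1 ltr01.
  apply: le_trans (psum_le f0 (leq_maxl N M)) _.
  have := hM _ (leq_maxr N M) => /= h1.
  set s := \sum_(_ <= _ < _) _ in h1 *.
  have := nrmD (s%:C - l : R[i]) l; rewrite subrK nrmC => h2.
  by have := ler_norm s; move: h1 h2; rewrite [nrm (_ - _)]/nrm; lra.
move=> [c xc]; rewrite /square_summable E.
pose s N := \sum_(0 <= k < N) nrm (x k) ^+ 2.
have snd : {homo s : n m / (n <= m)%N >-> n <= m} by move=> N M NM; exact: psum_le.
have ub : has_ubound (range s) by exists c => _ [N _ <-]; exact: xc.
have /cvgrPdist_le h := nondecreasing_cvgn snd ub.
apply/cvg_ex; exists (sup (range s))%:C; apply/cvg_ncvg/ncvgP => e /h.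
by apply: filterS => N; rewrite distrC -rmorphB -nrmC.
Qed.

Lemma l2bounded_tail (f : nat -> R) (c e : R) : (forall k, 0 <= f k) ->
  (forall N : nat, \sum_(0 <= k < N) f k <= c) -> 0 < e ->
  exists N : nat, forall M, (N <= M)%N -> \sum_(N <= k < M) f k <= e.
Proof.
move=> f0 fc e0; pose s N := \sum_(0 <= k < N) f k.
have E0 : range s !=set0 by exists (s 0%N), 0%N.
have uE : has_ubound (range s) by exists c => _ [N _ <-]; exact: fc.
have [_ [N _ <-] hN] := sup_adherent e0 (conj E0 uE).
exists N => M NM; have : s M <= sup (range s) by apply: ub_le_sup => //; exists M.
by rewrite /s (@big_cat_nat _ _ _ N 0 M)//= -/(s N); lra.
Qed.

Lemma ncauchyC (u : nat -> R[i]) :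
  (forall e : R, 0 < e -> exists N : nat, forall n, (N <= n)%N -> nrm (u n - u N) <= e) ->
  exists l, ncvg \oo u l.
Proof.
move=> uc.
have [U [UU oU]] := @ultraFilterLemma nat \oo _.
have [N0 hN0] := uc 1 ltr01.
(* Freezing the first terms makes the sequence bounded at every index; an ultrafilter limit of a
   Cauchy sequence is its limit. *)
pose v n := if (N0 <= n)%N then u n else u N0.
have vb n : nrm (v n) <= nrm (u N0) + 1.
  rewrite /v; case: leqP => h; last by rewrite lerDl.
  rewrite -[u n](subrK (u N0)) addrC (le_trans (nrmD _ _))// lerD2l; exact: hN0.
have [l vl] := ultra_ncvg vb; exists l; apply/ncvgP => e e0.
have e2 : 0 < e / 2 by rewrite divr_gt0.
have [N hN] := uc _ e2; exists (maxn N N0) => // n /=.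
rewrite geq_max => /andP[Nn N0n].
have lN : nrm (l - u N) <= e / 2.
  apply: ncvg_le_nrm (ncvgB vl (ncvg_cst (u N))) _.
  apply: oU; exists (maxn N N0) => // m /=; rewrite geq_max => /andP[Nm N0m].
  by rewrite /v N0m; exact: hN.
rewrite -[u n](subrK (u N)) -addrA (le_trans (nrmD _ _))// [leRHS](splitr e).
by rewrite lerD ?hN// nrm_sub.
Qed.

Lemma l2bounded_bop (H K : hilbertType R) (T : bop H K) (x : nat -> H) :
  l2bounded x -> l2bounded (fun n => T (x n)).
Proof.
move=> [c xc]; have [M M0 TM] := bop_bounded T; exists (M ^+ 2 * c) => N.
apply: le_trans (_ : \sum_(0 <= k < N) M ^+ 2 * nrm (x k) ^+ 2 <= _).
  apply: ler_sum => k _; rewrite -exprMn ler_pXn2r ?nnegrE ?mulr_ge0 ?nrm_ge0//.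
by rewrite -mulr_sumr ler_wpM2l ?sqr_ge0.
Qed.

End SquareSummable.

Section Pairing.
Context {R : realType}.
Implicit Types H K L : hilbertType R.

Definition lvec H K (w : l2_pair H K) : nat -> H := (sval w).1.
Definition rvec H K (w : l2_pair H K) : nat -> K := (sval w).2.

Lemma lvec_l2 H K (w : l2_pair H K) : l2bounded (lvec w).
Proof. exact: (square_summableP _).1 (svalP w).1. Qed.

Lemma rvec_l2 H K (w : l2_pair H K) : l2bounded (rvec w).
Proof. exact: (square_summableP _).1 (svalP w).2. Qed.

Lemma l2_pair_mk H K (x : nat -> H) (y : nat -> K) :
  l2bounded x -> l2bounded y -> exists w : l2_pair H K, lvec w = x /\ rvec w = y.
Proof.
move=> /square_summableP x2 /square_summableP y2.
by exists (exist _ (x, y) (conj x2 y2)).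
Qed.

Definition pairing_sum H K (T : bop H K) (w : l2_pair H K) N :=
  \sum_(0 <= k < N) '[T (lvec w k), rvec w k].

Lemma pairing_cvg H K (T : bop H K) (w : l2_pair H K) :
  ncvg \oo (pairing_sum T w) (trace_pairing T w).
Proof.
suff [l hl] : exists l, ncvg \oo (pairing_sum T w) l.
  suff <- : l = trace_pairing T w by [].
  rewrite /trace_pairing; apply: esym; apply: (@cvg_lim R[i]^o (@norm_hausdorff _ R[i]^o)).
  exact/cvg_ncvg.
have [c1 h1] := l2bounded_bop T (lvec_l2 w); have [c2 h2] := rvec_l2 w.
pose f k := nrm (T (lvec w k)) ^+ 2 + nrm (rvec w k) ^+ 2.
have f0 k : 0 <= f k by rewrite addr_ge0 ?sqr_ge0.
apply: ncauchyC => e e0.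
have [|N hN] := @l2bounded_tail R f (c1 + c2) e f0 _ e0.
  by move=> N; rewrite /f big_split/= lerD.
exists N => n Nn; rewrite /pairing_sum (@big_cat_nat _ _ _ N 0 n)//=.
rewrite addrAC subrr add0r; apply: le_trans (hN _ Nn).
apply: le_trans (nrm_sum _ _ _) _; apply: ler_sum => k _.
apply: le_trans (inner_le _ _) _; rewrite /f.
have := sqr_ge0 (nrm (T (lvec w k)) - nrm (rvec w k)).
have := sqr_ge0 (nrm (T (lvec w k)) + nrm (rvec w k)).
by move: (nrm _) (nrm _) => p q; rewrite !expr2; lra.
Qed.

Lemma pairing_eq H K (T : bop H K) (w : l2_pair H K) l :
  ncvg \oo (pairing_sum T w) l -> trace_pairing T w = l.
Proof. exact: ncvg_unique (pairing_cvg T w). Qed.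

Lemma pairingP H K (a : R[i]) (S T : bop H K) (w : l2_pair H K) :
  trace_pairing (a *: S + T) w = a * trace_pairing S w + trace_pairing T w.
Proof.
apply: pairing_eq.
apply: ncvg_ext (ncvgD (ncvgM a (pairing_cvg S w)) (pairing_cvg T w)) => N.
rewrite /pairing_sum mulr_sumr -big_split/=; apply: eq_bigr => k _.
by rewrite -innerZl -innerDl.
Qed.

Lemma pairing0 H K (w : l2_pair H K) : trace_pairing (0 : bop H K) w = 0.
Proof.
have := pairingP 1 (0 : bop H K) 0 w; rewrite scale1r addr0 mul1r => h.
by apply/eqP; rewrite -[X in X == _](addrK (trace_pairing (0 : bop H K) w)) -h subrr.
Qed.

Lemma pairing_eq_ext H K H' K' (S : bop H K) (T : bop H' K') w w' :
  (forall n, '[S (lvec w n), rvec w n] = '[T (lvec w' n), rvec w' n]) ->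
  trace_pairing S w = trace_pairing T w'.
Proof.
move=> h; apply: pairing_eq; apply: ncvg_ext (pairing_cvg T w') => N.
by apply: eq_bigr.
Qed.

(** The predual is stable under two-sided multiplication, so multiplication by fixed operators is
    weak* continuous. *)
Lemma pairing_compop H K H' K' (A : bop K K') (B : bop H' H) (w : l2_pair H' K') :
  exists w' : l2_pair H K, forall T,
    trace_pairing (compop (compop A T) B) w = trace_pairing T w'.
Proof.
have [A' AA'] := adjoint_exists A.
have [w' [w'l w'r]] := l2_pair_mk (l2bounded_bop B (lvec_l2 w))
  (l2bounded_bop A' (rvec_l2 w)).
exists w' => T; apply: pairing_eq_ext => n.
by rewrite w'l w'r !compopE AA'.
Qed.

Lemma pairing_rank1 H K (x : H) (y : K) :
  exists w : l2_pair H K, forall T, trace_pairing T w = '[T x, y].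
Proof.
have l2 (V : hilbertType R) (z : V) : l2bounded (fun n => if n is 0%N then z else 0).
  exists (nrm z ^+ 2) => -[|N]; first by rewrite big_geq ?sqr_ge0.
  by rewrite big_nat_recl// big1 ?addr0// => k _; rewrite nrm0 expr0n.
have [w [wl wr]] := l2_pair_mk (l2 _ x) (l2 _ y).
exists w => T; apply: pairing_eq; apply/ncvgP => e e0; exists 1%N => // -[//|N] _ /=.
rewrite /pairing_sum big_nat_recl// big1 ?addr0 => [|k _]; first by rewrite wl wr subrr nrm0 ltW.
by rewrite wl linear0 inner0l.
Qed.

Definition interleave (V : Type) (x y : nat -> V) n :=
  if odd n then y n./2 else x n./2.

Lemma interleave_sum (W : nmodType) (f : nat -> W) N :
  \sum_(0 <= k < N.*2) f k = \sum_(0 <= k < N) (f k.*2 + f k.*2.+1).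
Proof.
elim: N => [|N IH]; first by rewrite !big_geq.
by rewrite doubleS !big_nat_recr//= IH addrA.
Qed.

Lemma interleave_l2 H (x y : nat -> H) :
  l2bounded x -> l2bounded y -> l2bounded (interleave x y).
Proof.
move=> [c xc] [d yd]; exists (c + d) => N.
apply: le_trans (_ : \sum_(0 <= k < N.*2) nrm (interleave x y k) ^+ 2 <= _).
  by apply: psum_le; [move=> k; exact: sqr_ge0|rewrite -addnn leq_addr].
rewrite interleave_sum big_split/= lerD//.
  rewrite (eq_bigr (fun k => nrm (x k) ^+ 2))// => k _.
  by rewrite /interleave odd_double doubleK.
rewrite (eq_bigr (fun k => nrm (y k) ^+ 2))// => k _.
by rewrite /interleave /= odd_double /= uphalf_double.
Qed.

(** Interleaving the sequences represents a sum of functionals; the partial sums of even length then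
    split in two. *)
Lemma pairing_comb H K a (w1 w2 : l2_pair H K) : exists w : l2_pair H K,
  forall T, trace_pairing T w = a * trace_pairing T w1 + trace_pairing T w2.
Proof.
have l2a : l2bounded (fun n => a *: lvec w1 n).
  have [c h] := lvec_l2 w1; exists (nrm a ^+ 2 * c) => N.
  rewrite (eq_bigr (fun k => nrm a ^+ 2 * nrm (lvec w1 k) ^+ 2)).
    by rewrite -mulr_sumr ler_wpM2l ?sqr_ge0.
  by move=> k _; rewrite nrmZ exprMn.
have [w [wl wr]] := l2_pair_mk (interleave_l2 l2a (lvec_l2 w2))
  (interleave_l2 (rvec_l2 w1) (rvec_l2 w2)).
exists w => T.
have h1 : ncvg \oo (fun N => pairing_sum T w N.*2) (trace_pairing T w).
  apply/ncvgP => e /((ncvgP _ _).1 (pairing_cvg T w))[N _ hN].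
  by exists N => // n /= Nn; apply: hN => /=; rewrite (leq_trans Nn)// -addnn leq_addr.
apply: ncvg_unique h1 _.
apply: ncvg_ext (ncvgD (ncvgM a (pairing_cvg T w1)) (pairing_cvg T w2)) => N.
rewrite /pairing_sum interleave_sum wl wr mulr_sumr -big_split/=.
apply: eq_bigr => k _; rewrite /interleave /= odd_double /= uphalf_double doubleK.
by rewrite linearZ/= innerZl.
Qed.

End Pairing.

Lemma initial_ptws_cvg {X : choiceType} {J : Type} {V : topologicalType}
    (f : X -> {ptws J -> V}) {I : Type} (F : set_system I) {FF : ProperFilter F}
    (m : I -> initial_topology f) (x : initial_topology f) :
  (forall j, f (m i) j @[i --> F] --> f x j) -> m @ F --> x.
Proof.
move=> h A; rewrite nbhsE => -[B [[C oC <-] Cx] BA].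
have fcvg : (fun i => f (m i)) @ F --> f x.
  apply/cvg_sup => j D; rewrite nbhsE => -[E [[G oG <-] Gx] ED].
  have hG : F (fun i => G (f (m i) j)) := h j _ (open_nbhs_nbhs (conj oG Gx)).
  have : F ((fun i => f (m i)) @^-1` D) by apply: filterS hG => i Gi; exact: ED.
  by [].
have CF := fcvg _ (open_nbhs_nbhs (conj oC Cx)).
have : F (m @^-1` (f @^-1` C)) by exact: CF.
by apply: filterS => i Ci; exact: BA.
Qed.

(** * The weak* closed span as a double annihilator *)

Section WeakStar.
Context {R : realType} {H K : hilbertType R}.
Implicit Types (X M : set (bop H K)) (T : bop H K) (w : l2_pair H K).

Definition annihilates w X := forall S, X S -> trace_pairing S w = 0.

Lemma smallest_subspace X : op_subspace (smallest (@op_subspace R H K) X).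
Proof.
split=> [M [[M0 _] _]|a S T hS hT M MP]; first exact: M0.
by have [[_ MD] _] := MP; apply: MD; [exact: hS|exact: hT].
Qed.

Lemma annihilates_smallest w X :
  annihilates w X -> annihilates w (smallest (@op_subspace R H K) X).
Proof.
move=> wX S /(_ [set T | trace_pairing T w = 0]); apply; split=> //.
by split=> [|a S1 S2 /= h1 h2]; rewrite /= ?pairing0// pairingP h1 h2 mulr0 addr0.
Qed.

Lemma op_subspaceB M S T : op_subspace M -> M S -> M T -> M (S - T).
Proof. by move=> [_ MD] MS MT; rewrite addrC -scaleN1r; apply: MD. Qed.

Lemma op_subspaceZ M a S : op_subspace M -> M S -> M (a *: S).
Proof. by move=> [M0 MD] MS; rewrite -[_ *: _]addr0; apply: MD. Qed.

Lemma pairingB S T w :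
  trace_pairing (S - T) w = trace_pairing S w - trace_pairing T w.
Proof. by rewrite addrC -scaleN1r pairingP mulN1r addrC. Qed.

Lemma pairingZ a T w : trace_pairing (a *: T) w = a * trace_pairing T w.
Proof. by rewrite -[_ *: _]addr0 pairingP pairing0 addr0. Qed.

(* A weak* neighbourhood involves finitely many pairings, and these are closed under
   linear combinations, so Hahn-Banach separation reduces to this algebraic statement. *)
Lemma finite_agree (ws : seq (l2_pair H K)) : forall M T, op_subspace M ->
  (forall w, annihilates w M -> trace_pairing T w = 0) ->
  exists2 m, M m & forall w, List.In w ws -> trace_pairing m w = trace_pairing T w.
Proof.
elim: ws => [|w ws IH] M T sM MT; first by exists 0 => //; have [] := sM.
have [wM|/existsNP[m /not_implyP[Mm wm]]] := pselect (annihilates w M).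
  have [m Mm mP] := IH M T sM MT; exists m => // w' [<-|/mP//].
  by rewrite (wM _ Mm) (MT _ wM).
pose m0 := (trace_pairing m w)^-1 *: m.
have Mm0 : M m0 by exact: op_subspaceZ.
have wm0 : trace_pairing m0 w = 1.
  by rewrite /m0 pairingZ mulVf//; exact/eqP.
clearbody m0.
pose M' := [set S | M S /\ trace_pairing S w = 0].
have sM' : op_subspace M'.
  split=> [|a S1 S2 [M1 w1] [M2 w2]]; first by split; [have [] := sM|exact: pairing0].
  by split; [apply: sM.2|rewrite pairingP w1 w2 mulr0 addr0].
pose T' := T - trace_pairing T w *: m0.
have [w' w'M'|m' [Mm' wm'] m'P] := IH M' T' sM'.
  (* [w''] is [w'] corrected along [w] to vanish at [m0]; it annihilates [M], since removing the
     [m0] component of an element of [M] lands in [M']. *)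
  have [w'' w''E] := pairing_comb (- trace_pairing m0 w') w w'.
  have := MT w''; rewrite w''E => h.
  rewrite /T' pairingB pairingZ; rewrite -[RHS]h; first by ring.
  move=> S MS; rewrite w''E.
  have : trace_pairing (S - trace_pairing S w *: m0) w' = 0.
    apply: w'M'; split; first by apply: op_subspaceB => //; exact: op_subspaceZ.
    by rewrite pairingB pairingZ wm0 mulr1 subrr.
  by rewrite pairingB pairingZ => <-; ring.
exists (trace_pairing T w *: m0 + m'); first by apply: sM.2.
move=> w1 [<-|ww]; rewrite pairingP; first by rewrite wm0 wm' mulr1 addr0.
rewrite (m'P _ ww) /T' pairingB pairingZ.
by rewrite addrCA subrr addr0.
Qed.

Lemma pairing_continuous w : continuous (fun T : weak_star H K => trace_pairing T w).
Proof.
move=> T A hA.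
have h1 : (@trace_pairing R H K : weak_star H K -> {ptws _ -> R[i]^o}) @ T -->
    (@trace_pairing R H K T : {ptws _ -> R[i]^o}) by exact: initial_continuous.
have /cvg_sup/(_ w) h2 := h1.
pose pw : (forall _ : l2_pair H K, R[i]^o) -> R[i]^o := @proj _ (fun=> R[i]^o) w.
have h3 : nbhs ((@trace_pairing R H K T) : initial_topology pw) (pw @^-1` A).
  exact: (@initial_continuous _ _ pw).
have {}h2 := h2 (fmap_filter _ (nbhs_filter T)).
exact: h2 h3.
Qed.

(** The bipolar theorem. Later arguments about [wspan] test against functionals and no longer meet
    the topology. *)
Lemma wspanP X T :
  wspan X T <-> forall w, annihilates w X -> trace_pairing T w = 0.
Proof.
split=> [XT w wX|h].
  have cl : closed [set S : weak_star H K | trace_pairing S w = 0].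
    apply: (@preimage_closed _ _ (fun S : weak_star H K => trace_pairing S w)
      [set (0 : R[i]^o)]).
      by move=> S _; exact: pairing_continuous.
    apply: accessible_closed_set1; apply: hausdorff_accessible.
    exact: (@norm_hausdorff _ R[i]^o).
  apply: cl; apply: closure_subset XT => S; exact: annihilates_smallest.
pose M := smallest (@op_subspace R H K) X.
have MT w : annihilates w M -> trace_pairing T w = 0.
  move=> wM; apply: h => S XS; apply: wM; exact: sub_smallest XS.
(* A net indexed by finite lists of functionals: [m ws] agrees with [T] exactly on [ws], so every
   pairing is eventually constant. *)
have /choice[m mP] : forall ws : seq (l2_pair H K), exists m : weak_star H K,
    M m /\ forall w, List.In w ws -> trace_pairing m w = trace_pairing T w.
  by move=> ws; have [m] := finite_agree ws (smallest_subspace X) MT; exists m.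
pose F : set_system (seq (l2_pair H K)) :=
  [set A | exists ws0, forall ws, List.incl ws0 ws -> A ws].
have FF : ProperFilter F.
  split; first by move=> [ws /(_ ws (@List.incl_refl _ _))].
  split.
  - by exists [::].
  - move=> A B [a hA] [b hB]; exists (a ++ b) => ws /List.incl_app_inv[ha hb].
    by split; [exact: hA|exact: hB].
  - by move=> A B AB [a hA]; exists a => ws /hA /AB.
have mT : m @ F --> (T : weak_star H K).
  apply: initial_ptws_cvg => w; apply: cvg_near_cst.
  by exists [:: w] => ws hw; apply: (mP ws).2; apply: hw; left.
move=> B /mT /= [ws hB]; exists (m ws); split; first exact: (mP ws).1.
by apply: hB; exact: List.incl_refl.
Qed.

Lemma sub_wspan X : X `<=` wspan X.
Proof. by move=> T XT; apply/wspanP => w; exact. Qed.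

Lemma wspan_subspace X : op_subspace (wspan X).
Proof.
split=> [|a S T /wspanP hS /wspanP hT]; first by apply/wspanP => w _; exact: pairing0.
by apply/wspanP => w wX; rewrite pairingP hS// hT// mulr0 addr0.
Qed.

Lemma wspan_min X Y : X `<=` wspan Y -> wspan X `<=` wspan Y.
Proof.
move=> XY T /wspanP XT; apply/wspanP => w wY; apply: XT => S /XY /wspanP; exact.
Qed.

End WeakStar.

Section WeakStarProducts.
Context {R : realType}.
Implicit Types H K L : hilbertType R.

Lemma wspan_compop H K H' K' (X : set (bop H K)) (Y : set (bop H' K')) (A : bop K K')
    (B : bop H' H) :
  (forall T, X T -> wspan Y (compop (compop A T) B)) ->
  forall T, wspan X T -> wspan Y (compop (compop A T) B).
Proof.
move=> XY T /wspanP XT; apply/wspanP => w wY.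
have [w' w'E] := pairing_compop A B w; rewrite w'E; apply: XT => S XS.
by rewrite -w'E; have /wspanP := XY _ XS; exact.
Qed.

Lemma compop_idl H K (T : bop H K) : compop (idop K) T = T.
Proof. exact: eq_bop. Qed.

Lemma compop_idr H K (T : bop H K) : compop T (idop H) = T.
Proof. exact: eq_bop. Qed.

Lemma compopA H K L L' (A : bop L L') (B : bop K L) (C : bop H K) :
  compop A (compop B C) = compop (compop A B) C.
Proof. exact: eq_bop. Qed.

Lemma wspan_compopl H K L (X : set (bop H K)) (Y : set (bop H L)) (A : bop K L) :
  (forall T, X T -> wspan Y (compop A T)) ->
  forall T, wspan X T -> wspan Y (compop A T).
Proof.
move=> XY T XT; rewrite -(compop_idr (compop A T)).
by apply: (wspan_compop (X := X)) => // S XS; rewrite compop_idr; exact: XY.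
Qed.

Lemma wspan_compopr H K L (X : set (bop K L)) (Y : set (bop H L)) (B : bop H K) :
  (forall T, X T -> wspan Y (compop T B)) ->
  forall T, wspan X T -> wspan Y (compop T B).
Proof.
move=> XY T XT; rewrite -(compop_idl T).
by apply: (wspan_compop (X := X)) => // S XS; rewrite compop_idl; exact: XY.
Qed.

(** Multiplication is used only as separately weak* continuous, so the factors are closed up one at
    a time. *)
Lemma wspan_mulset H K L (X : set (bop K L)) (Y : set (bop H K)) (Z : set (bop H L)) :
  mulset X Y `<=` wspan Z -> mulset (wspan X) (wspan Y) `<=` wspan Z.
Proof.
move=> XYZ _ [S hS [T hT <-]].
apply: (wspan_compopl (X := Y)) => // T' YT'.
apply: (wspan_compopr (X := X)) => // S' XS'.
by apply: XYZ; exists S' => //; exists T'.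
Qed.

(** Membership in [bl_space S] is tested by the functionals ['[T x, y]], which belong to the
    predual. *)
Lemma bl_space_wclosed H K (S : set (projection H * projection K)) (X : set (bop H K)) :
  X `<=` bl_space S -> wspan X `<=` bl_space S.
Proof.
move=> XS T /wspanP XT P Q SPQ; apply: eq_bop => u; apply: inner_eq0P => v.
rewrite !compopE proj_adj; have [w wE] := pairing_rank1 (P u) (Q v).
rewrite -wE; apply: XT => T' /XS /(_ _ _ SPQ) QTP.
by rewrite wE -proj_adj -[Q _]/(compop (compop Q T') P u) QTP bop0E inner0l.
Qed.

End WeakStarProducts.

(** * Operators intertwining two CSLs *)

Section GraphOperators.
Context {R : realType}.
Implicit Types H K : hilbertType R.

Definition swap (A B : Type) (L : set (A * B)) : set (B * A) :=
  [set qp | L (qp.2, qp.1)].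

(* The graph of an isomorphism between two CSLs, as a relation so that passing to
   the inverse is just [swap]. *)
Definition csl_graph H K (L : set (projection H * projection K)) :=
  [/\ forall P P' Q Q', L (P, P') -> L (Q, Q') -> pcomm P Q /\ pcomm P' Q',
      forall F, F `<=` L -> L (pinf (fst @` F), pinf (snd @` F)),
      forall F, F `<=` L -> L (psup (fst @` F), psup (snd @` F)) &
      forall P P' Q Q', L (P, P') -> L (Q, Q') -> (P <= Q)%O = (P' <= Q')%O].

Definition graph_op H K (L : set (projection H * projection K)) : set (bop H K) :=
  [set T | forall P P', L (P, P') -> forall x, P' (T (P x)) = T (P x)].

Lemma image_swap (A B : Type) (F : set (A * B)) :
  fst @` swap F = snd @` F /\ snd @` swap F = fst @` F.
Proof.
by split; apply/seteqP; split=> _ [[a b] Fab <-]; exists (b, a).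
Qed.

Lemma csl_graph_swap H K (L : set (projection H * projection K)) :
  csl_graph L -> csl_graph (swap L).
Proof.
move=> [Lc Li Ls Lo]; split.
- by move=> P P' Q Q' LP LQ; have [] := Lc _ _ _ _ LP LQ.
- move=> F FL; rewrite /swap/=; have [<- <-] := image_swap F.
  by apply: Li => -[P P'] /FL.
- move=> F FL; rewrite /swap/=; have [<- <-] := image_swap F.
  by apply: Ls => -[P P'] /FL.
- by move=> P P' Q Q' LP LQ; rewrite (Lo _ _ _ _ LP LQ).
Qed.

Section Reflexive.
Context {H K : hilbertType R} (L : set (projection H * projection K)).
Hypothesis gL : csl_graph L.

Lemma graph_bot : L (proj0 H, proj0 K).
Proof.
have [_ _ Ls _] := gL; have := Ls set0 (@sub0set _ _).
by rewrite !image_set0 !psup_set0.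
Qed.

Lemma graph_top : L (proj1 H, proj1 K).
Proof.
have [_ Li _ _] := gL; have := Li set0 (@sub0set _ _).
by rewrite !image_set0 !pinf_set0.
Qed.

Lemma graph_meet P P' Q Q' : L (P, P') -> L (Q, Q') -> L (pmeet P Q, pmeet P' Q').
Proof.
have [_ Li _ _] := gL => LP LQ; have := Li [set (P, P'); (Q, Q')].
by rewrite !image_setU !image_set1; apply=> _ [->|->].
Qed.

Lemma graph_join P P' Q Q' : L (P, P') -> L (Q, Q') -> L (pjoin P Q, pjoin P' Q').
Proof.
have [_ _ Ls _] := gL => LP LQ; have := Ls [set (P, P'); (Q, Q')].
by rewrite !image_setU !image_set1; apply=> _ [->|->].
Qed.

Lemma range_pair (A B : Type) (p : nat -> A) (q : nat -> B) :
  fst @` range (fun n => (p n, q n)) = range p /\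
  snd @` range (fun n => (p n, q n)) = range q.
Proof.
by split; apply/seteqP; split=> [_ [_ [n _ <-] <-]|_ [n _ <-]];
  (try by exists n); exists (p n, q n) => //; exists n.
Qed.

(** [T P = P' T P] says that the complement of [P'] kills [T P]. Complementing the second entries
    thus turns [graph_op L] into the space of a bilattice, to which reflexivity applies. *)
Lemma graph_bilat : bilat [set pq | L (pq.1, pcompl pq.2)].
Proof.
have [Lc Li Ls Lo] := gL.
have rc (q : nat -> projection K) :
    [set pcompl P | P in range (fun n => pcompl (q n))] = range q.
  apply/seteqP; split=> [_ [_ [n _ <-] <-]|_ [n _ <-]].
    by exists n => //; rewrite pcomplK.
  by exists (pcompl (q n)); [exists n|rewrite pcomplK].
split=> /=.
- move=> P P' Q Q' LP LQ; have [PP QQ] := Lc _ _ _ _ LP LQ; split=> //.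
  have h := pcommC (pcomm_compl (pcommC (pcomm_compl QQ))).
  by rewrite !pcomplK in h.
- by rewrite pcompl0 pcompl1; split; [exact: graph_bot|exact: graph_top].
- move=> P P' Q Q' LP LQ; rewrite pcompl_meet pcompl_join.
  by split; [exact: graph_meet|exact: graph_join].
- move=> p q Lpq _ _; have [e1 e2] := range_pair p (fun n => pcompl (q n)).
  have : L (pinf (range p), pinf (range (fun n => pcompl (q n)))).
    by rewrite -e1 -e2; apply: Li => _ [n _ <-].
  by rewrite -[X in L (_, X)]pcomplK pcompl_pinf (rc q).
- move=> p q Lpq _ _; have [e1 e2] := range_pair p (fun n => pcompl (q n)).
  have : L (psup (range p), psup (range (fun n => pcompl (q n)))).
    by rewrite -e1 -e2; apply: Ls => _ [n _ <-].
  by rewrite -[X in L (_, X)]pcomplK pcompl_psup (rc q).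
Qed.

Lemma graph_op_reflexive x y : (forall T, graph_op L T -> '[T x, y] = 0) ->
  exists P P', [/\ L (P, P'), P x = x & P' y = 0].
Proof.
move=> Txy; have [T ST|P [Q [/= LPQ Px Qy]]] := @bl_space_reflexive _ _ _ _ graph_bilat x y.
  apply: Txy => P P' LP u; apply/pcompl_eq0.
  have /ST : [set pq | L (pq.1, pcompl pq.2)] (P, pcompl P') by rewrite /= pcomplK.
  by move=> h; rewrite -[LHS]/(compop (compop (pcompl P') T) P u) h.
by exists P, (pcompl Q); split=> //; rewrite pcomplE Qy subrr.
Qed.

End Reflexive.

(* [P* := sup P_W] satisfies [P* W x = W x] for all [W], and an infimum [R*] of
   elements with [R' x = x] kills the complement of [P*]; since [R* <= P*] the
   images satisfy [R*' <= P*'], so [x] lies in the range of [P*'], which [y]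
   is orthogonal to. *)
Lemma graph_op_cyclic H K (L : set (projection H * projection K)) x y :
  csl_graph L ->
  (forall V W, graph_op L V -> graph_op (swap L) W -> '[V (W x), y] = 0) ->
  '[x, y] = 0.
Proof.
move=> gL VWxy; have [Lc Li Ls Lo] := gL; have gL' := csl_graph_swap gL.
pose F := [set pq | L pq /\ pq.2 y = 0].
have FL : F `<=` L by move=> pq [].
have Py : psup (snd @` F) y = 0 by apply/psupP => _ [pq [_ h] <-].
have FW W : graph_op (swap L) W -> psup (fst @` F) (W x) = W x.
  move=> LW; have [T LT|P [P' [LP PW P'y]]] := @graph_op_reflexive _ _ L gL (W x) y.
    exact: VWxy.
  have /proj_leP : (P <= psup (fst @` F))%O by apply: le_psup; exists (P, P').
  exact.
set P := psup (fst @` F) in FW *; set P' := psup (snd @` F) in Py *.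
have LP : L (P, P') by exact: Ls.
pose G := [set pq | L pq /\ pq.2 x = x].
have GL : G `<=` L by move=> pq [].
have Qx : pinf (snd @` G) x = x by apply/pinfP => _ [pq [_ h] <-].
have QP : (pinf (fst @` G) <= P)%O.
  apply/proj_le0P => z Pz.
  have [W LW|R' [R0 [LR R'x R0z]]] := @graph_op_reflexive _ _ (swap L) gL' x z.
    by rewrite -(FW _ LW) proj_adj Pz inner0r.
  have : (pinf (fst @` G) <= R0)%O by apply: pinf_le; exists (R0, R').
  by move=> /proj_le0P; apply.
have Q'P' : (pinf (snd @` G) <= P')%O by rewrite -(Lo _ _ _ _ (Li _ GL) LP).
have -> : x = P' x by move/proj_leP : Q'P' => /(_ _ Qx).
by rewrite proj_adj Py inner0r.
Qed.

End GraphOperators.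

(** * Cyclic projections and synthesis *)

Section CyclicProjections.
Context {R : realType} {K : hilbertType R} (L : set (projection K)).
Hypothesis Lc : pairwise_comm L.
Local Notation BB := (bicomm L).
Implicit Types (F P : projection K) (g u v x : K).

Let BBc : pairwise_comm BB := bicomm_comm Lc.

(** The analogue of simple functions multiplied by [g]; their closure is the cyclic subspace of [g]
    for the algebra generated by [L]. *)
Inductive simple_vec (g : K) : K -> Prop :=
| simple_vec0 : simple_vec g 0
| simple_vecS c F u : BB F -> simple_vec g u -> simple_vec g (c *: F g + u).

Lemma simple_lin g a u v : simple_vec g u -> simple_vec g v -> simple_vec g (a *: u + v).
Proof.
move=> gu gv; elim: gu => [|c F u' BF _ IH]; first by rewrite scaler0 add0r.
by rewrite scalerDr -addrA scalerA; apply: simple_vecS.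
Qed.

Lemma simple_self g : simple_vec g g.
Proof.
have := simple_vecS 1 (@bicomm1 _ _ L) (simple_vec0 g).
by rewrite scale1r addr0.
Qed.

Lemma simple_act g F u : BB F -> simple_vec g u -> simple_vec g (F u).
Proof.
move=> BF; elim=> [|c P v BP _ IH]; first by rewrite linear0; exact: simple_vec0.
rewrite linearP/= -(pmeetE g (BBc BF BP)).
by apply: simple_vecS => //; exact: bicomm_meet.
Qed.

Definition near_simple g : set K :=
  [set u | forall e : R, 0 < e -> exists2 v, simple_vec g v & nrm (u - v) <= e].

Lemma near_simple_subsp g : subsp (near_simple g).
Proof.
split=> [e e0|a x y hx hy e e0].
  by exists 0; [exact: simple_vec0|rewrite subrr nrm0 ltW].
have e1 : 0 < e / (2 * (nrm a + 1)).
  by rewrite divr_gt0// mulr_gt0// ltr_wpDl ?nrm_ge0.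
have e2 : 0 < e / 2 by rewrite divr_gt0.
have [u gu hu] := hx _ e1; have [v gv hv] := hy _ e2.
exists (a *: u + v); first exact: simple_lin.
rewrite opprD addrACA -scalerBr (le_trans (nrmD _ _))// [leRHS](splitr e) lerD//.
rewrite nrmZ (le_trans (ler_wpM2l (nrm_ge0 a) hu))//.
have a1 : 0 < nrm a + 1 by rewrite ltr_wpDl ?nrm_ge0.
rewrite [leLHS](_ : _ = e / 2 * (nrm a / (nrm a + 1))).
  by rewrite ler_piMr ?(ltW e2)// ler_pdivrMr// mul1r lerDl.
by field; rewrite gt_eqF.
Qed.

Lemma near_simple_closed g : seq_closed (near_simple g).
Proof.
move=> u l hu ul e e0; have e2 : 0 < e / 2 by rewrite divr_gt0.
have [N _ /(_ N (leqnn N)) /= hN] := (ncvgP _ _).1 ul _ e2.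
have [v gv hv] := hu N _ e2; exists v => //.
rewrite -[l](subrK (u N)) -addrA (le_trans (nrmD _ _))// [leRHS](splitr e).
by rewrite lerD// nrm_sub.
Qed.

Definition cyc g := sval (cid (proj_exists (near_simple_subsp g) (@near_simple_closed g))).

Lemma cycP g u : cyc g u = u <-> near_simple g u.
Proof. by apply: iff_sym; apply: (svalP (cid (proj_exists _ _))). Qed.

Lemma near_simple_simple g u : simple_vec g u -> near_simple g u.
Proof. by move=> gu e e0; exists u => //; rewrite subrr nrm0 ltW. Qed.

Lemma cyc_simple g u : simple_vec g u -> cyc g u = u.
Proof. by move=> /near_simple_simple /cycP. Qed.

Lemma cyc_self g : cyc g g = g.
Proof. exact/cyc_simple/simple_self. Qed.

(** So [cyc g] lies in the commutant of [L], and operator spaces that absorb this commutant can be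
    compressed by it. *)
Lemma cyc_comm g F : BB F -> pcomm F (cyc g).
Proof.
move=> BF; have inv x : cyc g x = x -> cyc g (F x) = F x.
  move=> /cycP hx; apply/cycP => e /hx[v gv hv].
  exists (F v); first exact: simple_act.
  by rewrite -linearB (le_trans (proj_nrm _ _)).
exact: (proj_commute (proj_adj F) inv inv).
Qed.

Lemma cyc_commL g P : L P -> pcomm (cyc g) P.
Proof. by move=> LP; apply/pcommC/cyc_comm/sub_bicomm. Qed.

Lemma cyc_orth g p : (forall F, BB F -> pcomm p F) -> p g = 0 -> forall x, p (cyc g x) = 0.
Proof.
move=> pB pg x; have ps u : simple_vec g u -> p u = 0.
  elim=> [|c F v BF _ IH]; first by rewrite linear0.
  by rewrite linearP/= (pB _ BF) pg linear0 scaler0 IH addr0.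
apply: nrm0_eq0; apply/eqP; rewrite eq_le nrm_ge0 andbT.
apply/ler_addgt0Pr => e e0; rewrite add0r.
have /cycP/(_ _ e0)[v gv hv] := proj_idem (cyc g) x.
by rewrite -[p _]subr0 -(ps _ gv) -linearB (le_trans (proj_nrm _ _)).
Qed.

Definition splits (s : seq (projection K)) F := forall P, P \in s ->
  (forall x, P (F x) = F x) \/ (forall x, P (F x) = 0).

Lemma simple_split g u : simple_vec g u -> exists2 s : seq (projection K),
  (forall P, P \in s -> BB P) &
  forall F, BB F -> splits s F -> exists c, F u = c *: F g.
Proof.
elim=> [|c P v BP _ [s sB sP]].
  by exists [::] => // F _ _; exists 0; rewrite linear0 scale0r.
exists (P :: s) => [Q|F BF sF]; first by rewrite inE => /orP[/eqP->|/sB].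
have [|d Fv] := sP F BF; first by move=> Q Qs; apply: sF; rewrite inE Qs orbT.
have FPg : F (P g) = P (F g) by apply: BBc.
have [h|h] := sF P (mem_head _ _).
  by exists (c + d); rewrite linearP/= FPg h Fv scalerDl.
by exists d; rewrite linearP/= FPg h scaler0 add0r.
Qed.

Lemma simple_splits g (m : nat) (u : nat -> K) :
  (forall k, (k < m)%N -> simple_vec g (u k)) -> exists2 s : seq (projection K),
  (forall P, P \in s -> BB P) &
  forall F, BB F -> splits s F -> forall k, (k < m)%N -> exists c, F (u k) = c *: F g.
Proof.
elim: m => [_|m IH hu]; first by exists [::].
have [|s sB sP] := IH; first by move=> k km; apply: hu; rewrite ltnW.
have [s' s'B s'P] := simple_split (hu m (ltnSn m)).
exists (s ++ s') => [P|F BF sF k]; first by rewrite mem_cat => /orP[/sB|/s'B].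
rewrite ltnS leq_eqVlt => /orP[/eqP->|km].
  by apply: s'P => // P Ps; apply: sF; rewrite mem_cat Ps orbT.
by apply: sP => // P Ps; apply: sF; rewrite mem_cat Ps.
Qed.

(** Finitely many simple vectors involve finitely many projections; on the atoms of these, every
    coefficient is constant. *)
Lemma simple_partition g (m : nat) (u v : nat -> K) :
  (forall k, (k < m)%N -> simple_vec g (u k)) ->
  (forall k, (k < m)%N -> simple_vec g (v k)) ->
  (forall k, (m <= k)%N -> u k = 0 /\ v k = 0) ->
  exists (I : finType) (F : I -> projection K) (X Y : I -> nat -> R[i]),
  [/\ forall i, BB (F i), forall x, \sum_i F i x = x,
      forall i j x, i != j -> F i (F j x) = 0,
      forall i k, F i (u k) = X i k *: F i g /\ F i (v k) = Y i k *: F i g &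
      forall i k, (m <= k)%N -> X i k = 0 /\ Y i k = 0].
Proof.
move=> hu hv uv0; have [s sB sP] := simple_splits hu; have [s' s'B s'P] := simple_splits hv.
have [|I [F [FB Fs Fo sF]]] := @atoms _ _ L (s ++ s') Lc.
  by move=> P; rewrite mem_cat => /orP[/sB|/s'B].
have h i k : exists XY : R[i] * R[i],
    [/\ F i (u k) = XY.1 *: F i g, F i (v k) = XY.2 *: F i g &
     (m <= k)%N -> XY.1 = 0 /\ XY.2 = 0].
  have [mk|km] := leqP m k.
    (* Where [F i g = 0] the coefficient is not determined by the vector, so it has to be chosen to
       be 0. *)
    by exists (0, 0); have [-> ->] := uv0 _ mk; rewrite !linear0 scale0r.
  have [|c hc] := sP (F i) (FB i) _ k km.
    by move=> P Ps; apply: sF; rewrite mem_cat Ps.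
  have [|d hd] := s'P (F i) (FB i) _ k km.
    by move=> P Ps; apply: sF; rewrite mem_cat Ps orbT.
  by exists (c, d).
have /choice[XY hXY] : forall ik : I * nat, exists XY : R[i] * R[i],
    [/\ F ik.1 (u ik.2) = XY.1 *: F ik.1 g, F ik.1 (v ik.2) = XY.2 *: F ik.1 g &
     (m <= ik.2)%N -> XY.1 = 0 /\ XY.2 = 0] by move=> [i k]; exact: h.
exists I, F, (fun i k => (XY (i, k)).1), (fun i k => (XY (i, k)).2).
split=> // i k; first by have [] := hXY (i, k).
by have [_ _] := hXY (i, k).
Qed.

End CyclicProjections.

Section OrthogonalSums.
Context {R : realType} {K : hilbertType R} {I : finType} (F : I -> projection K).
Hypothesis Fo : forall i j x, i != j -> F i (F j x) = 0.

Lemma orth_sum_inner (a b : I -> R[i]) x y :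
  '[\sum_i a i *: F i x, \sum_i b i *: F i y] =
  \sum_i a i * (b i)^*%C * '[F i x, F i y].
Proof.
rewrite inner_suml; apply: eq_bigr => i _; rewrite inner_sumr (bigD1 i)//= big1.
  by rewrite addr0 innerZl innerZr; ring.
move=> j ji; rewrite innerZl innerZr -[F i x](proj_idem (F i)) proj_adj.
by rewrite Fo 1?eq_sym// inner0r !mulr0.
Qed.

Lemma orth_sum_nrm (a : I -> R[i]) x :
  nrm (\sum_i a i *: F i x) ^+ 2 = \sum_i nrm (a i) ^+ 2 * nrm (F i x) ^+ 2.
Proof.
apply: complexI; rewrite -inner_nrm orth_sum_inner rmorph_sum/=.
apply: eq_bigr => i _; rewrite inner_nrm -sqr_normc nrmE -rmorphXn -rmorphM.
by [].
Qed.

End OrthogonalSums.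

Section Localization.
Context {R : realType} {K : hilbertType R} (L : set (projection K)).
Hypothesis Lc : pairwise_comm L.
Local Notation BB := (bicomm L).
Let BBc : pairwise_comm BB := bicomm_comm Lc.
Implicit Types (F E : projection K).

Section Mass.
Variables (r s : nat -> K) (C : R).
Hypothesis rsC : forall N : nat, \sum_(0 <= k < N) (nrm (r k) ^+ 2 + nrm (s k) ^+ 2) <= C.

Definition qsum F N := \sum_(0 <= k < N) (nrm (F (r k)) ^+ 2 + nrm (F (s k)) ^+ 2).
(** The total mass of [r] and [s] in [F], written as a supremum of strongly continuous terms and
    hence lower semicontinuous. *)
Definition qsup F := sup (range (qsum F)).

Lemma qsum_le F N : qsum F N <= C.
Proof.
apply: le_trans (rsC N); apply: ler_sum => k _.
by rewrite lerD ?proj_nrm_sqr.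
Qed.

Lemma qsum_ub F : has_ubound (range (qsum F)).
Proof. by exists C => _ [N _ <-]; exact: qsum_le. Qed.

Lemma qsupP F M : qsup F <= M <-> forall N, qsum F N <= M.
Proof.
split=> [qM N|h].
  by apply: le_trans qM; apply: ub_le_sup; [exact: qsum_ub|exists N].
by apply: ge_sup => [|_ [N _ <-]]; [exists (qsum F 0), 0%N|exact: h].
Qed.

Lemma qsum_le_sup F N : qsum F N <= qsup F.
Proof. by have /qsupP := lexx (qsup F). Qed.

Lemma qsup_ge0 F : 0 <= qsup F.
Proof. by have := qsum_le_sup F 0; rewrite /qsum big_geq. Qed.

Lemma qsum_mono F N M : (N <= M)%N -> qsum F N <= qsum F M.
Proof. by move=> NM; apply: psum_le => // k; rewrite addr_ge0 ?sqr_ge0. Qed.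

Lemma qsup_cvg F : qsum F N @[N --> \oo] --> qsup F.
Proof.
by apply: nondecreasing_cvgn; [move=> N M; exact: qsum_mono|exact: qsum_ub].
Qed.

Lemma qsup_add F G M : (forall N, qsum F N + qsum G N <= M) -> qsup F + qsup G <= M.
Proof.
move=> h; have : qsum F N + qsum G N @[N --> \oo] --> qsup F + qsup G.
  by apply: cvgD; exact: qsup_cvg.
by move=> /cvgr_to_le; apply; apply: filterE.
Qed.

(* Hahn decomposition of [F |-> qsup F - e * nrm (F g) ^+ 2] below [F0]. *)
Lemma hahn_piece (g : K) (e : R) F0 : BB F0 -> qsup F0 < e * nrm (F0 g) ^+ 2 ->
  exists E, [/\ BB E, (E <= F0)%O, E g <> 0 &
    forall F, BB F -> (F <= E)%O -> forall N, qsum F N <= e * nrm (F g) ^+ 2].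
Proof.
move=> BF0 qF0.
have e0 : 0 < e.
  rewrite ltNge; apply/negP => e0; have := le_lt_trans (qsup_ge0 F0) qF0.
  by rewrite ltNge mulr_le0_ge0 ?sqr_ge0.
pose f F := qsup F - e * nrm (F g) ^+ 2.
have lsc (u : nat -> projection K) (P : projection K) k M : (forall x, ncvg \oo (fun n => u n x) (P x)) ->
    (forall n, (k <= n)%N -> f (u n) <= M) -> f P <= M.
  move=> uP uM; rewrite /f lerBlDr; apply/qsupP => N.
  have h1 : qsum (u n) N @[n --> \oo] --> qsum P N.
    rewrite /qsum !big_mkord.
    have -> : (fun n => \sum_(0 <= k0 < N) (nrm (u n (r k0)) ^+ 2 + nrm (u n (s k0)) ^+ 2)) =
        (fun n => \sum_(k0 < N) (nrm (u n (r k0)) ^+ 2 + nrm (u n (s k0)) ^+ 2)).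
      by apply/funext => n; rewrite big_mkord.
    by apply: cvg_sumr => i; apply: cvgD; apply: ncvg_sqr.
  have h2 : M + e * nrm (u n g) ^+ 2 @[n --> \oo] --> M + e * nrm (P g) ^+ 2.
    by apply: cvgD; [exact: cvg_cst|apply: cvgMr; exact: ncvg_sqr].
  apply: (ler_cvg_to h1 h2); near=> n.
  have kn : (k <= n)%N by near: n; exact: nbhs_infty_ge.
  by have := uM _ kn; rewrite /f lerBlDr; apply: le_trans; exact: qsum_le_sup.
have modular (F G : projection K) : BB F -> BB G -> f (pmeet F G) + f (pjoin F G) <= f F + f G.
  move=> BF BG; have FG := BBc BF BG.
  have h1 : qsup (pmeet F G) + qsup (pjoin F G) <= qsup F + qsup G.
    apply: qsup_add => N; apply: le_trans (lerD (qsum_le_sup F N) (qsum_le_sup G N)).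
    rewrite /qsum -!big_split/=; apply: ler_sum => k _.
    by rewrite addrACA (nrm_modular _ FG) (nrm_modular _ FG) [leRHS]addrACA.
  have h2 := nrm_modular g FG.
  have -> : f (pmeet F G) + f (pjoin F G) = qsup (pmeet F G) + qsup (pjoin F G) -
      e * (nrm (pmeet F G g) ^+ 2 + nrm (pjoin F G g) ^+ 2) by rewrite /f; ring.
  have -> : f F + f G = qsup F + qsup G - e * (nrm (F g) ^+ 2 + nrm (G g) ^+ 2).
    by rewrite /f; ring.
  by rewrite h2 lerD2r.
have [E [BE EF0] Emin] : exists2 E, BB E /\ (E <= F0)%O &
    forall F, BB F /\ (F <= F0)%O -> f E <= f F.
  apply: (@modular_min _ _ [set F | BB F /\ (F <= F0)%O] (fun a b => (a <= b)%O) f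
    (@pmeet _ _) (- (e * nrm g ^+ 2))).
  - by exists F0.
  - move=> F _; rewrite /f -[leLHS]add0r lerD ?qsup_ge0//.
    by rewrite lerN2 ler_pM2l// proj_nrm_sqr.
  - by move=> x y z; exact: le_trans.
  - move=> F G [BF FF0] [BG GF0]; split.
    + by split; [exact: bicomm_meet|apply: le_trans FF0; exact: pmeetl].
    + exact: pmeetl.
    + exact: pmeetr.
    + by move=> z _ zF zG; apply: le_pinf => _ [->|->].
  - move=> F G [BF FF0] [BG GF0]; exists (pjoin F G); last exact: modular.
    by split; [exact: bicomm_join|apply: psup_le => _ [->|->]].
  - move=> u Bu ud; exists (pinf (range u)); split.
    + split; first by apply: bicomm_inf => _ [n _ <-]; have [] := Bu n.
      by apply: le_trans (Bu 0%N).2; apply: pinf_le; exists 0%N.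
    + by move=> n; apply: pinf_le; exists n.
    + by move=> b _ bu; apply: le_pinf => _ [n _ <-].
    + by move=> M uM; apply: (lsc u _ 0%N) => // x; exact: pinf_cvg.
  - move=> u Bu ui; exists (psup (range u)).
      split; first by apply: bicomm_sup => _ [n _ <-]; have [] := Bu n.
      by apply: psup_le => _ [n _ <-]; have [] := Bu n.
    by move=> k M uM; apply: (lsc u _ k) => // x; exact: psup_cvg.
exists E; split=> //.
(* [E g = 0] would give 0 <= f E <= f F0 < 0. *)
- move=> Eg; have := Emin F0 (conj BF0 (lexx _)).
  rewrite /f Eg nrm0 expr0n mulr0 subr0 => h; have := le_lt_trans h _.
  move=> /(_ 0); rewrite subr_lt0 => /(_ qF0).
  by rewrite ltNge qsup_ge0.
(* [G] is [E] with [F] removed. Minimality gives f E <= f G, and additivity of both masses turns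
   this into f F <= 0. *)
- move=> F BF FE N; pose G := pmeet E (pcompl F).
  have BG : BB G by apply: bicomm_meet => //; exact: bicomm_compl.
  have GF0 : (G <= F0)%O by apply: le_trans EF0; exact: pmeetl.
  have split_nrm x : nrm (F x) ^+ 2 + nrm (G x) ^+ 2 = nrm (E x) ^+ 2.
    have EF : pcomm E (pcompl F) by apply: BBc => //; exact: bicomm_compl.
    by rewrite /G pmeetE// EF pcomplE [RHS](proj_pyth F) (proj_le_absr x FE).
  have := Emin G (conj BG GF0); rewrite /f => h.
  have h2 : qsum F N + qsup G <= qsup E.
    rewrite -lerBrDl; apply/qsupP => M; rewrite lerBrDl.
    pose NM := maxn N M.
    apply: le_trans (lerD (qsum_mono F (leq_maxl N M)) (qsum_mono G (leq_maxr N M))) _.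
    apply: le_trans (qsum_le_sup E (maxn N M)); rewrite /qsum -big_split/=.
    by apply: ler_sum => k _; rewrite addrACA !split_nrm.
  have h3 := split_nrm g; rewrite -h3 in h.
  move: (nrm (F g) ^+ 2) (nrm (G g) ^+ 2) h => a b.
  by rewrite mulrDr; move: (e * a) (e * b) => ea eb; lra.
Unshelve. all: by end_near. Qed.

End Mass.
End Localization.

Section Pigeonhole.
Context {R : realType} {K : hilbertType R} {I : finType} (F : I -> projection K).
Hypothesis Fs : forall x, \sum_i F i x = x.
Hypothesis Fo : forall i j x, i != j -> F i (F j x) = 0.
Variables (g : K) (m : nat) (x y u v : nat -> K) (X Y : I -> nat -> R[i]) (C d : R).
Hypotheses (d0 : 0 < d) (d1 : d <= 1).
Hypothesis xyC : forall N : nat, \sum_(0 <= k < N) (nrm (x k) ^+ 2 + nrm (y k) ^+ 2) <= C.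
Hypothesis FX : forall i k, F i (u k) = X i k *: F i g /\ F i (v k) = Y i k *: F i g.
Hypothesis X0 : forall i k, (m <= k)%N -> X i k = 0 /\ Y i k = 0.
Hypothesis rs : forall N : nat,
  \sum_(0 <= k < N) (nrm (x k - u k) ^+ 2 + nrm (y k - v k) ^+ 2) <= 2 * d ^+ 2.

(* On the piece [F i] the functional is approximately
   [T |-> cross i * '[T (F i g), F i g]]; the constant [64] in [rate] leaves room to
   absorb the error terms below. *)
Definition cross (i : I) := \sum_(0 <= k < m) X i k * (Y i k)^*%C.
Definition weight (i : I) := \sum_(0 <= k < m) (nrm (X i k) ^+ 2 + nrm (Y i k) ^+ 2).
Definition rate (i : I) := nrm (cross i) ^+ 2 / (64 * weight i).

Lemma weight_ge0 i : 0 <= weight i.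
Proof. by apply: sumr_ge0 => k _; rewrite addr_ge0 ?sqr_ge0. Qed.

Lemma cross_le i : nrm (cross i) <= weight i.
Proof.
apply: le_trans (nrm_sum _ _ _) _; apply: ler_sum => k _.
rewrite nrmM nrmJ; have := sqr_ge0 (nrm (X i k) - nrm (Y i k)).
have := sqr_ge0 (nrm (X i k)); have := sqr_ge0 (nrm (Y i k)).
by move: (nrm _) (nrm _) => p q; rewrite !expr2; lra.
Qed.

Lemma rate_cross i : nrm (cross i) ^+ 2 = 64 * rate i * weight i.
Proof.
have [w0|w0] := eqVneq (weight i) 0; last by rewrite /rate; field.
have := cross_le i; rewrite w0 mulr0 => h.
have -> : nrm (cross i) = 0 by apply/eqP; rewrite eq_le h nrm_ge0.
by rewrite expr0n.
Qed.

Lemma rate_ge0 i : 0 <= rate i.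
Proof. by rewrite divr_ge0 ?sqr_ge0// mulr_ge0// weight_ge0. Qed.

Let u_nrm k : nrm (u k) ^+ 2 = \sum_i nrm (X i k) ^+ 2 * nrm (F i g) ^+ 2.
Proof.
rewrite -(parseval Fs); apply: eq_bigr => i _.
by rewrite (FX i k).1 nrmZ exprMn.
Qed.

Let v_nrm k : nrm (v k) ^+ 2 = \sum_i nrm (Y i k) ^+ 2 * nrm (F i g) ^+ 2.
Proof.
rewrite -(parseval Fs); apply: eq_bigr => i _.
by rewrite (FX i k).2 nrmZ exprMn.
Qed.

(** [nrm u ^+ 2 <= 2 * nrm x ^+ 2 + 2 * nrm (x - u) ^+ 2] bounds the masses of [u] and [v] by 2 C +
    4 d^2, and d <= 1. *)
Let D := 2 * C + 4.

Let uvD N : \sum_(0 <= k < N) (nrm (u k) ^+ 2 + nrm (v k) ^+ 2) <= D.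
Proof.
have half (z z' : K) : nrm z' ^+ 2 <= 2 * nrm z ^+ 2 + 2 * nrm (z - z') ^+ 2.
  have := parallelogram z (z - z'); rewrite subKr.
  have := sqr_ge0 (nrm (z + (z - z'))).
  by move: (_ ^+ 2) (nrm z' ^+ 2) (nrm z ^+ 2) (nrm (z - z') ^+ 2) => a b c e;
    rewrite mulr2n; lra.
apply: le_trans (_ : 2 * \sum_(0 <= k < N) (nrm (x k) ^+ 2 + nrm (y k) ^+ 2) +
   2 * \sum_(0 <= k < N) (nrm (x k - u k) ^+ 2 + nrm (y k - v k) ^+ 2) <= _).
  rewrite !mulr_sumr -big_split/=; apply: ler_sum => k _.
  have := half (x k) (u k); have := half (y k) (v k).
  by move: (nrm (x k) ^+ 2) (nrm (y k) ^+ 2) (nrm (x k - u k) ^+ 2) (nrm (y k - v k) ^+ 2)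
    (nrm (u k) ^+ 2) (nrm (v k) ^+ 2) => a1 a2 a3 a4 a5 a6; lra.
have := xyC N; have := rs N.
have : d ^+ 2 <= 1 by rewrite expr_le1// ltW.
move: (d ^+ 2) (\sum_(_ <= _ < _) _) (\sum_(_ <= _ < _) _) => a b c.
rewrite /D; lra.
Qed.

Let uv_sum N : (m <= N)%N ->
  \sum_(0 <= k < N) '[u k, v k] = \sum_i cross i * (nrm (F i g) ^+ 2)%:C.
Proof.
move=> mN.
have uvE k : '[u k, v k] = \sum_i X i k * (Y i k)^*%C * (nrm (F i g) ^+ 2)%:C.
  rewrite -[u k]Fs -[v k]Fs (eq_bigr (fun i => X i k *: F i g)); last first.
    by move=> i _; have [] := FX i k.
  rewrite [X in '[_, X]](eq_bigr (fun i => Y i k *: F i g)); last first.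
    by move=> i _; have [] := FX i k.
  by rewrite orth_sum_inner//; apply: eq_bigr => i _; rewrite inner_nrm.
rewrite (eq_bigr _ (fun k _ => uvE k)) exchange_big/=; apply: eq_bigr => i _.
rewrite /cross mulr_suml (@big_cat_nat _ _ _ m 0 N)//= [X in _ + X]big1_seq ?addr0//.
by move=> k /andP[_]; rewrite mem_index_iota => /andP[mk _];
  rewrite (X0 i mk).1 !mul0r.
Qed.

(** The remainders have mass of order d^2. AM-GM with weight [d] on the mixed terms divides it by
    [d], leaving an error of order [d]. *)
Let approx N : nrm (\sum_(0 <= k < N) '[x k, y k] - \sum_(0 <= k < N) '[u k, v k]) <=
  d * (2 + D).
Proof.
rewrite -sumrB; apply: le_trans (nrm_sum _ _ _) _.
apply: le_trans (_ : (2 * d)^-1 * \sum_(0 <= k < N) (nrm (x k - u k) ^+ 2 + nrm (y k - v k) ^+ 2)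
  + d / 2 * \sum_(0 <= k < N) (nrm (u k) ^+ 2 + nrm (v k) ^+ 2)
  + 2^-1 * \sum_(0 <= k < N) (nrm (x k - u k) ^+ 2 + nrm (y k - v k) ^+ 2) <= _).
  rewrite !mulr_sumr -!big_split/=; apply: ler_sum => k _.
  have -> : '[x k, y k] - '[u k, v k] =
      '[x k - u k, v k] + '[u k, y k - v k] + '[x k - u k, y k - v k].
    by rewrite !innerBl !innerBr; ring.
  apply: le_trans (nrmD _ _) _; apply: le_trans (lerD (nrmD _ _) (lexx _)) _.
  apply: le_trans (lerD (lerD (inner_le _ _) (inner_le _ _)) (inner_le _ _)) _.
  move: (nrm (x k - u k)) (nrm (y k - v k)) (nrm (u k)) (nrm (v k)) => r s p q.
  have amgm (a b : R) : a * b <= (2 * d)^-1 * a ^+ 2 + d / 2 * b ^+ 2.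
    rewrite -subr_ge0 (_ : _ - _ = (2 * d)^-1 * (a - d * b) ^+ 2).
      by rewrite mulr_ge0 ?sqr_ge0// invr_ge0 mulr_ge0// ltW.
    by field; rewrite gt_eqF.
  have h1 := amgm r q; have h2 := amgm s p.
  have h3 : r * s <= 2^-1 * r ^+ 2 + 2^-1 * s ^+ 2.
    by have := sqr_ge0 (r - s); rewrite !expr2; lra.
  rewrite !mulrDr; move: h1 h2 h3; rewrite (mulrC p s).
  move: ((2 * d)^-1 * r ^+ 2) ((2 * d)^-1 * s ^+ 2) (d / 2 * q ^+ 2) (d / 2 * p ^+ 2)
   (2^-1 * r ^+ 2) (2^-1 * s ^+ 2) (r * q) (s * p) (r * s) => ? ? ? ? ? ? ? ? ?; lra.
have D0 : 0 <= D by apply: le_trans (uvD 0); rewrite big_geq.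
have dd : d ^+ 2 <= d by rewrite expr2 ler_piMr// ltW.
move: (rs N) (uvD N); move: (\sum_(_ <= _ < _) _) (\sum_(_ <= _ < _) _) => b a ha hb.
have k1 : (2 * d)^-1 * a <= d.
  have d2 : 0 < 2 * d by rewrite mulr_gt0.
  by rewrite mulrC ler_pdivrMr// mulrCA -expr2.
have k2 : d / 2 * b <= d / 2 * D by rewrite ler_wpM2l// divr_ge0// ltW.
have k3 : 2^-1 * a <= d by move: (d ^+ 2) dd ha => q; lra.
apply: le_trans (lerD (lerD k1 k2) k3) _.
have dD : 0 <= d * D by rewrite mulr_ge0// ltW.
have -> : d * (2 + D) = d + d / 2 * D + d + d * D / 2 by field.
by rewrite lerDl divr_ge0.
Qed.

(** Used by contraposition. Were the remainders heavy on every piece, summing over the pieces would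
    make all [rate] terms small together, then the [cross] terms, then the functional itself; so a
    functional that is not small has a piece with light remainders. *)
Lemma pigeonhole :
  (forall i, rate i * nrm (F i g) ^+ 2 <= qsup (fun k => x k - u k) (fun k => y k - v k) (F i)) ->
  forall N, (m <= N)%N -> nrm (\sum_(0 <= k < N) '[x k, y k]) <= 5 * d * (2 + D).
Proof.
move=> heavy N mN.
have total : \sum_i rate i * nrm (F i g) ^+ 2 <= 2 * d ^+ 2.
  apply: le_trans (ler_sum _ (fun i _ => heavy i)) _.
  have h : \sum_i qsum (fun k => x k - u k) (fun k => y k - v k) (F i) M @[M --> \oo] -->
    \sum_i qsup (fun k => x k - u k) (fun k => y k - v k) (F i).
    by apply: cvg_sumr => i; exact: (qsup_cvg rs).
  apply: (cvgr_to_le h); apply: filterE => M; rewrite /qsum exchange_big/=.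
  apply: le_trans (rs M); apply: ler_sum => k _.
  by rewrite big_split/= !(parseval Fs).
have wD : \sum_i weight i * nrm (F i g) ^+ 2 <= D.
  apply: le_trans (uvD m); rewrite /weight.
  rewrite (eq_bigr (fun i => \sum_(0 <= k < m) (nrm (X i k) ^+ 2 * nrm (F i g) ^+ 2 +
     nrm (Y i k) ^+ 2 * nrm (F i g) ^+ 2))); last first.
    by move=> i _; rewrite mulr_suml; apply: eq_bigr => k _; rewrite mulrDl.
  by rewrite exchange_big/=; apply: ler_sum => k _; rewrite big_split/= u_nrm v_nrm.
have crossD : nrm (\sum_i cross i * (nrm (F i g) ^+ 2)%:C) <= 4 * d * (2 + D).
  apply: le_trans (nrm_sum _ _ _) _.
  (* AM-GM on [rate_cross], with 64 = 4 * (4 / d) * (4 * d). *)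
  apply: le_trans (_ : 4 / d * (\sum_i rate i * nrm (F i g) ^+ 2) +
    4 * d * (\sum_i weight i * nrm (F i g) ^+ 2) <= _).
    rewrite !mulr_sumr -big_split/=; apply: ler_sum => i _.
    rewrite nrmM nrmC ger0_norm ?sqr_ge0//.
    rewrite (mulrA (4 / d) (rate i)) (mulrA (4 * d) (weight i)) -mulrDl.
    apply: ler_wpM2r; first exact: sqr_ge0.
    have r0 := rate_ge0 i; have w0 := weight_ge0 i; have d4 : 0 <= 4 / d by rewrite divr_ge0// ltW.
    have rhs0 : 0 <= 4 / d * rate i + 4 * d * weight i.
      by apply: addr_ge0; [exact: mulr_ge0|rewrite mulr_ge0// mulr_ge0// ltW].
    rewrite -(@ler_pXn2r _ 2) ?nnegrE ?nrm_ge0//.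
    rewrite rate_cross -subr_ge0 (_ : _ - _ = (4 / d * rate i - 4 * d * weight i) ^+ 2).
      exact: sqr_ge0.
    by field; rewrite gt_eqF.
  have k1 : 4 / d * (\sum_i rate i * nrm (F i g) ^+ 2) <= 8 * d.
    rewrite (_ : 8 * d = 4 / d * (2 * d ^+ 2)); last by field; rewrite gt_eqF.
    by rewrite ler_wpM2l// divr_ge0// ltW.
  have k2 : 4 * d * (\sum_i weight i * nrm (F i g) ^+ 2) <= 4 * d * D.
    by rewrite ler_wpM2l// mulr_ge0// ltW.
  apply: le_trans (lerD k1 k2) _; rewrite le_eqVlt; apply/orP; left; apply/eqP; ring.
have a := approx N; rewrite uv_sum// in a.
rewrite -[\sum_(0 <= k < N) _](subrK (\sum_i cross i * (nrm (F i g) ^+ 2)%:C)).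
apply: le_trans (nrmD _ _) _; apply: le_trans (lerD a crossD) _.
by rewrite le_eqVlt; apply/orP; left; apply/eqP; ring.
Qed.

End Pigeonhole.

(** * A compression bounded by half of its own bound *)

Section Absorption.
Context {R : realType}.

(** The weight [kp] makes each of the three balanced contributions c/16 times n h; the products of
    two remainders add c^2/(64 S) <= c/64. The sum 3/16 + 1/64 is below 1/2. *)
Lemma weighted_sum (P Q A B : nat -> R) (N : nat) (S c e n h : R) :
  0 < S -> 0 < c -> c <= S -> e = c ^+ 2 / (64 * S) -> 0 < n -> 0 < h ->
  \sum_(0 <= k < N) (P k ^+ 2 + Q k ^+ 2) <= S ->
  \sum_(0 <= k < N) A k ^+ 2 <= e * n ^+ 2 ->
  \sum_(0 <= k < N) B k ^+ 2 <= e * h ^+ 2 ->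
  \sum_(0 <= k < N) (P k * B k * n + Q k * A k * h + A k * B k) <= c / 2 * (n * h).
Proof.
move=> S0 c0 cS eE n0 h0 PQ hA hB.
have [kp kE] : exists kp, kp = c / (8 * S) by exists (c / (8 * S)).
have kp0 : 0 < kp by rewrite kE divr_gt0// mulr_gt0.
have [kp0' n0' h0'] : [/\ 0 <= kp, 0 <= n & 0 <= h] by split; exact: ltW.
have term k : P k * B k * n + Q k * A k * h + A k * B k <=
    kp * (n * h) / 2 * (P k ^+ 2 + Q k ^+ 2) +
    (n / (2 * kp * h) + n / (2 * h)) * B k ^+ 2 +
    (h / (2 * kp * n) + h / (2 * n)) * A k ^+ 2.
  move: (P k) (Q k) (A k) (B k) => p q a b.
  rewrite -subr_ge0 (_ : _ - _ =
    n / (2 * kp * h) * (kp * h * p - b) ^+ 2 +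
    h / (2 * kp * n) * (kp * n * q - a) ^+ 2 +
    (2 * n * h)^-1 * (h * a - n * b) ^+ 2).
    by do ?[exact: sqr_ge0|apply: addr_ge0|apply: divr_ge0|rewrite invr_ge0|apply: mulr_ge0].
  by field; rewrite !gt_eqF.
apply: le_trans (ler_sum _ (fun k _ => term k)) _.
rewrite !big_split/= -!mulr_sumr.
have k1 : kp * (n * h) / 2 * (\sum_(0 <= k < N) (P k ^+ 2 + Q k ^+ 2)) <= kp * (n * h) / 2 * S.
  by apply: ler_wpM2l => //; do ?[apply: divr_ge0|apply: mulr_ge0].
have k2 : (n / (2 * kp * h) + n / (2 * h)) * \sum_(0 <= k < N) B k ^+ 2 <=
    (n / (2 * kp * h) + n / (2 * h)) * (e * h ^+ 2).
  by apply: ler_wpM2l => //; do ?[apply: addr_ge0|apply: divr_ge0|apply: mulr_ge0].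
have k3 : (h / (2 * kp * n) + h / (2 * n)) * \sum_(0 <= k < N) A k ^+ 2 <=
    (h / (2 * kp * n) + h / (2 * n)) * (e * n ^+ 2).
  by apply: ler_wpM2l => //; do ?[apply: addr_ge0|apply: divr_ge0|apply: mulr_ge0].
apply: le_trans (lerD (lerD k1 k2) k3) _.
have -> : kp * (n * h) / 2 * S + (n / (2 * kp * h) + n / (2 * h)) * (e * h ^+ 2) +
    (h / (2 * kp * n) + h / (2 * n)) * (e * n ^+ 2) = (3 / 16 + c / S / 64) * c * (n * h).
  by rewrite eE kE; field; rewrite !gt_eqF.
rewrite ler_wpM2r ?mulr_ge0 ?(ltW n0) ?(ltW h0)// mulrC ler_pM2l//.
have : c / S <= 1 by rewrite ler_pdivrMr// mul1r.
by move: (c / S) => q; lra.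
Qed.

Context {K : hilbertType R} (L : set (projection K)).
Hypothesis Lc : pairwise_comm L.
Local Notation BB := (bicomm L).
Let BBc : pairwise_comm BB := bicomm_comm Lc.
Variables (g : K) (E : projection K) (m : nat) (x y r s : nat -> K) (X Y : nat -> R[i]).
Hypothesis BE : BB E.
Let c := \sum_(0 <= k < m) X k * (Y k)^*%C.
Let S := \sum_(0 <= k < m) (nrm (X k) ^+ 2 + nrm (Y k) ^+ 2).
Let e := nrm c ^+ 2 / (64 * S).
Hypothesis c0 : c <> 0.
Hypothesis cS : nrm c <= S.
Hypothesis X0 : forall k, (m <= k)%N -> X k = 0 /\ Y k = 0.
Hypothesis Ex : forall k, E (x k) = X k *: E g + E (r k).
Hypothesis Ey : forall k, E (y k) = Y k *: E g + E (s k).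
Hypothesis qE : forall F, BB F -> (F <= E)%O -> forall N, qsum r s F N <= e * nrm (F g) ^+ 2.
Hypothesis pr : forall k, cyc L g (r k) = r k.
Hypothesis ps : forall k, cyc L g (s k) = s k.
Variable T : bop K K.
Hypothesis Txy : forall F G, BB F -> BB G ->
  ncvg \oo (fun N => \sum_(0 <= k < N) '[T (F (x k)), G (y k)]) 0.

Let inV (u : K) := E u = u /\ cyc L g u = u.
Let bnd (t : R) := forall u v, inV u -> inV v -> nrm '[T u, v] <= t * nrm u * nrm v.

Let cp : 0 < nrm c.
Proof. by rewrite lt_def nrm_ge0 andbT; apply/eqP => /nrm0_eq0. Qed.

(* With [A g = E u] and [B g = E v], the main term of the vanishing sum of the
   ['[T (A (x k)), B (y k)]] is [c * '[T (E u), E v]]. *)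
Let half_simple t u v : 0 <= t -> bnd t -> simple_vec L g u -> simple_vec L g v ->
  nrm '[T (E u), E v] <= t / 2 * nrm (E u) * nrm (E v).
Proof.
move=> t0 tb gu gv.
(* Applied to one-term sequences: [u] and [v] become multiples of [g] on the same pieces. *)
have [||k|I [F [a' [b' [FB Fs Fo FX _]]]]] := @simple_partition _ _ L Lc g 1
  (fun k => if k is 0%N then u else 0) (fun k => if k is 0%N then v else 0).
- by case.
- by case.
- by case: k.
pose a i := a' i 0%N; pose b i := b' i 0%N.
have Fu i : F i u = a i *: F i g by have [] := FX i 0%N.
have Fv i : F i v = b i *: F i g by have [] := FX i 0%N.
pose G i := pmeet E (F i).
have EF i : pcomm E (F i) by exact: BBc.
have GE i z : G i z = E (F i z) by apply: pmeetE.
have GE' i z : G i z = F i (E z) by rewrite GE EF.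
have GB i : BB (G i) by exact: bicomm_meet.
have GleE i : (G i <= E)%O by exact: pmeetl.
have Go i j z : i != j -> G i (G j z) = 0.
  by move=> ij; rewrite GE (GE' j) Fo// linear0.
pose A z := \sum_i a i *: G i z; pose B z := \sum_i b i *: G i z.
have Eu : E u = A g.
  rewrite -[in LHS](Fs u) linear_sum; apply: eq_bigr => i _.
  by rewrite Fu linearZ/= -GE.
have Ev : E v = B g.
  rewrite -[in LHS](Fs v) linear_sum; apply: eq_bigr => i _.
  by rewrite Fv linearZ/= -GE.
have Ax k : A (x k) = X k *: E u + A (r k).
  rewrite Eu /A scaler_sumr -big_split/=; apply: eq_bigr => i _.
  by rewrite GE' Ex linearP/= -!GE' scalerDr !scalerA mulrC.
have By k : B (y k) = Y k *: E v + B (s k).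
  rewrite Ev /B scaler_sumr -big_split/=; apply: eq_bigr => i _.
  by rewrite GE' Ey linearP/= -!GE' scalerDr !scalerA mulrC.
have lim0 : ncvg \oo (fun N => \sum_(0 <= k < N) '[T (A (x k)), B (y k)]) 0.
  have h : ncvg \oo (fun N => \sum_i \sum_j a i * ((b j)^*%C *
      \sum_(0 <= k < N) '[T (G i (x k)), G j (y k)])) 0.
    have ncvg_sum0 (f : I -> nat -> R[i]) : (forall i, ncvg \oo (f i) 0) ->
        ncvg \oo (fun N => \sum_i f i N) 0.
      move=> hf; suff h l : ncvg \oo (fun N => \sum_(i <- l) f i N) 0 by exact: h.
      elim: l => [|i l IH].
        by apply: ncvg_ext (ncvg_cst 0) => N; rewrite big_nil.
      have z : (0 : R[i]) = 0 + 0 by rewrite addr0.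
      rewrite [X in ncvg _ _ X]z; apply: ncvg_ext (ncvgD (hf i) IH) => N.
      by rewrite big_cons.
    apply: (ncvg_sum0 _ _) => i; apply: (ncvg_sum0 _ _) => j.
    rewrite -[X in ncvg _ _ X](mulr0 (a i)); apply: ncvgM.
    by rewrite -[X in ncvg _ _ X](mulr0 (b j)^*%C); apply: ncvgM; exact: Txy.
  apply: ncvg_ext h => N.
  transitivity (\sum_(0 <= k < N) \sum_i \sum_j a i * ((b j)^*%C * '[T (G i (x k)), G j (y k)])).
    rewrite [RHS]exchange_big/=; apply: eq_bigr => i _.
    rewrite [RHS]exchange_big/=; apply: eq_bigr => j _.
    by rewrite !mulr_sumr.
  apply: eq_bigr => k _.
  have -> : T (A (x k)) = \sum_i T (a i *: G i (x k)) by rewrite /A linear_sum.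
  rewrite inner_suml; apply: eq_bigr => i _.
  rewrite /B inner_sumr; apply: eq_bigr => j _.
  by rewrite [T (_ *: _)]linearZ/= innerZl innerZr.
have pcE : pcomm E (cyc L g) by exact: cyc_comm.
have VA z : cyc L g z = z -> inV (A z).
  move=> pz; split.
    by rewrite linear_sum; apply: eq_bigr => i _; rewrite linearZ/= GE proj_idem.
  rewrite linear_sum; apply: eq_bigr => i _; rewrite linearZ/=.
  by rewrite -(cyc_comm Lc g (GB i)) pz.
have VB z : cyc L g z = z -> inV (B z).
  move=> pz; split.
    by rewrite linear_sum; apply: eq_bigr => i _; rewrite linearZ/= GE proj_idem.
  rewrite linear_sum; apply: eq_bigr => i _; rewrite linearZ/=.
  by rewrite -(cyc_comm Lc g (GB i)) pz.
have Vu : inV (E u) by rewrite Eu; apply: VA; exact: cyc_self.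
have Vv : inV (E v) by rewrite Ev; apply: VB; exact: cyc_self.
(* [qE] holds on each [G i <= E]; summed with the weights [nrm (a i) ^+ 2], it compares the mass of
   the [A (r k)] with that of [A g = E u]. *)
have sumA N : \sum_(0 <= k < N) nrm (A (r k)) ^+ 2 <= e * nrm (E u) ^+ 2.
  rewrite Eu /A (orth_sum_nrm Go) mulr_sumr.
  rewrite (eq_bigr _ (fun k _ => orth_sum_nrm Go a (r k))) exchange_big/=.
  apply: ler_sum => i _; rewrite -mulr_sumr mulrCA ler_wpM2l ?sqr_ge0//.
  apply: le_trans (qE (GB i) (GleE i) N); apply: ler_sum => k _.
  by rewrite lerDl sqr_ge0.
have sumB N : \sum_(0 <= k < N) nrm (B (s k)) ^+ 2 <= e * nrm (E v) ^+ 2.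
  rewrite Ev /B (orth_sum_nrm Go) mulr_sumr.
  rewrite (eq_bigr _ (fun k _ => orth_sum_nrm Go b (s k))) exchange_big/=.
  apply: ler_sum => i _; rewrite -mulr_sumr mulrCA ler_wpM2l ?sqr_ge0//.
  apply: le_trans (qE (GB i) (GleE i) N); apply: ler_sum => k _.
  by rewrite lerDr sqr_ge0.
have [/nrm0_eq0 u0|u0] := eqVneq (nrm (E u)) 0.
  by rewrite u0 linear0 inner0l !nrm0 mulr0 mul0r.
have [/nrm0_eq0 v0|v0] := eqVneq (nrm (E v)) 0.
  by rewrite v0 inner0r !nrm0 mulr0.
have n0 : 0 < nrm (E u) by rewrite lt_def u0 nrm_ge0.
have h0 : 0 < nrm (E v) by rewrite lt_def v0 nrm_ge0.
have S0 : 0 < S by apply: lt_le_trans cS.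
(* The products of the main parts of [A (x k)] and [B (y k)] add up to [c * '[T (E u), E v]]. The
   other terms pair vectors of [inV], so [bnd t] and [weighted_sum] bound them. *)
have bound N : (m <= N)%N -> nrm (c * '[T (E u), E v]) <=
    nrm (\sum_(0 <= k < N) '[T (A (x k)), B (y k)]) + t * (nrm c / 2 * (nrm (E u) * nrm (E v))).
  move=> mN.
  have cE : c = \sum_(0 <= k < N) X k * (Y k)^*%C.
    rewrite (@big_cat_nat _ _ _ m 0 N)//= [X in _ + X]big1_seq ?addr0//.
    by move=> k /andP[_]; rewrite mem_index_iota => /andP[mk _]; rewrite (X0 mk).1 mul0r.
  have SN : \sum_(0 <= k < N) (nrm (X k) ^+ 2 + nrm (Y k) ^+ 2) <= S.
    rewrite (@big_cat_nat _ _ _ m 0 N)//= [X in _ + X]big1_seq ?addr0//.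
    move=> k /andP[_]; rewrite mem_index_iota => /andP[mk _].
    by have [-> ->] := X0 mk; rewrite nrm0 expr0n addr0.
  pose err := \sum_(0 <= k < N) (X k * '[T (E u), B (s k)] +
     (Y k)^*%C * '[T (A (r k)), E v] + '[T (A (r k)), B (s k)]).
  have -> : c * '[T (E u), E v] = \sum_(0 <= k < N) '[T (A (x k)), B (y k)] - err.
    rewrite cE mulr_suml -sumrB; apply: eq_bigr => k _.
    rewrite Ax By [T (_ + _)]linearP/= innerDl !innerDr !innerZl !innerZr.
    by ring.
  apply: le_trans (nrmB _ _) _; rewrite lerD2l.
  apply: le_trans (nrm_sum _ _ _) _.
  apply: le_trans (_ : t * \sum_(0 <= k < N) (nrm (X k) * nrm (B (s k)) * nrm (E u) +
     nrm (Y k) * nrm (A (r k)) * nrm (E v) + nrm (A (r k)) * nrm (B (s k))) <= _); last first.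
    by rewrite ler_wpM2l//; exact: (@weighted_sum _ _ _ _ _ S (nrm c) e).
  rewrite mulr_sumr; apply: ler_sum => k _.
  apply: le_trans (nrmD _ _) _; apply: le_trans (lerD (nrmD _ _) (lexx _)) _.
  rewrite !nrmM nrmJ.
  have b1 := tb _ _ Vu (VB _ (ps k)).
  have b2 := tb _ _ (VA _ (pr k)) Vv.
  have b3 := tb _ _ (VA _ (pr k)) (VB _ (ps k)).
  have b1' := ler_wpM2l (nrm_ge0 (X k)) b1; have b2' := ler_wpM2l (nrm_ge0 (Y k)) b2.
  apply: le_trans (lerD (lerD b1' b2') b3) _.
  by rewrite le_eqVlt; apply/orP; left; apply/eqP; ring.
have lim : nrm (c * '[T (E u), E v]) <= t * (nrm c / 2 * (nrm (E u) * nrm (E v))).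
  rewrite -[leRHS]add0r -lerBlDr -(@nrm0 _ R[i]).
  apply: (cvgr_to_ge (ncvg_nrm lim0)); near=> N; rewrite lerBlDr; apply: bound.
  by near: N; exact: nbhs_infty_ge.
rewrite -(ler_pM2l cp) -nrmM; apply: le_trans lim _.
by rewrite le_eqVlt; apply/orP; left; apply/eqP; ring.
Unshelve. all: by end_near. Qed.

Let inV_approx u : inV u -> exists un : nat -> K,
  (forall n, simple_vec L g (un n)) /\ ncvg \oo (fun n => E (un n)) u.
Proof.
move=> [Eu /cycP pu].
have /choice[un unP] : forall n : nat, exists v, simple_vec L g v /\ nrm (u - v) <= 2^-1 ^+ n.
  move=> n; have n0 : (0 : R) < 2^-1 ^+ n by rewrite exprn_gt0// invr_gt0.
  by have [v] := pu _ n0; exists v.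
exists un; split; first by move=> n; have [] := unP n.
rewrite -Eu; apply: ncvg_bop; apply/ncvgP => d d0.
have [N hN] := @geometric_small R 1 d d0; rewrite mul1r in hN.
exists N => // n /= Nn; rewrite nrm_sub; apply: le_trans (unP n).2 _.
apply: le_trans hN; rewrite ler_wiXn2l ?invr_ge0// invf_le1// ler1n.
by [].
Qed.

Let half t : 0 <= t -> bnd t -> bnd (t / 2).
Proof.
move=> t0 tb u v Vu Vv; have [un [gu Eun]] := inV_approx Vu.
have [vn [gv Evn]] := inV_approx Vv.
have h1 w : simple_vec L g w -> nrm '[T u, E w] <= t / 2 * nrm u * nrm (E w).
  move=> gw; have l1 : nrm '[T (E (un n)), E w] @[n --> \oo] --> nrm '[T u, E w].
    by apply: ncvg_nrm; apply: ncvg_inner; exact: ncvg_bop.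
  have l2 : t / 2 * nrm (E (un n)) * nrm (E w) @[n --> \oo] --> t / 2 * nrm u * nrm (E w).
    by apply: cvgMl; apply: cvgMr; exact: ncvg_nrm.
  by apply: (ler_cvg_to l1 l2); apply: filterE => n; exact: half_simple.
have l1 : nrm '[T u, E (vn n)] @[n --> \oo] --> nrm '[T u, v].
  by apply: ncvg_nrm; exact: ncvg_innerr.
have l2 : t / 2 * nrm u * nrm (E (vn n)) @[n --> \oo] --> t / 2 * nrm u * nrm v.
  by apply: cvgMr; exact: ncvg_nrm.
by apply: (ler_cvg_to l1 l2); apply: filterE => n; exact: h1.
Qed.

(* Writing [t] for the norm of the compression of [T], the hypothesis on [Txy] bounds it by
   [t / 2]. *)
Lemma absorption : '[T (E g), E g] = 0.
Proof.
have [M M0 TM] := bop_bounded T.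
have bn n : bnd (M * 2^-1 ^+ n).
  elim: n => [|n IH].
    move=> u v _ _; rewrite expr0 mulr1; apply: le_trans (inner_le _ _) _.
    by rewrite ler_wpM2r ?nrm_ge0.
  rewrite exprSr mulrA; apply: half => //.
  by rewrite mulr_ge0// exprn_ge0// invr_ge0.
have Vg : inV (E g).
  split; first exact: proj_idem.
  by rewrite -(cyc_comm Lc g BE) cyc_self.
apply: nrm0_eq0; apply/eqP; rewrite eq_le nrm_ge0 andbT.
apply/ler_addgt0Pr => d d0; rewrite add0r.
have [n hn] := @geometric_small R (M * nrm (E g) * nrm (E g)) d d0.
apply: le_trans hn; apply: le_trans (bn n _ _ Vg Vg) _.
by rewrite le_eqVlt; apply/orP; left; apply/eqP; ring.
Qed.

End Absorption.

Section Synthesis.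
Context {R : realType} {K : hilbertType R} (L : set (projection K)).
Hypothesis Lc : pairwise_comm L.
Local Notation BB := (bicomm L).
Let BBc : pairwise_comm BB := bicomm_comm Lc.
Variable N : set (bop K K).
Hypothesis bimodN : forall T P Q, N T -> (forall P', L P' -> pcomm P P') ->
  (forall P', L P' -> pcomm Q P') -> N (compop (P : projection K) (compop T (Q : projection K))).
Hypothesis reflN : forall x, (forall T, N T -> '[T x, x] = 0) -> x = 0.
Variable w : l2_pair K K.
Hypothesis wN : annihilates w N.

Lemma pairing_cyc g : trace_pairing (cyc L g : bop K K) w = 0.
Proof.
apply: contrapT => w0; set p := cyc L g in w0.
pose x k := p (lvec w k); pose y k := p (rvec w k).
have px k : p (x k) = x k by exact: proj_idem.
have py k : p (y k) = y k by exact: proj_idem.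
have xy_cvg : ncvg \oo (fun M => \sum_(0 <= k < M) '[x k, y k])
    (trace_pairing (p : bop K K) w).
  apply: ncvg_ext (pairing_cvg (p : bop K K) w) => M; apply: eq_bigr => k _.
  by rewrite /x /y -[RHS]proj_adj proj_idem.
have [c1 hc1] := lvec_l2 w; have [c2 hc2] := rvec_l2 w.
pose C := c1 + c2.
have xyC M : \sum_(0 <= k < M) (nrm (x k) ^+ 2 + nrm (y k) ^+ 2) <= C.
  rewrite big_split/= lerD//.
    by apply: le_trans (hc1 M); apply: ler_sum => k _; exact: proj_nrm_sqr.
  by apply: le_trans (hc2 M); apply: ler_sum => k _; exact: proj_nrm_sqr.
have C0 : 0 <= C by apply: le_trans (xyC 0%N); rewrite big_geq.
have wp : 0 < nrm (trace_pairing (p : bop K K) w).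
  by rewrite lt_def nrm_ge0 andbT; apply/eqP => /nrm0_eq0.
set om := nrm _ in wp.
have D0 : 0 < 2 + (2 * C + 4) by rewrite addr_gt0// ltr_wpDl// mulr_ge0.
(* Small enough for the conclusion of [pigeonhole] to contradict the size [om] of the functional. *)
have [d [d0 d1 dom]] : exists d : R, [/\ 0 < d, d <= 1 & 5 * d * (2 + (2 * C + 4)) < om].
  exists (Num.min 1 (om / (10 * (2 + (2 * C + 4))))); split.
  - by rewrite lt_min ltr01 divr_gt0// mulr_gt0.
  - by rewrite ge_min lexx.
  - apply: le_lt_trans (_ : 5 * (om / (10 * (2 + (2 * C + 4)))) * (2 + (2 * C + 4)) < _).
      by rewrite ler_pM2r// ler_pM2l// ge_min lexx orbT.
    rewrite (_ : 5 * _ * _ = om / 2); last by field; rewrite gt_eqF.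
    by rewrite ltr_pdivrMr// ltr_pMr// ltr1n.
have d2 : 0 < d ^+ 2 by rewrite exprn_gt0.
have f0 k : 0 <= nrm (x k) ^+ 2 + nrm (y k) ^+ 2 by rewrite addr_ge0 ?sqr_ge0.
have [m hm] := l2bounded_tail f0 xyC d2.
(* The 2m approximation errors then have total mass 2 m eta^2 <= d^2; the tail from [hm] supplies
   the other d^2 of [rs]. *)
pose eta := d / (2 * m + 1)%:R.
have eta0 : 0 < eta by rewrite divr_gt0// ltr0n addn1.
have approx z : p z = z -> exists u, simple_vec L g u /\ nrm (z - u) <= eta.
  by move=> /cycP/(_ _ eta0)[u]; exists u.
have /choice[u' u'P] : forall k, exists u, simple_vec L g u /\ nrm (x k - u) <= eta.
  by move=> k; exact: approx.
have /choice[v' v'P] : forall k, exists u, simple_vec L g u /\ nrm (y k - u) <= eta.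
  by move=> k; exact: approx.
pose u k := if (k < m)%N then u' k else 0; pose v k := if (k < m)%N then v' k else 0.
have su k : simple_vec L g (u k).
  by rewrite /u; case: ifP => _; [have [] := u'P k|exact: simple_vec0].
have sv k : simple_vec L g (v k).
  by rewrite /v; case: ifP => _; [have [] := v'P k|exact: simple_vec0].
have rs M : \sum_(0 <= k < M) (nrm (x k - u k) ^+ 2 + nrm (y k - v k) ^+ 2) <= 2 * d ^+ 2.
  apply: le_trans (psum_le _ (leq_maxr m M)) _; first by move=> k; rewrite addr_ge0 ?sqr_ge0.
  rewrite (@big_cat_nat _ _ _ m)//= ?leq_maxl// (_ : 2 * d ^+ 2 = d ^+ 2 + d ^+ 2); last by ring.
  apply: lerD; last first.
    apply: le_trans (hm _ (leq_maxl m M)); rewrite le_eqVlt; apply/orP; left; apply/eqP.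
    rewrite !big_nat; apply: eq_bigr => k /andP[mk _].
    by rewrite /u /v ltnNge mk !subr0.
  apply: le_trans (_ : \sum_(0 <= k < m) (2 * eta ^+ 2) <= _).
    rewrite !big_nat; apply: ler_sum => k /andP[_ km]; rewrite /u /v km.
    rewrite mulr2n mulrDl !mul1r lerD// ler_pXn2r ?nnegrE ?nrm_ge0 ?(ltW eta0)//.
      by have [] := u'P k.
    by have [] := v'P k.
  have m0 : 0 < (2 * m + 1)%:R :> R by rewrite ltr0n addn1.
  rewrite sumr_const_nat subn0 [leLHS](_ : _ = d ^+ 2 * ((2 * m)%:R / (2 * m + 1)%:R ^+ 2)).
    rewrite ler_piMr ?(ltW d2)// ler_pdivrMr ?exprn_gt0// mul1r -natrX ler_nat.
    by rewrite sqrnD muln1; apply: leq_trans (leq_addl _ _); rewrite leq_pmull.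
  rewrite -[LHS]mulr_natr /eta natrM; move: m0; move: (2 * m + 1)%:R (m%:R : R) => q b q0.
  by field; rewrite gt_eqF.
have [||k mk|I [F [X [Y [FB Fs Fo FX X0]]]]] := @simple_partition _ _ L Lc g m u v.
- by move=> k _; exact: su.
- by move=> k _; exact: sv.
- by rewrite /u /v ltnNge mk.
pose rr k := x k - u k; pose ss k := y k - v k.
(* A piece with light remainders; [hahn_piece] then cuts it to an [E] on whose every part they are
   light. *)
have [i hi] : exists i, qsup rr ss (F i) < rate m X Y i * nrm (F i g) ^+ 2.
  apply: contrapT => hn.
  have heavy i : rate m X Y i * nrm (F i g) ^+ 2 <= qsup rr ss (F i).
    by rewrite leNgt; apply/negP => hi; apply: hn; exists i.
  have h := pigeonhole Fs Fo d0 d1 xyC FX X0 rs heavy.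
  have : om <= 5 * d * (2 + (2 * C + 4)).
    apply: ncvg_le_nrm xy_cvg _; near=> M; apply: h.
    by near: M; exact: nbhs_infty_ge.
  by rewrite leNgt dom.
have [E [BE EF Eg qE]] := hahn_piece Lc rs (FB i) hi.
have c0 : cross m X Y i <> 0.
  move=> ci; move: hi; rewrite /rate ci nrm0 expr0n mul0r mul0r.
  by rewrite ltNge (qsup_ge0 rs).
have Ecoef z a : F i z = a *: F i g -> E z = a *: E g.
  move=> Fz; rewrite -(proj_le_absr z EF) Fz linearZ/=.
  by rewrite (proj_le_absr g EF).
apply: Eg; apply: reflN => T NT.
apply: (@absorption _ _ L Lc g E m x y rr ss (X i) (Y i) BE c0 (cross_le _ _ _ _)).
- exact: X0.
- by move=> k; rewrite -(Ecoef _ _ (FX i k).1) -linearD addrC subrK.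
- by move=> k; rewrite -(Ecoef _ _ (FX i k).2) -linearD addrC subrK.
- exact: qE.
- by move=> k; rewrite linearB/= -/p px cyc_simple.
- by move=> k; rewrite linearB/= -/p py cyc_simple.
move=> G G' BG BG'.
(* [J] meet [p] commutes with [L], so [N] absorbs it; on [lvec w] and [rvec w] it acts as [J] on [x]
   and [y]. Thus [wN] gives the vanishing sums that [absorption] asks for. *)
have commL (J : projection K) : BB J -> forall P', L P' -> pcomm (pmeet J p) P'.
  move=> BJ P' LP'; apply/pcommC/pcomm_inf => _ [->|->].
    by apply: (bicomm_comm Lc) => //; exact: sub_bicomm.
  by apply/pcommC/cyc_commL.
have Gp J z : BB J -> pmeet J p z = J (p z).
  by move=> BJ; apply: pmeetE; exact: cyc_comm.
have := wN (bimodN NT (commL _ BG') (commL _ BG)) => e0.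
rewrite -[X in ncvg _ _ X]e0; apply: ncvg_ext (pairing_cvg _ w) => M.
by rewrite /pairing_sum; apply: eq_bigr => k _; rewrite !compopE [LHS]proj_adj !Gp.
Unshelve. all: by end_near. Qed.

(* Orthogonalising the vectors [lvec w k] against the cyclic projections already
   found exhausts them by orthogonal cyclic projections. *)
Lemma synthesis : trace_pairing (idop K) w = 0.
Proof.
have exhaust n : exists p : projection K, [/\ forall F, BB F -> pcomm p F,
    trace_pairing (p : bop K K) w = 0 & forall k, (k < n)%N -> p (lvec w k) = lvec w k].
  elim: n => [|n [p [pB wp pl]]].
    exists (proj0 K); split=> //; last exact: pairing0.
    by move=> F _ x; rewrite !proj0E linear0.
  pose g := lvec w n - p (lvec w n); pose q := cyc L g.
  have pg : p g = 0 by rewrite linearB/= proj_idem subrr.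
  have pq x : p (q x) = 0 by exact: (cyc_orth pB pg).
  have qp x : q (p x) = 0.
    by apply: inner_eq0P => y; rewrite !proj_adj pq inner0r.
  have cpq : pcomm p q by move=> x; rewrite pq qp.
  have pqE x : pjoin p q x = p x + q x by rewrite pjoinE// pq subr0.
  exists (pjoin p q); split.
  - move=> F BF; apply/pcommC/pcomm_sup => _ [->|->]; first exact/pcommC/pB.
    exact: cyc_comm.
  - have -> : (pjoin p q : bop K K) = 1 *: (p : bop K K) + (q : bop K K).
      by apply: eq_bop => x; rewrite scale1r pqE.
    by rewrite pairingP wp pairing_cyc mulr0 addr0.
  - move=> k; rewrite ltnS leq_eqVlt => /orP[/eqP->|kn]; rewrite pqE.
      have -> : q (lvec w n) = g.
        by rewrite -[lvec w n](subrK (p (lvec w n))) linearD/= qp addr0 cyc_self.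
      by rewrite /g addrC subrK.
    by rewrite -(pl _ kn) qp proj_idem addr0.
have [c1 hc1] := lvec_l2 w; have [c2 hc2] := rvec_l2 w.
pose f k := nrm (lvec w k) ^+ 2 + nrm (rvec w k) ^+ 2.
have f0 k : 0 <= f k by rewrite addr_ge0 ?sqr_ge0.
have fc M : \sum_(0 <= k < M) f k <= c1 + c2 by rewrite big_split/= lerD.
apply: nrm0_eq0; apply/eqP; rewrite eq_le nrm_ge0 andbT.
apply/ler_addgt0Pr => e e0; rewrite add0r.
have [n hn] := l2bounded_tail f0 fc e0.
have [p [_ wp pl]] := exhaust n.
(* [p] fixes the first [n] left vectors, so only the tail of the series contributes to the
   difference. *)
have -> : trace_pairing (idop K) w = trace_pairing (idop K - (p : bop K K)) w.
  by rewrite pairingB wp subr0.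
apply: ncvg_le_nrm (pairing_cvg _ w) _; near=> M.
have nM : (n <= M)%N by near: M; exact: nbhs_infty_ge.
have -> : pairing_sum (idop K - (p : bop K K)) w M =
    \sum_(n <= k < M) '[pcompl p (lvec w k), rvec w k].
  rewrite /pairing_sum (eq_bigr (fun k => '[pcompl p (lvec w k), rvec w k])); last first.
    by move=> k _; rewrite pcomplE.
  rewrite (@big_cat_nat _ _ _ n 0 M)//= [X in X + _]big1_seq ?add0r// => k /andP[_].
  by rewrite mem_index_iota => /andP[_ kn]; rewrite pcomplE pl// subrr inner0l.
apply: le_trans (hn _ nM).
apply: le_trans (nrm_sum _ _ _) _; apply: ler_sum => k _.
apply: le_trans (inner_le _ _) _.
apply: le_trans (ler_wpM2r (nrm_ge0 _) (proj_nrm _ _)) _; rewrite /f.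
move: (nrm_ge0 (lvec w k)) (nrm_ge0 (rvec w k)); move: (nrm _) (nrm _) => a b a0 b0.
have := sqr_ge0 (a - b); have := sqr_ge0 a; have := sqr_ge0 b; rewrite !expr2; lra.
Unshelve. all: by end_near. Qed.

End Synthesis.

Lemma idop_wspan (R : realType) (H K : hilbertType R)
    (L : set (projection H * projection K)) : csl_graph L ->
  wspan (mulset (graph_op L) (graph_op (swap L))) (idop K).
Proof.
move=> gL; have [Lc _ _ _] := gL; apply/wspanP => w wVW.
have Lc' : pairwise_comm (snd @` L).
  by move=> _ _ [[P P'] LP <-] [[Q Q'] LQ <-]; have [] := Lc _ _ _ _ LP LQ.
apply: (synthesis Lc' _ _ wVW).
- move=> _ P Q [V LV [W LW <-]] PL QL.
  exists (compop (P : bop K K) V).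
    move=> P1 P1' LP x; rewrite !compopE -(PL P1'); last by exists (P1, P1').
    by rewrite (LV _ _ LP).
  exists (compop W (Q : bop K K)).
    move=> P1' P1 LP x; rewrite !compopE (QL P1'); last by exists (P1, P1').
    by rewrite (LW _ _ LP).
  exact: eq_bop.
- move=> x hx; apply: nrm0_eq0; apply/eqP; rewrite -sqrf_eq0 nrm_sqrE.
  rewrite (@graph_op_cyclic _ _ _ L x x gL)// => V W LV LW.
  by apply: (hx (compop V W)); exists V => //; exists W.
Qed.

(** * Masas *)

Section Masas.
Context {R : realType} {H : hilbertType R}.
Implicit Types (D : set (bop H H)) (L : set (projection H)).

Definition comm_op D (P : projection H) := forall T, D T -> forall x, T (P x) = P (T x).

Definition op_commutant (A : set (bop H H)) : set (bop H H) :=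
  [set T | forall S, A S -> compop T S = compop S T].

Lemma compopDl (a : R[i]) (S T U : bop H H) :
  compop (a *: S + T) U = a *: compop S U + compop T U.
Proof. exact: eq_bop. Qed.

Lemma compopDr (a : R[i]) (S T U : bop H H) :
  compop U (a *: S + T) = a *: compop U S + compop U T.
Proof. by apply: eq_bop => x; rewrite compopE linearP. Qed.

Lemma compop0l (U : bop H H) : compop (0 : bop H H) U = 0.
Proof. exact: eq_bop. Qed.

Lemma compop0r (U : bop H H) : compop U (0 : bop H H) = 0.
Proof. by apply: eq_bop => x; rewrite compopE linear0. Qed.

Lemma is_adjointC (S T : bop H H) : is_adjoint S T -> is_adjoint T S.
Proof. by move=> ST x y; rewrite innerC -ST -innerC. Qed.

(** The double commutant works: [L] lies in its own commutant, so the double commutant lies there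
    too and is abelian. *)
Lemma bicommutant_abelian L : pairwise_comm L ->
  exists2 D, selfadjoint_abelian D & forall P, L P -> D P.
Proof.
move=> Lc; pose A := [set (P : bop H H) | P in L].
pose C := op_commutant A; exists (op_commutant C); last first.
  by move=> P LP S CS; rewrite CS//; exists P.
have AC : A `<=` C.
  by move=> _ [P LP <-] _ [Q LQ <-]; apply: eq_bop => x; exact: Lc.
have Cadj S S' : C S -> is_adjoint S S' -> C S'.
  move=> CS SS' _ [P LP <-]; apply: eq_bop => x; apply: inner_injr => y.
  rewrite !compopE -SS' -proj_adj.
  have /bopP h := CS _ (ex_intro2 _ _ P LP erefl).
  by rewrite -[P (S y)]/(compop (P : bop H H) S y) -h compopE SS' proj_adj.
split.
- split=> [S _|a S T hS hT U CU]; first by rewrite compop0l compop0r.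
  by rewrite compopDl compopDr hS// hT.
- by move=> _ [S hS [T hT <-]] U CU; rewrite -compopA hT// compopA hS// compopA.
- move=> S' [S hS SS'] T CT; have [T' TT'] := adjoint_exists T.
  apply: eq_bop => x; apply: inner_injr => y; rewrite !compopE.
  rewrite -SS' -(is_adjointC TT') -(is_adjointC TT') -SS'.
  have /bopP/(_ y) := hS _ (Cadj _ _ CT TT'); rewrite !compopE => ->.
  by [].
- by move=> S T hS hT; apply: hS => _ [P LP <-]; apply: hT; apply: AC; exists P.
Qed.

Lemma masa_exists D0 : selfadjoint_abelian D0 -> exists2 D, masa D & D0 `<=` D.
Proof.
move=> sD0.
(* Adjoining [D0] to every member makes the union of the empty chain admissible. *)
pose PP (A : set (bop H H)) := selfadjoint_abelian (D0 `|` A).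
have [F FP Ftot|A [PA Amax]] := @Zorn_bigcup _ PP.
  have pair S T : (D0 `|` \bigcup_(X in F) X) S -> (D0 `|` \bigcup_(X in F) X) T ->
      exists X, [/\ PP X, X `<=` \bigcup_(X in F) X, (D0 `|` X) S & (D0 `|` X) T].
    have P0 : PP set0 by rewrite /PP setU0.
    move=> [hS|[X FX XS]] [hT|[Y FY YT]].
    - by exists set0; split=> //; left.
    - by exists Y; split; [exact: FP|exact: bigcup_sup|left|right].
    - by exists X; split; [exact: FP|exact: bigcup_sup|right|left].
    - have [XY|YX] := Ftot _ _ FX FY.
        by exists Y; split; [exact: FP|exact: bigcup_sup|right; exact: XY|right].
      by exists X; split; [exact: FP|exact: bigcup_sup|right|right; exact: YX].
  have sub X : X `<=` \bigcup_(X in F) X -> D0 `|` X `<=` D0 `|` \bigcup_(X in F) X.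
    by move=> h S [hS|/h hS]; [left|right].
  split.
  - split=> [|a S T hS hT]; first by left; have [[]] := sD0.
    have [X [[[_ XD] _ _ _] /sub h XS XT]] := pair _ _ hS hT.
    by apply: h; exact: XD.
  - move=> _ [S hS [T hT <-]].
    have [X [[_ XM _ _] /sub h XS XT]] := pair _ _ hS hT.
    by apply: h; apply: XM; exists S => //; exists T.
  - move=> S' [S hS SS'].
    have [X [[_ _ XA _] /sub h XS _]] := pair _ _ hS hS.
    by apply: h; apply: XA; exists S.
  - move=> S T hS hT; have [X [[_ _ _ XC] _ XS XT]] := pair _ _ hS hT.
    exact: XC.
exists (D0 `|` A); last by move=> S hS; left.
split=> // D' sD' DD' S D'S; right.
have AD' : A `<=` D' by move=> T AT; apply: DD'; right.
apply: contrapT => nAS; apply: (Amax D').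
  by split=> // h; apply: nAS; exact: h.
by rewrite /PP setUidr// => T D0T; apply: DD'; left.
Qed.

(** The definition of a masa does not ask for a unit; adding the scalars keeps the algebra
    selfadjoint and abelian, so maximality provides it. It makes one-sided multiplications available
    in [bl_rel_stable]. *)
Lemma masa_id D : masa D -> D (idop H).
Proof.
move=> [[[D0 DD] DM DA DC] Dmax].
pose D' := [set T | exists a S, D S /\ T = a *: idop H + S].
have DD' : D `<=` D' by move=> S DS; exists 0, S; rewrite scale0r add0r.
apply: (Dmax D') => //; last by exists 1, 0; rewrite scale1r addr0.
have E (a : R[i]) (S : bop H H) x : (a *: idop H + S) x = a *: x + S x by [].
have DZ a S : D S -> D (a *: S) by move=> DS; rewrite -[_ *: _]addr0; exact: DD.
have DA' S T : D S -> D T -> D (S + T) by move=> DS DT; rewrite -[S]scale1r; exact: DD.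
split.
- split=> [|c _ _ [a [S [DS ->]]] [b [T [DT ->]]]].
    by exists 0, 0; rewrite scale0r addr0.
  exists (c * a + b), (c *: S + T); split; first exact: DD.
  by rewrite scalerDr scalerA addrACA -scalerDl.
- move=> _ [_ [a [S [DS ->]]] [_ [b [T [DT ->]]] <-]].
  exists (a * b), (a *: T + (b *: S + compop S T)); split.
    apply: (DD _ _ _ DT); apply: (DD _ _ _ DS); apply: DM.
    by exists S => //; exists T.
  apply: eq_bop => x; rewrite compopE !E [S (_ + _)]linearP/= scalerDr scalerA.
  by rewrite -!addrA.
- move=> T' [_ [a [S [DS ->]]] h]; have [S' SS'] := adjoint_exists S.
  exists (a^*)%C, S'; split; first by apply: DA; exists S.
  apply: eq_bop => y; apply: inner_injr => x.
  by rewrite -h !E innerDl innerDr innerZl innerZr conjcK SS'.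
- move=> _ _ [a [S [DS ->]]] [b [T [DT ->]]]; apply: eq_bop => x.
  have /bopP/(_ x) ST := DC _ _ DS DT; rewrite !compopE in ST.
  rewrite !compopE !E [S (_ + _)]linearP [T (_ + _)]linearP/= !scalerDr !scalerA ST (mulrC a).
  by rewrite -!addrA; congr (_ + _); rewrite addrCA.
Qed.

End Masas.

(** * Reduced pairs of a bilattice isomorphism *)

Section Bilattices.
Context {R : realType} {H K : hilbertType R}.
Implicit Type S : set (projection H * projection K).

Lemma infimums_meet (V : hilbertType R) (P Q : projection V) :
  infimums [set P; Q] (pmeet P Q).
Proof. exact/infimumsP. Qed.

Lemma supremums_join (V : hilbertType R) (P Q : projection V) :
  supremums [set P; Q] (pjoin P Q).
Proof. exact/supremumsP. Qed.

Lemma strongly_closed_limit S (p : nat -> projection H) (q : nat -> projection K)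
    (P : projection H) (Q : projection K) :
  strongly_closed S -> (forall n, S (p n, q n)) ->
  (forall x, ncvg \oo (fun n => p n x) (P x)) ->
  (forall y, ncvg \oo (fun n => q n y) (Q y)) -> S (P, Q).
Proof.
move=> clS Spq pP qQ.
have pc : (fun n => (p n : bop H H) : sot H H) @ \oo --> ((P : bop H H) : sot H H).
  by apply: initial_ptws_cvg => x; apply/cvg_ncvg; exact: pP.
have qc : (fun n => (q n : bop K K) : sot K K) @ \oo --> ((Q : bop K K) : sot K K).
  by apply: initial_ptws_cvg => x; apply/cvg_ncvg; exact: qQ.
have pqc : (fun n => ((p n : bop H H) : sot H H, (q n : bop K K) : sot K K)) @ \oo -->
    ((P : bop H H) : sot H H, (Q : bop K K) : sot K K).
  exact: cvg_pair pc qc.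
have [|[P' Q'] SPQ [/val_inj <- /val_inj <-]//] := closed_cvg _ clS _ _ pqc.
by apply: nearW => n; exists (p n, q n).
Qed.

Lemma bilattice_bilat S :
  is_bilattice S -> bl_commutative S -> strongly_closed S -> bilat S.
Proof.
move=> [S00 S10 S01 Sm] [cl cr] clS; split.
- move=> P P' Q Q' SP SP'; split=> x.
    have /bopP/(_ x) := cl P P' (ex_intro2 _ _ _ SP erefl) (ex_intro2 _ _ _ SP' erefl).
    by rewrite !compopE.
  have /bopP/(_ x) := cr Q Q' (ex_intro2 _ _ _ SP erefl) (ex_intro2 _ _ _ SP' erefl).
  by rewrite !compopE.
- by [].
- move=> P P' Q Q' SP SP'; split.
    have [h _] := Sm _ _ _ _ SP SP' (pmeet P P') (pjoin Q Q').
    by apply: h; [exact: infimums_meet|exact: supremums_join].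
  have [_ h] := Sm _ _ _ _ SP SP' (pjoin P P') (pmeet Q Q').
  by apply: h; [exact: supremums_join|exact: infimums_meet].
- move=> p q Spq pd qi; apply: (strongly_closed_limit clS Spq) => x.
    exact: pinf_cvg.
  exact: psup_cvg.
- move=> p q Spq pd qi; apply: (strongly_closed_limit clS Spq) => x.
    exact: psup_cvg.
  exact: pinf_cvg.
Qed.

Definition bl_rel S (u : H) (v : K) := exists P Q, [/\ S (P, Q), P u = u & Q v = v].

(** The two sides have complementary virtues: the isomorphism transports the pairs of [S], while
    orthogonality to all [T u] is linear and closed in each variable and stable under the masas. *)
Lemma bl_relP S u v : bilat S ->
  bl_rel S u v <-> forall T, bl_space S T -> '[T u, v] = 0.
Proof.
move=> bS; split=> [[P [Q [SPQ Pu Qv]]] T ST|h]; last exact: bl_space_reflexive.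
by rewrite -Pu -Qv -proj_adj -[Q _]/(compop (compop Q T) P u) ST// bop0E inner0l.
Qed.

Lemma bl_rel_left S v : bilat S -> exists P : projection H, forall u, bl_rel S u v <-> P u = u.
Proof.
move=> bS; apply: (@proj_exists _ _ [set u | bl_rel S u v]).
  split=> [|a x y /(bl_relP _ _ bS) hx /(bl_relP _ _ bS) hy]; apply/(bl_relP _ _ bS) => T ST.
    by rewrite linear0 inner0l.
  by rewrite linearP/= innerDl innerZl hx// hy// mulr0 addr0.
move=> u l hu ul; apply/(bl_relP _ _ bS) => T ST.
apply: (ncvg_unique (F := \oo) (u := fun n => '[T (u n), v])).
  by apply: ncvg_inner; exact: ncvg_bop.
apply: ncvg_ext (ncvg_cst 0) => n.
by have /(bl_relP _ _ bS) -> := hu n.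
Qed.

Lemma bl_rel_right S u : bilat S -> exists Q : projection K, forall v, bl_rel S u v <-> Q v = v.
Proof.
move=> bS; apply: (@proj_exists _ _ [set v | bl_rel S u v]).
  split=> [|a x y /(bl_relP _ _ bS) hx /(bl_relP _ _ bS) hy]; apply/(bl_relP _ _ bS) => T ST.
    by rewrite inner0r.
  by rewrite innerDr innerZr hx// hy// mulr0 addr0.
move=> v l hv vl; apply/(bl_relP _ _ bS) => T ST.
apply: (ncvg_unique (F := \oo) (u := fun n => '[T u, v n])).
  exact: ncvg_innerr.
apply: ncvg_ext (ncvg_cst 0) => n.
by have /(bl_relP _ _ bS) -> := hv n.
Qed.

End Bilattices.

Section Isomorphisms.
Context {R : realType}.
Implicit Types H K : hilbertType R.

Section OneMap.
Context {H K : hilbertType R} (L : set (projection H)) (M : set (projection K)).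
Variable phi : projection H -> projection K.
Hypothesis hphi : csl_hom L M phi.
Hypothesis bphi : set_bij L M phi.

Lemma csl_inf (F : set (projection H)) : F `<=` L -> L (pinf F).
Proof.
by have [[_ _ _ Lc] _ _ _] := hphi => FL; apply: (Lc F _ FL); right; exact/infimumsP.
Qed.

Lemma csl_sup (F : set (projection H)) : F `<=` L -> L (psup F).
Proof.
by have [[_ _ _ Lc] _ _ _] := hphi => FL; apply: (Lc F _ FL); left; exact/supremumsP.
Qed.

Lemma csl_hom_inf (F : set (projection H)) : F `<=` L -> phi (pinf F) = pinf (phi @` F).
Proof.
have [_ _ _ h] := hphi => FL; have [_ hi] := h F (pinf F) FL.
by apply/infimumsP/hi/infimumsP.
Qed.

Lemma csl_hom_sup (F : set (projection H)) : F `<=` L -> phi (psup F) = psup (phi @` F).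
Proof.
have [_ _ _ h] := hphi => FL; have [hs _] := h F (psup F) FL.
by apply/supremumsP/hs/supremumsP.
Qed.

(** [P <= Q] is an equation between meets, so injectivity reflects the order. *)
Lemma csl_hom_le P Q : L P -> L Q -> (P <= Q)%O = (phi P <= phi Q)%O.
Proof.
move=> LP LQ; have [_ phiI _] := bphi.
have PQL : [set P; Q] `<=` L by move=> _ [->|->].
have E : phi (pmeet P Q) = pmeet (phi P) (phi Q).
  by rewrite /pmeet csl_hom_inf// image_setU !image_set1.
have meet_le (V : hilbertType R) (A B : projection V) : (A <= B)%O <-> pmeet A B = A.
  split=> [AB|<-]; last exact: pmeetr.
  by apply: proj_le_anti; [exact: pmeetl|apply: le_pinf => _ [->|->]].
apply/idP/idP => /meet_le h; apply/meet_le; first by rewrite -E h.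
by apply: phiI; rewrite ?inE//; [exact: csl_inf|rewrite E].
Qed.

(** Keeping only pairs that commute with the masas makes the graph operators bimodules over them;
    the cut survives infima and suprema. *)
Definition iso_graph (D : set (bop H H)) (E : set (bop K K)) :
    set (projection H * projection K) :=
  [set pq | [/\ L pq.1, pq.2 = phi pq.1, comm_op D pq.1 & comm_op E pq.2]].

Lemma iso_graph_csl D E : csl_graph (iso_graph D E).
Proof.
have [[Lc _ _ _] [Mc _ _ _] LM _] := hphi.
have cop (V : hilbertType R) (A B : projection V) :
    compop (A : bop V V) (B : bop V V) = compop (B : bop V V) (A : bop V V) -> pcomm A B.
  by move=> /bopP h x; have := h x.
split=> /=.
- move=> P P' Q Q' [LP /= -> _ _] [LQ /= -> _ _].
  by split; apply: cop; [exact: Lc|apply: Mc; exact: LM].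
- move=> F FG; have FL : fst @` F `<=` L by move=> _ [pq /FG[h _ _ _] <-].
  have E1 : phi @` (fst @` F) = snd @` F.
    apply/seteqP; split=> [_ [_ [pq Fpq <-] <-]|_ [pq Fpq <-]].
      by exists pq => //; have [_ ->] := FG _ Fpq.
    by exists pq.1; [exists pq|have [_ ->] := FG _ Fpq].
  split=> /=; first exact: csl_inf.
  - by rewrite csl_hom_inf// E1.
  - move=> T DT; have [T' TT'] := adjoint_exists T; apply: (pinf_commute TT').
    by move=> _ [pq /FG[_ _ h _] <-]; exact: h.
  - move=> T DT; have [T' TT'] := adjoint_exists T; apply: (pinf_commute TT').
    by move=> _ [pq /FG[_ _ _ h] <-]; exact: h.
- move=> F FG; have FL : fst @` F `<=` L by move=> _ [pq /FG[h _ _ _] <-].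
  have E1 : phi @` (fst @` F) = snd @` F.
    apply/seteqP; split=> [_ [_ [pq Fpq <-] <-]|_ [pq Fpq <-]].
      by exists pq => //; have [_ ->] := FG _ Fpq.
    by exists pq.1; [exists pq|have [_ ->] := FG _ Fpq].
  split=> /=; first exact: csl_sup.
  - by rewrite csl_hom_sup// E1.
  - move=> T DT; have [T' TT'] := adjoint_exists T; apply: (psup_commute TT').
    by move=> _ [pq /FG[_ _ h _] <-]; exact: h.
  - move=> T DT; have [T' TT'] := adjoint_exists T; apply: (psup_commute TT').
    by move=> _ [pq /FG[_ _ _ h] <-]; exact: h.
- move=> P P' Q Q' [LP /= -> _ _] [LQ /= -> _ _]; exact: csl_hom_le.
Qed.

End OneMap.

(** [Q T P = 0] puts the range of [T P] in the kernel of [Q]; on the right it is these kernels that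
    have to be intertwined. *)
Definition compl_graph H K (L : set (projection H * projection K)) :
    set (projection H * projection K) :=
  [set pq | L (pcompl pq.1, pcompl pq.2)].

Lemma compl_graph_csl H K (L : set (projection H * projection K)) :
  csl_graph L -> csl_graph (compl_graph L).
Proof.
move=> [Lc Li Ls Lo]; split=> /=.
- move=> P P' Q Q' LP LQ; have [h1 h2] := Lc _ _ _ _ LP LQ.
  have cc (V : hilbertType R) (A B : projection V) : pcomm (pcompl A) (pcompl B) -> pcomm A B.
    move=> h; have := pcomm_compl (pcommC (pcomm_compl h)).
    by rewrite !pcomplK => /pcommC.
  by split; exact: cc.
- move=> F FL; rewrite /compl_graph/= !pcompl_pinf.
  have -> : [set pcompl P | P in [set pq.1 | pq in F]] =
    [set pq.1 | pq in [set (pcompl pq.1, pcompl pq.2) | pq in F]] by rewrite !image_comp.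
  have -> : [set pcompl P | P in [set pq.2 | pq in F]] =
    [set pq.2 | pq in [set (pcompl pq.1, pcompl pq.2) | pq in F]] by rewrite !image_comp.
  by apply: Ls => _ [pq Fpq <-]; exact: FL.
- move=> F FL; rewrite /compl_graph/= !pcompl_psup.
  have -> : [set pcompl P | P in [set pq.1 | pq in F]] =
    [set pq.1 | pq in [set (pcompl pq.1, pcompl pq.2) | pq in F]] by rewrite !image_comp.
  have -> : [set pcompl P | P in [set pq.2 | pq in F]] =
    [set pq.2 | pq in [set (pcompl pq.1, pcompl pq.2) | pq in F]] by rewrite !image_comp.
  by apply: Li => _ [pq Fpq <-]; exact: FL.
- move=> P P' Q Q' LP LQ; rewrite -(le_pcomplE P Q) -(le_pcomplE P' Q').
  exact: Lo.
Qed.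

(* The witness is the supremum of all [P] such that [Q] is covered by the right
   entries of those pairs of [S1] whose left entry dominates [P]; this condition is
   transported by the isomorphism, unlike a condition on vectors. *)
Lemma reduced_projection H1 H2 K1 K2 (S1 : set (projection H1 * projection H2))
    (S2 : set (projection K1 * projection K2))
    (L1 : set (projection H1)) (M1 : set (projection K1))
    (L2 : set (projection H2)) (M2 : set (projection K2)) phi psi Q :
  bilat S1 -> bilat S2 ->
  csl_hom L1 M1 phi -> set_bij L1 M1 phi -> csl_hom L2 M2 psi -> set_bij L2 M2 psi ->
  (forall pq, S1 pq -> L1 pq.1 /\ L2 pq.2) ->
  (forall P' Q', S2 (P', Q') <-> exists P Q, [/\ S1 (P, Q), P' = phi P & Q' = psi Q]) ->
  L2 Q ->
  exists P, [/\ L1 P, forall u, P u = u <-> forall v, Q v = v -> bl_rel S1 u v &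
    forall u, phi P u = u <-> forall v, psi Q v = v -> bl_rel S2 u v].
Proof.
move=> b1 b2 hphi bphi hpsi bpsi S1L S12 LQ.
pose PP := [set P | L1 P /\ exists F, [/\ F `<=` S1, forall pq, F pq -> (P <= pq.1)%O &
  (Q <= psup (snd @` F))%O]].
have PPL : PP `<=` L1 by move=> P [].
have LPP : L1 (psup PP) := csl_sup hphi PPL.
exists (psup PP).
have F1L F : F `<=` S1 -> fst @` F `<=` L1 by move=> FS _ [pq /FS/S1L[h _] <-].
have F2L F : F `<=` S1 -> snd @` F `<=` L2 by move=> FS _ [pq /FS/S1L[_ h] <-].
split=> // u; split.
- move=> Pu v Qv; have [M MP] := bl_rel_left v b1; apply/MP.
  suff : (psup PP <= M)%O by move=> /proj_leP; exact.
  apply: psup_le => P [LP [F [FS FP QF]]]; apply/proj_leP => u' Pu'; apply/MP.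
  have [N NP] := bl_rel_right u' b1; apply/NP.
  have : (psup (snd @` F) <= N)%O.
    apply: psup_le => _ [[P1 Q1] Fpq <-]; apply/proj_leP => v' Q1v'; apply/NP.
    exists P1, Q1; split=> //; first exact: FS.
    by have /proj_leP := FP _ Fpq; exact.
  by move=> /(le_trans QF) /proj_leP; exact.
(* The infimum of the left entries of all pairs fixing [u] is in [PP], with [F] as witness: every
   [v] fixed by [Q] lies under the right entry of a pair of [F]. *)
- move=> h; pose F := [set pq | S1 pq /\ pq.1 u = u].
  have FS : F `<=` S1 by move=> pq [].
  have PPi : PP (pinf (fst @` F)).
    split; first by apply: (csl_inf hphi); exact: F1L.
    exists F; split=> // [pq Fpq|]; first by apply: pinf_le; exists pq.
    apply/proj_leP => v Qv; have [P1 [Q1 [S1PQ P1u Q1v]]] := h _ Qv.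
    have /proj_leP : (Q1 <= psup (snd @` F))%O by apply: le_psup; exists (P1, Q1).
    exact.
  have /proj_leP := le_psup PPi; apply.
  by apply/pinfP => _ [pq [_ h1] <-].
- rewrite (csl_hom_sup hphi)// => Pu v Qv; have [M MP] := bl_rel_left v b2; apply/MP.
  suff : (psup (phi @` PP) <= M)%O by move=> /proj_leP; exact.
  apply: psup_le => _ [P [LP [F [FS FP QF]]] <-]; apply/proj_leP => u' Pu'; apply/MP.
  have [N NP] := bl_rel_right u' b2; apply/NP.
  have : (psup (psi @` (snd @` F)) <= N)%O.
    apply: psup_le => _ [_ [[P1 Q1] Fpq <-] <-]; apply/proj_leP => v' Q1v'; apply/NP.
    exists (phi P1), (psi Q1); split=> //.
      by apply/S12; exists P1, Q1; split=> //; exact: FS.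
    have := FP _ Fpq; rewrite (csl_hom_le hphi bphi)//; last by have [] := S1L _ (FS _ Fpq).
    by move=> /proj_leP; exact.
  rewrite -(csl_hom_sup hpsi); last exact: F2L.
  move: QF; rewrite (csl_hom_le hpsi bpsi)//; last by apply: (csl_sup hpsi); exact: F2L.
  by move=> QF /(le_trans QF) /proj_leP; exact.
- move=> h; pose F := [set pq | S1 pq /\ phi pq.1 u = u].
  have FS : F `<=` S1 by move=> pq [].
  have FL1 := F1L _ FS; have FL2 := F2L _ FS.
  have PPi : PP (pinf (fst @` F)).
    split; first exact: (csl_inf hphi).
    exists F; split=> // [pq Fpq|]; first by apply: pinf_le; exists pq.
    rewrite (csl_hom_le hpsi bpsi)//; last exact: (csl_sup hpsi).
    rewrite (csl_hom_sup hpsi)//.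
    apply/proj_leP => v Qv; have [P' [Q' [S2PQ P'u Q'v]]] := h _ Qv.
    have [P1 [Q1 [S1PQ eP eQ]]] := (S12 _ _).1 S2PQ; subst P' Q'.
    have /proj_leP : (psi Q1 <= psup (psi @` (snd @` F)))%O.
      by apply: le_psup; exists Q1 => //; exists (P1, Q1).
    exact.
  have : (phi (pinf (fst @` F)) <= phi (psup PP))%O.
    by rewrite -(csl_hom_le hphi bphi)//; [exact: le_psup|exact: (csl_inf hphi)].
  move=> /proj_leP; apply; rewrite (csl_hom_inf hphi)//.
  by apply/pinfP => _ [_ [pq [_ h1] <-] <-].
Qed.

End Isomorphisms.

(** * Morita equivalence *)

Section GraphBimodules.
Context {R : realType} {H K : hilbertType R} (L : set (projection H * projection K)).
Implicit Types (D : set (bop H H)) (E : set (bop K K)).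

Lemma graph_op_subspace : op_subspace (graph_op L).
Proof.
split=> [P P' _ x|a V W LV LW P P' LP x]; first by rewrite bop0E linear0.
by rewrite bopDE bopZE linearP/= (LV _ _ LP) (LW _ _ LP).
Qed.

Lemma graph_op_bimodule D E :
  (forall P P', L (P, P') -> comm_op D P /\ comm_op E P') -> bimodule E D (graph_op L).
Proof.
move=> LDE; split=> [|_ [_ [A EA [V LV <-]] [B DB <-]] P P' LP x].
  exact: graph_op_subspace.
have [DP EP] := LDE _ _ LP; rewrite !compopE.
by rewrite (DP _ DB) -(EP _ EA) (LV _ _ LP).
Qed.

Lemma graph_op_unital : csl_graph L ->
  unital_algebra (wspan (mulset (graph_op L) (graph_op (swap L)))).
Proof.
move=> gL; split; first exact: wspan_subspace; last exact: idop_wspan.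
apply: wspan_mulset => _ [_ [V LV [W LW <-]] [_ [V' LV' [W' LW' <-]] <-]].
apply: sub_wspan; exists V => //; exists (compop W (compop V' W')); last exact: eq_bop.
move=> P' P LP x; rewrite !compopE.
by rewrite -(LW' _ _ LP) -(LV' _ _ LP) (LW _ _ LP).
Qed.

End GraphBimodules.

Section Conjugation.
Context {R : realType} {H1 H2 K1 K2 : hilbertType R}.
Context (L1 : set (projection H1 * projection K1)) (L2 : set (projection H2 * projection K2)).

(** [W] maps the range of [A'] into that of [A], [T] maps this into the kernel of [B], and [V] maps
    that into the kernel of [B']. Domination by [(A', B')] gives the condition for [(P', Q')]. *)
Lemma graph_op_conj (S1 : set (projection H1 * projection H2))
    (S2 : set (projection K1 * projection K2)) :
  (forall P' Q', S2 (P', Q') -> exists A A' B B', [/\ L1 (A, A'), L2 (pcompl B, pcompl B'),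
    (P' <= A')%O, (Q' <= B')%O & forall T, bl_space S1 T -> forall x, B (T (A x)) = 0]) ->
  mulset (mulset (graph_op L2) (bl_space S1)) (graph_op (swap L1)) `<=` bl_space S2.
Proof.
move=> S2L _ [_ [V LV [T ST <-]] [W LW <-]] P' Q' /S2L[A [A' [B [B' [LA LB PA QB BTA]]]]].
apply: eq_bop => x; rewrite !compopE bop0E -(proj_le_absl _ PA) -(LW _ _ LA).
set y := T _; have /pcompl_id <- : B y = 0 by exact: BTA.
rewrite -(LV _ _ LB); apply: ((proj_le0P _ _).1 QB).
by apply/pcompl_id; exact: proj_idem.
Qed.

Lemma wspan_conj (U1 : set (bop H1 H2)) (U2 : set (bop K1 K2)) :
  csl_graph L1 -> csl_graph L2 -> wspan U1 `<=` U1 ->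
  mulset (mulset (graph_op L2) U1) (graph_op (swap L1)) `<=` U2 ->
  mulset (mulset (graph_op (swap L2)) U2) (graph_op L1) `<=` U1 ->
  U1 = wspan (mulset (mulset (graph_op (swap L2)) U2) (graph_op L1)).
Proof.
move=> gL1 gL2 U1cl U12 U21; apply/seteqP; split=> [T U1T|T]; last first.
  move=> hT; apply: U1cl; apply: (wspan_min _ hT) => S /U21; exact: sub_wspan.
(* The identity on the left is replaced by W2 V2, then the one on the right by W1 V1, and the
   product is regrouped as W2 (V2 T W1) V1. *)
rewrite -(compop_idl T).
apply: (wspan_compopr (X := mulset (graph_op (swap L2)) (graph_op L2))); last first.
  exact: (idop_wspan (csl_graph_swap gL2)).
move=> _ [W2 LW2 [V2 LV2 <-]]; rewrite -(compop_idr (compop _ T)).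
apply: (wspan_compopl (X := mulset (graph_op (swap L1)) (graph_op L1))); last first.
  exact: (idop_wspan (csl_graph_swap gL1)).
move=> _ [W1 LW1 [V1 LV1 <-]]; apply: sub_wspan.
exists (compop W2 (compop (compop V2 T) W1)).
  exists W2 => //; exists (compop (compop V2 T) W1) => //.
  by apply: U12; exists (compop V2 T); [exists V2 => //; exists T|exists W1].
by exists V1 => //; exact: eq_bop.
Qed.

End Conjugation.

Section Stability.
Context {R : realType}.
Implicit Types H K : hilbertType R.

Lemma comm_op_stable H (D : set (bop H H)) (P : projection H) : selfadjoint_abelian D ->
  (forall T, D T -> forall x, P x = x -> P (T x) = T x) -> comm_op D P.
Proof.
move=> [_ _ Dadj _] DP T DT; have [T' TT'] := adjoint_exists T.
by apply: (proj_commute TT'); apply: DP => //; apply: Dadj; exists T.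
Qed.

(** Elements of the masas are absorbed by the space, and [bl_relP] carries this over to vectors. *)
Lemma bl_rel_stable H K (S : set (projection H * projection K)) D E :
  bilat S -> masa D -> masa E -> bimodule E D (bl_space S) -> forall u v, bl_rel S u v ->
  (forall T, D T -> bl_rel S (T u) v) /\ (forall T, E T -> bl_rel S u (T v)).
Proof.
move=> bS mD mE [_ ED] u v /(bl_relP _ _ bS) uv.
split=> T hT; apply/(bl_relP _ _ bS) => A SA.
  rewrite -[A _]/(compop (compop (idop K) A) T u); apply: uv; apply: ED.
  exists (compop (idop K) A); last by exists T.
  by exists (idop K); [exact: masa_id|exists A].
have [T' TT'] := adjoint_exists T.
rewrite -(is_adjointC TT') -[T' _]/(compop (compop T' A) (idop H) u); apply: uv; apply: ED.
exists (compop T' A); last by exists (idop H) => //; exact: masa_id.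
exists T'; last by exists A.
by have [[_ _ Eadj _] _] := mE; apply: Eadj; exists T.
Qed.

Lemma swap_bilat H K (S : set (projection H * projection K)) : bilat S -> bilat (swap S).
Proof.
move=> [Sc [S01 S10] Sm Sd Si]; split=> //.
- by move=> P P' Q Q' SP SP'; have [] := Sc _ _ _ _ SP SP'.
- by move=> P P' Q Q' SP SP'; have [] := Sm _ _ _ _ SP SP'.
- by move=> p q Spq pd qi; exact: Si.
- by move=> p q Spq pd qi; exact: Sd.
Qed.

Lemma bl_rel_swap H K (S : set (projection H * projection K)) u v :
  bl_rel (swap S) v u <-> bl_rel S u v.
Proof. by split=> -[P [Q [SPQ Pu Qv]]]; exists Q, P. Qed.

End Stability.

Section Isomorphism.
Context {R : realType} {H1 H2 K1 K2 : hilbertType R}.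
Context (S1 : set (projection H1 * projection H2)) (S2 : set (projection K1 * projection K2)).
Context (phi : projection H1 -> projection K1) (psi : projection H2 -> projection K2).
Hypotheses (b1 : bilat S1) (b2 : bilat S2) (S12 : bl_isom S1 S2 phi psi).

Lemma bl_isomE P' Q' :
  S2 (P', Q') <-> exists P Q, [/\ S1 (P, Q), P' = phi P & Q' = psi Q].
Proof.
have [[_ _ hS] _ _ [_ _ surj]] := S12; split=> [/surj[[P Q] SPQ [<- <-]]|].
  by exists P, Q.
by move=> [P [Q [SPQ -> ->]]]; exact: hS.
Qed.

Context (D1 : set (bop H1 H1)) (D2 : set (bop H2 H2)).
Context (E1 : set (bop K1 K1)) (E2 : set (bop K2 K2)).
Hypotheses (mD1 : masa D1) (mD2 : masa D2) (mE1 : masa E1) (mE2 : masa E2).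
Hypotheses (bU1 : bimodule D2 D1 (bl_space S1)) (bU2 : bimodule E2 E1 (bl_space S2)).

Definition left_graph := iso_graph (bl_left S1) phi D1 E1.
Definition right_graph := compl_graph (iso_graph (bl_right S1) psi D2 E2).

(** [A] is the largest projection related to [Q], then [B] the largest related to [A]. Being
    described through [bl_rel], both are stable under the masas, and by [reduced_projection] the
    same holds of their images. *)
Lemma reduced_pair P Q : S1 (P, Q) -> exists A B,
  [/\ left_graph (A, phi A) /\ right_graph (pcompl B, pcompl (psi B)),
    (P <= A)%O /\ (phi P <= phi A)%O, (Q <= B)%O /\ (psi Q <= psi B)%O,
    forall T, bl_space S1 T -> forall x, B (T (A x)) = 0 &
    forall T, bl_space S2 T -> forall x, psi B (T (phi A x)) = 0].
Proof.
move=> SPQ; have [[hphi hpsi hS] bphi bpsi _] := S12.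
have S1L pq : S1 pq -> bl_left S1 pq.1 /\ bl_right S1 pq.2 by move=> Spq; split; exists pq.
have [LP LQ] := S1L _ SPQ.
have [A [LA A1 A2]] := reduced_projection b1 b2 hphi bphi hpsi bpsi S1L bl_isomE LQ.
have [B [LB B1 B2]] : exists B, [/\ bl_right S1 B,
    forall v, B v = v <-> forall u, A u = u -> bl_rel (swap S1) v u &
    forall v, psi B v = v <-> forall u, phi A u = u -> bl_rel (swap S2) v u].
  apply: (reduced_projection (swap_bilat b1) (swap_bilat b2) hpsi bpsi hphi bphi) => //.
    by move=> [Q1 P1] /S1L[].
  move=> Q1 P1; rewrite /swap/=; split=> [/bl_isomE[P2 [Q2 [SPQ2 -> ->]]]|[Q2 [P2 [SPQ2 -> ->]]]].
    by exists Q2, P2.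
  by apply/bl_isomE; exists P2, Q2.
have PA : (P <= A)%O by apply/proj_leP => u Pu; apply/A1 => v Qv; exists P, Q.
have QB : (Q <= B)%O.
  by apply/proj_leP => v Qv; apply/B1 => u /A1 h; apply/bl_rel_swap; exact: h.
have kill H K (S : set (projection H * projection K)) (A0 : projection H) (B0 : projection K) :
    bilat S ->
    (forall v, B0 v = v <-> forall u, A0 u = u -> bl_rel (swap S) v u) ->
    forall T, bl_space S T -> forall x, B0 (T (A0 x)) = 0.
  move=> bS hB T ST x; apply: inner_eq0P => y; rewrite proj_adj.
  have /hB/(_ _ (proj_idem A0 x)) := proj_idem B0 y.
  by move=> /bl_rel_swap /(bl_relP _ _ bS); exact.
exists A, B; split.
- split; split=> //=; rewrite ?pcomplK//.
  + apply: comm_op_stable; first by have [] := mD1.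
    move=> T DT u /A1 h; apply/A1 => v /h uv.
    by have [+ _] := bl_rel_stable b1 mD1 mD2 bU1 uv; exact.
  + apply: comm_op_stable; first by have [] := mE1.
    move=> T DT u /A2 h; apply/A2 => v /h uv.
    by have [+ _] := bl_rel_stable b2 mE1 mE2 bU2 uv; exact.
  + apply: comm_op_stable; first by have [] := mD2.
    move=> T DT v /B1 h; apply/B1 => u /h /bl_rel_swap uv; apply/bl_rel_swap.
    by have [_] := bl_rel_stable b1 mD1 mD2 bU1 uv; exact.
  + apply: comm_op_stable; first by have [] := mE2.
    move=> T DT v /B2 h; apply/B2 => u /h /bl_rel_swap uv; apply/bl_rel_swap.
    by have [_] := bl_rel_stable b2 mE1 mE2 bU2 uv; exact.
- by split=> //; rewrite -(csl_hom_le hphi bphi).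
- by split=> //; rewrite -(csl_hom_le hpsi bpsi).
- exact: kill.
- exact: kill.
Qed.

Lemma isom_Morita :
  exists (V1 : set (bop H1 K1)) (V2 : set (bop H2 K2))
         (W1 : set (bop K1 H1)) (W2 : set (bop K2 H2)),
  [/\ [/\ bimodule E1 D1 V1, bimodule E2 D2 V2,
          bimodule D1 E1 W1 & bimodule D2 E2 W2],
      bl_space S1 = wspan (mulset (mulset W2 (bl_space S2)) V1),
      bl_space S2 = wspan (mulset (mulset V2 (bl_space S1)) W1) &
      [/\ unital_algebra (wspan (mulset V1 W1)),
          unital_algebra (wspan (mulset W1 V1)),
          unital_algebra (wspan (mulset V2 W2)) &
          unital_algebra (wspan (mulset W2 V2))]].
Proof.
have [[hphi hpsi hS] bphi bpsi _] := S12.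
have g1 : csl_graph left_graph by exact: (iso_graph_csl hphi bphi).
have g2 : csl_graph right_graph by apply: compl_graph_csl; exact: (iso_graph_csl hpsi bpsi).
have U12 : mulset (mulset (graph_op right_graph) (bl_space S1)) (graph_op (swap left_graph))
    `<=` bl_space S2.
  apply: graph_op_conj => P' Q' /bl_isomE[P [Q [SPQ -> ->]]].
  have [A [B [[LA LB] [_ PA] [_ QB] AB _]]] := reduced_pair SPQ.
  by exists A, (phi A), B, (psi B).
have U21 : mulset (mulset (graph_op (swap right_graph)) (bl_space S2)) (graph_op left_graph)
    `<=` bl_space S1.
  apply: (@graph_op_conj _ _ _ _ _ (swap left_graph) (swap right_graph)) => P Q SPQ.
  have [A [B [[LA LB] [PA _] [QB _] _ AB]]] := reduced_pair SPQ.
  by exists (phi A), A, (psi B), B.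
have comm_compl (V : hilbertType R) (D : set (bop V V)) P : comm_op D (pcompl P) -> comm_op D P.
  move=> DP T DT x; have := DP T DT x; rewrite !pcomplE linearB/= => h.
  by apply: oppr_inj; apply: (addrI (T x)).
exists (graph_op left_graph), (graph_op right_graph), (graph_op (swap left_graph)),
  (graph_op (swap right_graph)); split.
- split; apply: graph_op_bimodule => P P' [] //= _ _ c1 c2; split=> //; exact: comm_compl.
- by apply: wspan_conj => //; exact: bl_space_wclosed.
- apply: (@wspan_conj _ _ _ _ _ (swap left_graph) (swap right_graph)) => //.
  + exact: csl_graph_swap.
  + exact: csl_graph_swap.
  + exact: bl_space_wclosed.
- split; [exact: graph_op_unital| |exact: graph_op_unital|].
    exact: graph_op_unital (csl_graph_swap g1).
  exact: graph_op_unital (csl_graph_swap g2).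
Qed.

End Isomorphism.

Section Masas.
Context {R : realType}.
Implicit Types H K : hilbertType R.

Lemma commuting_masa H (L : set (projection H)) : commuting L ->
  exists2 D, masa D & forall P, L P -> comm_op D P.
Proof.
move=> Lc; have [|D0 sD0 LD0] := @bicommutant_abelian _ _ L.
  by move=> P Q LP LQ x; have /bopP/(_ x) := Lc _ _ LP LQ.
have [D mD D0D] := masa_exists sD0; exists D => // P LP T DT x.
have [[_ _ _ Dc] _] := mD.
by have /bopP/(_ x) := Dc _ _ DT (D0D _ (LD0 _ LP)).
Qed.

Lemma bl_space_bimodule H K (S : set (projection H * projection K)) D E :
  (forall P, bl_left S P -> comm_op D P) -> (forall Q, bl_right S Q -> comm_op E Q) ->
  bimodule E D (bl_space S).
Proof.
move=> SD SE; split.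
  split=> [P Q SPQ|a T T' ST ST' P Q SPQ]; apply: eq_bop => x; rewrite !compopE.
    by rewrite bop0E linear0.
  have /bopP/(_ x) := ST _ _ SPQ; have /bopP/(_ x) := ST' _ _ SPQ.
  by rewrite !compopE bop0E bopDE bopZE linearP/= => -> ->; rewrite scaler0 addr0.
move=> _ [_ [A EA [T ST <-]] [B DB <-]] P Q SPQ; apply: eq_bop => x; rewrite !compopE.
rewrite (SD P _ _ DB); last by exists (P, Q).
rewrite -(SE Q _ _ EA); last by exists (P, Q).
by have /bopP/(_ (B x)) := ST _ _ SPQ; rewrite !compopE => ->; rewrite bop0E linear0.
Qed.

End Masas.

Local Close Scope ring_scope.
Local Close Scope complex_scope.

Theorem theorem3p1 (R : realType) (H1 H2 K1 K2 : hilbertType R)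
    (S1 : set (projection H1 * projection H2))
    (S2 : set (projection K1 * projection K2))
    (S1_bilattice : is_bilattice S1) (S2_bilattice : is_bilattice S2)
    (S1_commutative : bl_commutative S1) (S2_commutative : bl_commutative S2)
    (S1_closed : strongly_closed S1) (S2_closed : strongly_closed S2)
    (S12_isomorphic : bl_isomorphic S1 S2)
    (U1_nondegenerate : nondegenerate_op (bl_space S1))
    (U2_nondegenerate : nondegenerate_op (bl_space S2)) :
  (exists D1 D2 E1 E2,
    nondegenerate_bimodules D1 D2 E1 E2 (bl_space S1) (bl_space S2)) /\
  (forall D1 D2 E1 E2,
    nondegenerate_bimodules D1 D2 E1 E2 (bl_space S1) (bl_space S2) ->
    spatially_Morita_equivalent D1 D2 E1 E2 (bl_space S1) (bl_space S2)).
Proof.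
have b1 := bilattice_bilat S1_bilattice S1_commutative S1_closed.
have b2 := bilattice_bilat S2_bilattice S2_commutative S2_closed.
have [phi [psi iso]] := S12_isomorphic; split=> [|D1 D2 E1 E2 nd]; last first.
  split=> //; have [[mD1 mD2 mE1 mE2] [bU1 _ bU2 _]] := nd.
  exact: (isom_Morita b1 b2 iso mD1 mD2 mE1 mE2 bU1 bU2).
(* Masas commuting with the bilattices show that the second half is not vacuous. *)
have [D1 mD1 cD1] := commuting_masa S1_commutative.1.
have [D2 mD2 cD2] := commuting_masa S1_commutative.2.
have [E1 mE1 cE1] := commuting_masa S2_commutative.1.
have [E2 mE2 cE2] := commuting_masa S2_commutative.2.
by exists D1, D2, E1, E2; split; split=> //; exact: bl_space_bimodule.
Qed.
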